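(* Let $h_n>0$ and $T=nh_n$. Assume that each of the drifts $B_1,\dots,B_4$ is globally Lipschitz and of class $C^4$ with all partial derivatives of order $0$ to $4$ of polynomial growth, that $\sup_{t}\mathbb{E}[|Y_t|^{\ell}]<\infty$ for all $\ell\ge 0$ and each $Y\in\{\xi_0,\delta_0,\varepsilon_0,\zeta_0\}$, and that each such $Y$ is ergodic with an invariant measure $\pi_Y$: for every $\pi_Y$-integrable $g$, $\frac1T\int_0^Tg(Y_t)dt\to\int g\,d\pi_Y$ in probability as $T\to\infty$. Then, as $h_n\to0$ and $nh_n\to\infty$, $\mathbb{Q}_{\mathbb{XX}}\to\mathbf{\Sigma}_0$ in probability. If in addition $nh_n^2\to0$, then $$\sqrt{n}\,(\operatorname{vech}\mathbb{Q}_{\mathbb{XX}}-\operatorname{vech}\mathbf{\Sigma}_0)\ \to\ N_{\bar p}\bigl(0,\ 2\mathbb{D}_p^{+}(\mathbf{\Sigma}_0\otimes\mathbf{\Sigma}_0)\mathbb{D}_p^{+\top}\bigr)\quad\text{in distribution.}$$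
   Context: Notation: for a symmetric $p\times p$ matrix $A$, $\operatorname{vech}A$ is the half-vectorization and $\mathbb{D}_p$ is the $p^2\times\bar p$ duplication matrix, $\operatorname{vec}A=\mathbb{D}_p\operatorname{vech}A$; $A^{+}$ is the Moore-Penrose inverse. True model and data: $p_1,p_2,k_1,k_2,r_1,\dots,r_4\ge 1$ are fixed integers with $k_1\le p_1$, $k_2\le p_2$; $p=p_1+p_2$, $\bar p=p(p+1)/2$. $W_1,\dots,W_4$ are independent standard Wiener processes of dimensions $r_1,\dots,r_4$. The latent processes $\xi_0,\delta_0,\varepsilon_0,\zeta_0$, with values in $\mathbb{R}^{k_1},\mathbb{R}^{p_1},\mathbb{R}^{p_2},\mathbb{R}^{k_2}$, solve for $t\ge0$: $d\xi_{0,t}=B_1(\xi_{0,t})dt+\mathbf{S}_{1,0}dW_{1,t}$, $d\delta_{0,t}=B_2(\delta_{0,t})dt+\mathbf{S}_{2,0}dW_{2,t}$, $d\varepsilon_{0,t}=B_3(\varepsilon_{0,t})dt+\mathbf{S}_{3,0}dW_{3,t}$, $d\zeta_{0,t}=B_4(\zeta_{0,t})dt+\mathbf{S}_{4,0}dW_{4,t}$, with deterministic initial values $c_1,\dots,c_4$ and constant matrices $\mathbf{S}_{i,0}$. Put $\mathbf{\Sigma}_{\xi\xi,0}=\mathbf{S}_{1,0}\mathbf{S}_{1,0}^\top$, $\mathbf{\Sigma}_{\delta\delta,0}=\mathbf{S}_{2,0}\mathbf{S}_{2,0}^\top$, $\mathbf{\Sigma}_{\varepsilon\varepsilon,0}=\mathbf{S}_{3,0}\mathbf{S}_{3,0}^\top$,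 $\mathbf{\Sigma}_{\zeta\zeta,0}=\mathbf{S}_{4,0}\mathbf{S}_{4,0}^\top$; $\mathbf{\Sigma}_{\delta\delta,0}$ and $\mathbf{\Sigma}_{\varepsilon\varepsilon,0}$ are positive definite. Constant matrices: $\mathbf{\Lambda}_{x_1,0}\in\mathbb{R}^{p_1\times k_1}$ of full column rank, $\mathbf{\Lambda}_{x_2,0}\in\mathbb{R}^{p_2\times k_2}$, $\mathbf{\Gamma}_0\in\mathbb{R}^{k_2\times k_1}$, $\mathbf{B}_0\in\mathbb{R}^{k_2\times k_2}$ with zero diagonal, $\mathbf{\Psi}_0=\mathbb{I}_{k_2}-\mathbf{B}_0$ non-singular. The observed process is $\mathbb{X}_t=(\mathbb{X}_{1,t}^\top,\mathbb{X}_{2,t}^\top)^\top$ with $\mathbb{X}_{1,t}=\mathbf{\Lambda}_{x_1,0}\xi_{0,t}+\delta_{0,t}$, $\mathbb{X}_{2,t}=\mathbf{\Lambda}_{x_2,0}\eta_{0,t}+\varepsilon_{0,t}$, $\eta_{0,t}=\mathbf{B}_0\eta_{0,t}+\mathbf{\Gamma}_0\xi_{0,t}+\zeta_{0,t}$. Set $$\mathbf{\Sigma}_0=\begin{pmatrix}\mathbf{\Sigma}_0^{11}&\mathbf{\Sigma}_0^{12}\\ \mathbf{\Sigma}_0^{12\top}&\mathbf{\Sigma}_0^{22}\end{pmatrix},$$ $\mathbf{\Sigma}_0^{11}=\mathbf{\Lambda}_{x_1,0}\mathbf{\Sigma}_{\xi\xi,0}\mathbf{\Lambda}_{x_1,0}^\top+\mathbf{\Sigma}_{\delta\delta,0}$,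 $\mathbf{\Sigma}_0^{12}=\mathbf{\Lambda}_{x_1,0}\mathbf{\Sigma}_{\xi\xi,0}\mathbf{\Gamma}_0^\top\mathbf{\Psi}_0^{-1\top}\mathbf{\Lambda}_{x_2,0}^\top$, $\mathbf{\Sigma}_0^{22}=\mathbf{\Lambda}_{x_2,0}\mathbf{\Psi}_0^{-1}(\mathbf{\Gamma}_0\mathbf{\Sigma}_{\xi\xi,0}\mathbf{\Gamma}_0^\top+\mathbf{\Sigma}_{\zeta\zeta,0})\mathbf{\Psi}_0^{-1\top}\mathbf{\Lambda}_{x_2,0}^\top+\mathbf{\Sigma}_{\varepsilon\varepsilon,0}$. With $t_i^n=ih_n$ and $T=nh_n$, the realized covariance is $\mathbb{Q}_{\mathbb{XX}}=\frac1T\sum_{i=1}^n(\mathbb{X}_{t_i^n}-\mathbb{X}_{t_{i-1}^n})(\mathbb{X}_{t_i^n}-\mathbb{X}_{t_{i-1}^n})^\top$. *)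

(* Defs.v *)
From HB Require Import structures.
From mathcomp Require Import all_boot all_order all_algebra.
From mathcomp Require Import all_classical all_reals all_analysis.
From mathcomp Require Import mxtens.
Set Implicit Arguments.
Unset Strict Implicit.
Unset Printing Implicit Defensive.
Import Order.TTheory GRing.Theory Num.Theory.
Import numFieldNormedType.Exports.
Local Open Scope classical_set_scope.
Local Open Scope ring_scope.

(* `|x| on vectors and matrices is the sup norm; every notion below depends on
   the norm only up to equivalence. *)

Section matrices.
Variable R : realType.

Definition posdef n (A : 'M[R]_n) :=
  A^T = A /\ forall x : 'cV[R]_n, x != 0 -> 0 < (x^T *m A *m x) 0 0.

Definition moore_penrose m n (A : 'M[R]_(m, n)) (X : 'M[R]_(n, m)) :=
  [/\ A *m X *m A = A, X *m A *m X = X,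
      (A *m X)^T = A *m X & (X *m A)^T = X *m A].

Definition mpinv m n (A : 'M[R]_(m, n)) : 'M[R]_(n, m) :=
  xget 0 [set X | moore_penrose A X].

(* mxtens_unindex (i * p + j) = (i, j): vec stacks the columns, matching the
   index convention of the Kronecker product *t. *)
Definition vec p (A : 'M[R]_p) : 'cV[R]_(p * p) :=
  \col_k A (mxtens_unindex k).2 (mxtens_unindex k).1.

Definition pbar p := (p * p.+1)./2.

(* Positions (row, column) on or below the diagonal, column by column. *)
Definition vech_seq p : seq ('I_p * 'I_p) :=
  [seq (i, j) | j : 'I_p <- enum 'I_p,
                i : 'I_p <- [seq i : 'I_p <- enum 'I_p | (j <= i)%N]].

Lemma size_vech_seq p : size (vech_seq p) == pbar p.
Proof.
apply/eqP; rewrite /vech_seq size_allpairs_dep sumnE big_map big_enum /=.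
transitivity (\sum_(j < p) (p - j))%N.
  apply: eq_bigr => j _; rewrite size_filter.
  rewrite -(count_map val (fun i => j <= i)%N) val_enum_ord.
  have jp : (j <= p)%N by exact: ltnW.
  rewrite -[in iota _ _](subnKC jp) iotaD count_cat.
  rewrite (_ : count _ (iota 0 j) = 0%N); last first.
    apply/eqP; rewrite -leqn0 leqNgt -has_count; apply/hasPn => i.
    by rewrite mem_iota add0n /= -ltnNge.
  have /eqP -> : count (fun i => j <= i)%N (iota (0 + j) (p - j)) ==
      size (iota (0 + j) (p - j)).
    by rewrite -all_count; apply/allP => i; rewrite mem_iota; case/andP.
  by rewrite size_iota.
transitivity (\sum_(j < p) j.+1)%N.
  rewrite (reindex_inj rev_ord_inj) /=; apply: eq_bigr => j _.
  by rewrite subKn.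
rewrite -(big_mkord xpredT S) -[LHS]add0n -(big_nat_recl _ _ id) //.
by rewrite bin2_sum bin2 mulnC.
Qed.

Definition vech_index p : (pbar p).-tuple ('I_p * 'I_p) :=
  Tuple (size_vech_seq p).

Definition vech p (A : 'M[R]_p) : 'cV[R]_(pbar p) :=
  \col_k A (tnth (vech_index p) k).1 (tnth (vech_index p) k).2.

Definition dupmx p : 'M[R]_(p * p, pbar p) :=
  \matrix_(k, l)
    let: (j, i) := mxtens_unindex k in
    ((tnth (vech_index p) l == (i, j)) || (tnth (vech_index p) l == (j, i)))%:R.

Lemma dupmxP p (A : 'M[R]_p) : A^T = A -> vec A = dupmx p *m vech A.
Proof.
move=> Asym; apply/matrixP => k z; rewrite !mxE.
case E : (mxtens_unindex k) => [j i] /=.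
have uv : uniq (vech_index p).
  apply: allpairs_uniq_dep => /=; first exact: enum_uniq.
    by move=> x _; rewrite filter_uniq ?enum_uniq.
  by move=> [a b] [c d] _ _ [-> ->].
have memv (a b : 'I_p) : (b <= a)%N -> (a, b) \in vech_index p.
  move=> ba; apply/allpairsPdep; exists b, a.
  by rewrite mem_enum mem_filter ba mem_enum.
have [a [b [ab Aab hab]]] : exists a b : 'I_p, [/\ (b <= a)%N, A i j = A a b &
    forall x, ((x == (i, j)) || (x == (j, i))) =
      (x == (a, b)) || (x == (b, a))].
  have [le|lt] := leqP j i; first by exists i, j; split.
  exists j, i; split; [exact: ltnW| |by move=> x; rewrite orbC].
  by rewrite -[in LHS]Asym mxE.
have /tnthP[l0 El0] := memv a b ab.
rewrite (bigD1 l0) //= !mxE E hab -El0 eqxx mul1r big1 ?addr0 // => l ll0.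
rewrite !mxE E hab; case: eqP => [e|_] /=.
  by move: ll0; rewrite -(inj_eq (tuple_uniqP _ uv)) -El0 e eqxx.
case: eqP => [e|_]; rewrite ?mul0r //.
have : tnth (vech_index p) l \in vech_index p by exact: mem_tnth.
rewrite e => /allpairsPdep[c [d [_]]]; rewrite mem_filter => /andP[cd _] [? ?].
subst c d; have ? : a = b by apply/val_inj/eqP; rewrite eqn_leq cd ab.
by subst b; move: ll0; rewrite -(inj_eq (tuple_uniqP _ uv)) -El0 e eqxx.
Qed.

Lemma unitmx_gram m n (C : 'M[R]_(m, n)) : row_free C -> C *m C^T \in unitmx.
Proof.
move=> fC; rewrite -row_free_unit -kermx_eq0; apply/eqP/row_matrixP => i.
rewrite row0; set v := row i _.
have vCC : v *m C *m C^T = 0 by rewrite -mulmxA -row_mul mulmx_ker row0.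
have : (v *m C) *m (v *m C)^T = 0 by rewrite trmx_mul mulmxA vCC mul0mx.
move/matrixP/(_ 0 0); rewrite !mxE => /eqP.
rewrite psumr_eq0; last by move=> j _; rewrite [X in _ * X]mxE sqr_ge0.
move=> /allP vC0; apply: (row_free_inj fC); rewrite mul0mx.
apply/rowP => j; have := vC0 j; rewrite mem_index_enum => /(_ isT).
by rewrite /= !mxE mulf_eq0 orbb => /eqP.
Qed.

Lemma mpinvP m n (A : 'M[R]_(m, n)) : moore_penrose A (mpinv A).
Proof.
rewrite /mpinv; case: xgetP => [X -> //|/(_ _) noX]; exfalso.
have [r [C [F [ACF uF uC]]]] : exists r (C : 'M[R]_(m, r)) (F : 'M[R]_(r, n)),
    [/\ C *m F = A, F *m F^T \in unitmx & C^T *m C \in unitmx].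
  exists (\rank A), (col_base A), (row_base A); split; first exact: mulmx_base.
    exact/unitmx_gram/row_base_free.
  rewrite -[X in _ *m X]trmxK; apply: unitmx_gram.
  by rewrite /row_free mxrank_tr; exact: col_base_full.
have iF : (invmx (F *m F^T))^T = invmx (F *m F^T).
  by rewrite trmx_inv trmx_mul trmxK.
have iC : (invmx (C^T *m C))^T = invmx (C^T *m C).
  by rewrite trmx_inv trmx_mul trmxK.
pose X := F^T *m invmx (F *m F^T) *m (invmx (C^T *m C) *m C^T).
have AX : A *m X = C *m invmx (C^T *m C) *m C^T.
  transitivity (C *m F *m X); first by rewrite ACF.
  rewrite /X !mulmxA; congr (_ *m _); congr (_ *m _).
  by rewrite -[C *m F *m F^T]mulmxA mulmxK.
have XA : X *m A = F^T *m invmx (F *m F^T) *m F.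
  transitivity (X *m (C *m F)); first by rewrite ACF.
  rewrite /X !mulmxA; congr (_ *m _).
  by rewrite -[_ *m C^T *m C]mulmxA mulmxKV.
apply: (noX X); split.
- rewrite AX; transitivity (C *m invmx (C^T *m C) *m C^T *m (C *m F)).
    by rewrite ACF.
  by rewrite !mulmxA -[_ *m C^T *m C]mulmxA mulmxKV.
- by rewrite XA /X !mulmxA -[_ *m F *m F^T]mulmxA mulmxKV.
- by rewrite AX !trmx_mul trmxK iC mulmxA.
- by rewrite XA !trmx_mul trmxK iF mulmxA.
Qed.

End matrices.

Section drifts.
Variables (R : realType) (k : nat).
Implicit Type f : 'cV[R]_k -> 'cV[R]_k.

Definition pderiv f (s : seq 'I_k) : 'cV[R]_k -> 'cV[R]_k :=
  foldr (fun i g => 'D_(delta_mx i 0) g) f s.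

Definition classC (m : nat) f := forall s : seq 'I_k, (size s <= m)%N ->
  continuous (pderiv f s) /\
  ((size s < m)%N -> forall i x, derivable (pderiv f s) x (delta_mx i 0)).

Definition poly_growth f :=
  exists (C : R) (q : nat), forall x, `|f x| <= C * (1 + `|x|) ^+ q.

Definition drift_regular f :=
  [/\ lipschitz f, classC 4 f &
      forall s : seq 'I_k, (size s <= 4)%N -> poly_growth (pderiv f s)].

End drifts.

Definition borel_cV (R : realType) (n : nat) :=
  g_sigma_algebraType (@open 'cV[R]_n).

(* mathcomp's normal_prob takes the standard deviation and is not a Dirac mass
   when the latter is 0. *)
Definition normal_law (R : realType) (m v : R) (A : set R) : \bar R :=
  if v == 0 then \d_m A else normal_prob m (Num.sqrt v) A.

(* mu is the normal law N_n(m, V): every linear form is univariate normal. *)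
Definition gaussian_law (R : realType) (n : nat)
    (mu : probability (borel_cV R n) R) (m : 'cV[R]_n) (V : 'M[R]_n) :=
  forall (u : 'cV[R]_n) (A : set R), measurable A ->
    mu [set x : 'cV[R]_n | A ((u^T *m x) 0 0)] =
    normal_law ((u^T *m m) 0 0) ((u^T *m V *m u) 0 0) A.

Section probability.
Variables (d : measure_display) (T : measurableType d) (R : realType).
Variable P : probability T R.

Definition cvg_in_probability (I : Type) (F : set_system I)
    (V : normedZmodType R) (Z : I -> T -> V) (l : V) :=
  forall e : R, 0 < e ->
    P [set w | e <= `|Z i w - l|] @[i --> F] --> 0%E.

Definition cvg_in_distribution (n : nat) (Z : nat -> T -> 'cV[R]_n)
    (mu : probability (borel_cV R n) R) :=
  forall f : 'cV[R]_n -> R, continuous f -> (exists M, forall x, `|f x| <= M) ->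
    ('E_P[f \o Z N] @[N --> \oo] --> \int[mu]_x (f x)%:E)%E.

(* Mutual independence of a finite family of set systems: product rule over
   every subfamily. *)
Definition independent_systems (I : finType) (F : I -> set (set T)) :=
  forall (J : {set I}) (A : I -> set T), (forall i, i \in J -> F i (A i)) ->
    P (\bigcap_(i in [set` J]) A i) = (\prod_(i in J) P (A i))%E.

Definition sigma_rv (d' : measure_display) (T' : measurableType d')
    (X : T -> T') : set (set T) := preimage_set_system setT X measurable.

Definition sigma_process (d' : measure_display) (T' : measurableType d')
    (Y : R -> T -> T') : set (set T) :=
  <<s [set B | exists2 t, 0 <= t & sigma_rv (Y t) B] >>.

(* Processes are indexed by R but only their values at times t >= 0 matter. *)
Definition wiener1 (b : R -> T -> R) :=
  [/\ forall t, 0 <= t -> measurable_fun setT (b t),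
      \forall w \ae P, b 0 w = 0,
      forall (m : nat) (t : nat -> R), 0 <= t 0%N ->
        {homo t : i j / (i <= j)%N >-> i <= j} ->
        independent_systems
          (fun i : 'I_m => sigma_rv (fun w => b (t i.+1) w - b (t i) w)),
      forall (s t : R) (A : set R), 0 <= s -> s < t -> measurable A ->
        P [set w | A (b t w - b s w)] = normal_prob 0 (Num.sqrt (t - s)) A &
      \forall w \ae P, {within `[0, +oo[, continuous (b ^~ w)}].

Definition wiener (r : nat) (W : R -> T -> 'cV[R]_r) :=
  (forall i, wiener1 (fun t w => W t w i 0)) /\
  independent_systems (fun i => sigma_process (fun t w => W t w i 0)).

Definition independent4 (r1 r2 r3 r4 : nat)
    (W1 : R -> T -> 'cV[R]_r1) (W2 : R -> T -> 'cV[R]_r2)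
    (W3 : R -> T -> 'cV[R]_r3) (W4 : R -> T -> 'cV[R]_r4) :=
  independent_systems (tnth [tuple
    sigma_process (W1 : R -> T -> borel_cV R r1);
    sigma_process (W2 : R -> T -> borel_cV R r2);
    sigma_process (W3 : R -> T -> borel_cV R r3);
    sigma_process (W4 : R -> T -> borel_cV R r4)]).

Section latent.
Variables (k r : nat) (W : R -> T -> 'cV[R]_r) (B : 'cV[R]_k -> 'cV[R]_k).
Variable S : 'M[R]_(k, r).

(* dY = B(Y) dt + S dW, Y_0 = c. As S is constant the stochastic integral is
   S W_t. For Lipschitz B a solution is a pathwise functional of W, so that
   adaptedness need not be required. *)
Definition sde_solution (c : 'cV[R]_k) (Y : R -> T -> 'cV[R]_k) :=
  [/\ forall t, 0 <= t -> measurable_fun setT (Y t : T -> borel_cV R k),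
      forall w, {within `[0, +oo[, continuous (Y ^~ w)} &
      \forall w \ae P, forall t, 0 <= t ->
        Y t w = c + \col_i (\int[lebesgue_measure]_(s in `[0, t]) B (Y s w) i 0)
                  + S *m W t w].

(* pi is invariant for the transition semigroup P_t(x, A) = P(Y^x_t \in A),
   where Y^x denotes the solution started from x. *)
Definition invariant_law (pi : probability (borel_cV R k) R) :=
  forall Y : 'cV[R]_k -> R -> T -> 'cV[R]_k,
    (forall x, sde_solution x (Y x)) ->
    forall (t : R) (A : set (borel_cV R k)), 0 <= t -> measurable A ->
      (\int[pi]_x P [set w | A (Y x t w)] = pi A)%E.

Definition ergodic (Y : R -> T -> 'cV[R]_k) :=
  exists2 pi : probability (borel_cV R k) R, invariant_law pi &
    forall g : borel_cV R k -> R, pi.-integrable setT (EFin \o g) ->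
      cvg_in_probability (pinfty_nbhs R)
        (fun t w => t^-1 * \int[lebesgue_measure]_(s in `[0, t]) g (Y s w) : R)
        (\int[pi]_x g x).

Definition bounded_moments (Y : R -> T -> 'cV[R]_k) :=
  forall l : R, 0 <= l ->
    exists M : R, forall t, 0 <= t -> ('E_P[fun w => (`|Y t w| `^ l)%R] <= M%:E)%E.

Definition latent_process (c : 'cV[R]_k) (Y : R -> T -> 'cV[R]_k) :=
  [/\ sde_solution c Y, drift_regular B, bounded_moments Y & ergodic Y].

End latent.

Definition realized_cov (p : nat) (X : R -> T -> 'cV[R]_p) (h : R) (n : nat)
    (w : T) : 'M[R]_p :=
  (n%:R * h)^-1 *: \sum_(1 <= i < n.+1)
    ((X (i%:R * h) w - X (i.-1%:R * h) w) *m
     (X (i%:R * h) w - X (i.-1%:R * h) w)^T).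

End probability.

(* Main.v *)
Require Import Defs.
From HB Require Import structures.
From mathcomp Require Import all_boot all_order all_algebra.
From mathcomp Require Import all_classical all_reals all_analysis.
From mathcomp Require Import measurable_realfun mxtens ring lra.
Set Implicit Arguments.
Unset Strict Implicit.
Unset Printing Implicit Defensive.
Import Order.TTheory GRing.Theory Num.Theory.
Import numFieldNormedType.Exports.
Local Open Scope classical_set_scope.
Local Open Scope ring_scope.

(** The four latent processes are stacked into one diffusion Y, driven by one
    Wiener process W, with diffusion matrix S, and X = C Y.  An increment of X
    over a step of length h is then L dW plus a drift term, with L = C S, and
    Sigma_0 = L L^T.  The drift terms are negligible even after multiplication
    by sqrt n: the drift at the left end point is a limit of Euler schemes, hence
    uncorrelated with the increment of W, and the remainder of the realized
    covariance has mean absolute value O(h + sqrt (h / n)).  What is left is an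
    average of i.i.d. quadratic forms in standard Gaussian vectors.

    For a linear form of the normalised average, E cos (. + t) is compared with
    its Gaussian value by replacing the summands one at a time (Lindeberg); the
    Gaussian summands are increments of a coordinate of W on a time interval
    whose length is the variance.  Convergence of all E cos (u . Z + t) implies
    convergence in distribution, since continuous functions are approximated on
    boxes by Bernstein polynomials in sines, and bounded first moments give
    tightness.  Isserlis' formula and the algebra of the duplication
    matrix identify the covariance. *)

(** * Expectation and independence *)

(** The bounds are tuned to one scaling. Multiplied by sqrt n, the remainder h + sqrt (h / n)
    becomes sqrt (n h^2) + sqrt h, which is where the condition n h^2 -> 0 enters. The critical
    terms are the products of a drift with a Wiener increment: estimated one by one they contribute
    sqrt h to the realized covariance, and sqrt (n h) diverges. Only their orthogonality brings them
    down to sqrt (h / n), and orthogonality asks that the drift at the left end point be independent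
    of the coming increment, while a solution is given only as a pathwise identity. The Euler
    schemes answer this, being explicit functions of past increments. Cosines with an arbitrary
    phase t carry the information of the characteristic function without leaving the reals, and the
    phase absorbs the summands that are not being replaced. Cutting the Gaussian comparison
    variables out of the given Wiener process keeps everything on one probability space. *)

Section expectation.
Variables (d : measure_display) (T : measurableType d) (R : realType).
Variable P : probability T R.
Implicit Types X Y : T -> R.

Definition itg X := P.-integrable setT (EFin \o X).
(** Expectations are real numbers, so that [ring], [field] and [nra] apply to them; the price is an
    integrability side condition, since [Rintegral] sends an infinite integral to 0. *)
Definition ex X : R := \int[P]_w X w.

Lemma itg_meas X : itg X -> measurable_fun setT X.
Proof. by move=> /measurable_int/measurable_EFinP. Qed.

Lemma expectationE X : itg X -> ('E_P[X] = (ex X)%:E)%E.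
Proof.
move=> iX; rewrite unlock /ex /Rintegral fineK//.
exact: integrable_fin_num.
Qed.

Lemma itg_le X Y : measurable_fun setT X -> (forall w, `|X w| <= Y w) ->
  itg Y -> itg X.
Proof.
move=> mX XY; apply: le_integrable => //; first exact/measurable_EFinP.
by move=> w _; rewrite /= lee_fin (le_trans (XY w))// ler_norm.
Qed.

Lemma itg_cst (c : R) : itg (fun=> c).
Proof. exact: finite_measure_integrable_cst. Qed.

Lemma itg_bounded X (M : R) : measurable_fun setT X ->
  (forall w, `|X w| <= M) -> itg X.
Proof. by move=> mX XM; apply: (itg_le mX XM); exact: itg_cst. Qed.

Lemma itgD X Y : itg X -> itg Y -> itg (fun w => X w + Y w).
Proof. by move=> iX iY; have := integrableD measurableT iX iY. Qed.

Lemma itgZ (c : R) X : itg X -> itg (fun w => c * X w).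
Proof. by move=> iX; have := integrableZl measurableT c iX. Qed.

Lemma itgN X : itg X -> itg (fun w => - X w).
Proof. by move=> iX; under eq_fun do rewrite -mulN1r; exact: itgZ. Qed.

Lemma itgB X Y : itg X -> itg Y -> itg (fun w => X w - Y w).
Proof. by move=> iX iY; apply: itgD => //; exact: itgN. Qed.

Lemma itg_norm X : itg X -> itg (fun w => `|X w|).
Proof. exact: integrable_norm. Qed.

Lemma itg_sum (I : Type) (s : seq I) (p : pred I) (F : I -> T -> R) :
  (forall i, p i -> itg (F i)) -> itg (fun w => \sum_(i <- s | p i) F i w).
Proof.
move=> iF; rewrite /itg.
rewrite [X in _.-integrable _ X](_ : _ =
    fun w => (\sum_(i <- s | p i) (F i w)%:E)%E); first exact: integrable_sum.
by apply/funext => w; rewrite /= sumEFin.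
Qed.

Lemma exD X Y : itg X -> itg Y -> ex (fun w => X w + Y w) = ex X + ex Y.
Proof. by move=> iX iY; rewrite /ex RintegralD. Qed.

Lemma exB X Y : itg X -> itg Y -> ex (fun w => X w - Y w) = ex X - ex Y.
Proof. by move=> iX iY; rewrite /ex RintegralB. Qed.

Lemma exZ (c : R) X : itg X -> ex (fun w => c * X w) = c * ex X.
Proof. by move=> iX; rewrite /ex RintegralZl. Qed.

Lemma ex_cst (c : R) : ex (fun=> c) = c.
Proof.
rewrite /ex Rintegral_cst//.
by rewrite -[X in fine X]/(P setT) probability_setT mulr1.
Qed.

Lemma ex_sum (I : Type) (s : seq I) (p : pred I) (F : I -> T -> R) :
  (forall i, p i -> itg (F i)) ->
  ex (fun w => \sum_(i <- s | p i) F i w) = \sum_(i <- s | p i) ex (F i).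
Proof.
move=> iF; elim: s => [|i s IH].
  by rewrite big_nil; under eq_fun do rewrite big_nil; exact: ex_cst.
rewrite big_cons; under eq_fun do rewrite big_cons; case: ifPn => // pi.
by rewrite exD ?IH//; [exact: iF|exact: itg_sum].
Qed.

Lemma ex_le X Y : itg X -> itg Y -> (forall w, X w <= Y w) -> ex X <= ex Y.
Proof. by move=> iX iY XY; apply: le_Rintegral => // w _; exact: XY. Qed.

Lemma ex_ge0 X : (forall w, 0 <= X w) -> 0 <= ex X.
Proof. by move=> X0; apply: Rintegral_ge0. Qed.

Lemma ex_norm X : itg X -> `|ex X| <= ex (fun w => `|X w|).
Proof. by move=> iX; exact: le_normr_Rintegral. Qed.

(** Integrability of the limit is part of the conclusion, as it is not known beforehand. This is the
    only passage to the limit for unbounded variables: it serves for Riemann sums, for Euler schemes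
    and for the removal of a truncation. *)
Lemma itg_fatou (X_ : nat -> T -> R) X (M : R) :
  (forall n, itg (X_ n)) -> (forall n w, 0 <= X_ n w) ->
  (forall n, ex (X_ n) <= M) -> measurable_fun setT X ->
  (\forall w \ae P, X_ n w @[n --> \oo] --> X w) ->
  (forall w, 0 <= X w) -> itg X /\ ex X <= M.
Proof.
move=> iX_ X_0 X_M mX X_X X0.
have le : (\int[P]_w (X w)%:E <= M%:E)%E.
  rewrite (ge0_ae_eq_integral (g := fun w => limn_einf (fun n => (X_ n w)%:E)))//.
  - apply: (le_trans (fatou _ _ _ _)) => //.
    + by move=> n; apply: (measurable_int P); exact: iX_.
    + by move=> n w _; rewrite lee_fin.
    + rewrite limn_einf_lim; apply: lime_le; first exact: is_cvg_einfs.
      apply: nearW => n; rewrite /einfs.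
      apply: (@le_trans _ _ (\int[P]_w (X_ n w)%:E)%E).
        by apply: ge_ereal_inf; exists (\int[P]_w (X_ n w)%:E)%E => //; exists n => /=.
      by rewrite -(fineK (integrable_fin_num _ (iX_ n)))// lee_fin X_M.
  - exact/measurable_EFinP.
  (* The lower limit is measurable as the opposite of an upper limit. *)
  - rewrite (_ : (fun w => _) = fun w =>
        (- limn_esup (fun n => - (X_ n w)%:E))%E); last first.
      apply/funext => w; rewrite -limn_einfN; congr limn_einf.
      by apply/funext => n; exact/esym/oppeK.
    apply/measurableT_comp => //; apply: measurable_fun_limn_esup => n.
    apply/measurableT_comp => //.
    by apply: (measurable_int P); exact: iX_.
  - by move=> w _; rewrite lee_fin.
  - move=> w _; rewrite limn_einf_lim; apply: lime_ge; first exact: is_cvg_einfs.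
    by apply: nearW => n; apply: le_ereal_inf_tmp => _ [m /= _ <-]; rewrite lee_fin.
  - apply: filterS X_X => w Xw _.
    have h : ((X_ n w)%:E @[n --> \oo] --> (X w)%:E)%E by apply/cvg_EFin => //; exact: nearW.
    by have [-> _] := cvg_limn_einf_sup h.
have iX : itg X.
  apply/integrableP; split; first exact/measurable_EFinP.
  under eq_integral do rewrite /= ger0_norm//.
  by rewrite (le_lt_trans le)// ltry.
split => //; rewrite -lee_fin /ex /Rintegral fineK//.
exact: integrable_fin_num.
Qed.

Lemma ex_bounded_cvg (X_ : nat -> T -> R) X (M : R) :
  (forall n, measurable_fun setT (X_ n)) -> measurable_fun setT X ->
  (forall n w, `|X_ n w| <= M) ->
  (\forall w \ae P, X_ n w @[n --> \oo] --> X w) ->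
  ex (X_ n) @[n --> \oo] --> ex X.
Proof.
move=> mX_ mX X_M X_X.
have [] := @dominated_convergence _ _ _ P setT measurableT
  (fun n => EFin \o X_ n) (EFin \o X) (cst M%:E).
- by move=> n; exact/measurable_EFinP.
- exact/measurable_EFinP.
- by apply: filterS X_X => w Xw _; apply/cvg_EFin => //; exact: nearW.
- exact: itg_cst.
- by apply: aeW => w n _; rewrite /= lee_fin.
move=> iX _ h; rewrite /ex /Rintegral; apply: fine_cvg.
by rewrite fineK//; exact: integrable_fin_num.
Qed.

Lemma markov1 X (e : R) : 0 < e -> itg X ->
  (P [set w | (e <= `|X w|)%R] <= (e^-1 * ex (fun w => `|X w|))%:E)%E.
Proof.
move=> e0 iX; have mX := itg_meas iX.
rewrite EFinM -lee_pdivrMl ?invr_gt0// invrK.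
rewrite -(expectationE (itg_norm iX)).
pose X' : {mfun T >-> R} := HB.pack X (isMeasurableFun.Build _ _ _ _ X mX).
have := @markov _ _ _ P X' id e e0 (@measurable_id _ _ _).
by apply => // x y.
Qed.

(** Measurability of X is kept apart because it does not follow from that of its square. *)
Definition sqi X := measurable_fun setT X /\ itg (fun w => X w ^+ 2).

Lemma sqi_itgM X Y : sqi X -> sqi Y -> itg (fun w => X w * Y w).
Proof.
move=> [mX iX] [mY iY]; apply: (@itg_le _ (fun w => X w ^+ 2 + Y w ^+ 2)).
- exact: measurable_funM.
- move=> w; rewrite ler_norml; apply/andP.
  by split; have := sqr_ge0 (X w + Y w); have := sqr_ge0 (X w - Y w); nra.
- exact: itgD.
Qed.

Lemma sqi_cst (c : R) : sqi (fun=> c).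
Proof. by split => //; exact: itg_cst. Qed.

Lemma sqi_itg X : sqi X -> itg X.
Proof.
move=> sX; rewrite (_ : X = fun w => X w * 1); last first.
  by apply/funext => w; rewrite mulr1.
exact: (sqi_itgM sX (sqi_cst 1)).
Qed.

Lemma sqiD X Y : sqi X -> sqi Y -> sqi (fun w => X w + Y w).
Proof.
move=> sX sY; have [mX iX] := sX; have [mY iY] := sY; split.
  exact: measurable_funD.
have -> : (fun w => (X w + Y w) ^+ 2) =
    fun w => (X w ^+ 2 + 2 * (X w * Y w)) + Y w ^+ 2.
  by apply/funext => w; ring.
by apply: itgD => //; apply: itgD => //; apply: itgZ; exact: sqi_itgM.
Qed.

Lemma sqiZ (c : R) X : sqi X -> sqi (fun w => c * X w).
Proof.
move=> [mX iX]; split; first exact: measurable_funM.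
have -> : (fun w => (c * X w) ^+ 2) = fun w => c ^+ 2 * X w ^+ 2.
  by apply/funext => w; ring.
exact: itgZ.
Qed.

Lemma sqi_sum (I : Type) (s : seq I) (p : pred I) (F : I -> T -> R) :
  (forall i, p i -> sqi (F i)) -> sqi (fun w => \sum_(i <- s | p i) F i w).
Proof.
move=> sF; elim: s => [|i s IH].
  by under eq_fun do rewrite big_nil; exact: sqi_cst.
rewrite (_ : (fun w => _) = fun w => (if p i then F i w else 0) +
    \sum_(j <- s | p j) F j w); last first.
  by apply/funext => w; rewrite big_cons; case: ifP => //; rewrite add0r.
apply: sqiD => //; have [/sF//|_] := boolP (p i); exact: sqi_cst.
Qed.

(* The parameter a replaces Cauchy-Schwarz: the best choice balances the terms. *)
Lemma ex_normM_le X Y (a : R) : 0 < a -> sqi X -> sqi Y ->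
  ex (fun w => `|X w * Y w|) <=
  a * ex (fun w => X w ^+ 2) + a^-1 * ex (fun w => Y w ^+ 2).
Proof.
move=> a0 sX sY; have [_ iX] := sX; have [_ iY] := sY.
rewrite -exZ// -exZ// -exD//; [|exact: itgZ..].
apply: ex_le; first by apply: itg_norm; exact: sqi_itgM.
  by apply: itgD; exact: itgZ.
move=> w; rewrite normrM -(real_normK (num_real (X w))) -(real_normK (num_real (Y w))).
set x := `|X w|; set y := `|Y w|.
have x0 : 0 <= x by exact: normr_ge0.
have y0 : 0 <= y by exact: normr_ge0.
rewrite -subr_ge0 (_ : _ - _ = a^-1 * (a * x * (a * x - y) + y ^+ 2)); last first.
  by field; rewrite gt_eqF.
rewrite mulr_ge0 ?invr_ge0 ?(ltW a0)//.
have := sqr_ge0 (a * x - y); have := sqr_ge0 (a * x + y); nra.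
Qed.

(** With a the inverse of a bound on the L2 norm of X, the right-hand side is of the order of that
    bound. *)
Lemma ex_norm_le X (a : R) : 0 < a -> sqi X ->
  ex (fun w => `|X w|) <= a * ex (fun w => X w ^+ 2) + a^-1.
Proof.
move=> a0 sX; have := ex_normM_le a0 sX (sqi_cst 1).
under eq_fun do rewrite mulr1; under [X in a^-1 * ex X]eq_fun do rewrite expr1n.
by rewrite ex_cst mulr1.
Qed.

Lemma ex_sqrD_le X Y : sqi X -> sqi Y -> ex (fun w => (X w + Y w) ^+ 2) <=
  2 * ex (fun w => X w ^+ 2) + 2 * ex (fun w => Y w ^+ 2).
Proof.
move=> sX sY; have [_ iX] := sX; have [_ iY] := sY.
have [_ iXY] := sqiD sX sY.
rewrite -exZ// -exZ// -exD//; [|exact: itgZ..].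
apply: ex_le => //; first by apply: itgD; exact: itgZ.
by move=> w; have := sqr_ge0 (X w - Y w); nra.
Qed.

(** Cauchy-Schwarz against the constant sequence 1, read off the nonnegative double sum of the (F i
    - F j)^2. *)
Lemma sqr_sum_le (n : nat) (F : 'I_n -> R) :
  (\sum_i F i) ^+ 2 <= n%:R * \sum_i F i ^+ 2.
Proof.
have : 0 <= \sum_i \sum_j (F i - F j) ^+ 2.
  by apply: sumr_ge0 => i _; apply: sumr_ge0 => j _; exact: sqr_ge0.
rewrite (_ : \sum_i _ = 2 * (n%:R * \sum_i F i ^+ 2) - 2 * (\sum_i F i) ^+ 2).
  by lra.
transitivity (\sum_i (n%:R * F i ^+ 2 - 2 * F i * (\sum_j F j) + \sum_j F j ^+ 2)).
  apply: eq_bigr => i _.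
  transitivity (\sum_j (F i ^+ 2 - 2 * F i * F j + F j ^+ 2)).
    by apply: eq_bigr => j _; ring.
  by rewrite !big_split/= sumr_const card_ord -(mulr_natl (F i ^+ 2)) sumrN -mulr_sumr.
rewrite !big_split/= sumr_const card_ord -(mulr_natl _ n) -mulr_sumr sumrN.
by rewrite -mulr_suml -mulr_sumr; ring.
Qed.

Lemma ex_sqr_sum_le (n : nat) (F : 'I_n -> T -> R) : (forall i, sqi (F i)) ->
  ex (fun w => (\sum_i F i w) ^+ 2) <= n%:R * \sum_i ex (fun w => F i w ^+ 2).
Proof.
move=> sF; rewrite -ex_sum; last by move=> i _; have [] := sF i.
have i1 : itg (fun w => \sum_i F i w ^+ 2).
  by apply: itg_sum => i _; have [] := sF i.
rewrite -exZ//; apply: ex_le; [|exact: itgZ|].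
  by have [] := @sqi_sum _ (index_enum _) xpredT _ (fun i _ => sF i).
by move=> w; exact: sqr_sum_le.
Qed.

End expectation.

Definition mkmfun d d' (T : measurableType d) (T' : measurableType d')
    (X : T -> T') (mX : measurable_fun setT X) : {mfun T >-> T'} :=
  HB.pack X (isMeasurableFun.Build _ _ _ _ X mX).

(** * Independence of two variables: generating systems, product laws, products and sums *)

Section independence.
Variables (d : measure_display) (T : measurableType d) (R : realType).
Variable P : probability T R.
Implicit Types X Y : T -> R.

(** As functions of A, both sides are finite measures that agree on a pi-system and on the whole
    space, hence on the generated sigma-algebra. *)
Lemma indep_sigma_l (C : set (set T)) (B : set T) : setI_closed C ->
  C `<=` measurable -> measurable B ->
  (forall A, C A -> P (A `&` B) = (P A * P B)%E) ->
  forall A, <<s C >> A -> P (A `&` B) = (P A * P B)%E.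
Proof.
move=> CI Cm mB CB.
have e : [set X | C X /\ X `<=` setT] = C.
  by apply/seteqP; split => [A []//|A CA]; split.
have PB0 : 0 <= fine (P B) by exact: fine_ge0.
pose m1 := mrestr P mB.
pose m2 := mscale (NngNum PB0) P.
have PBE : P B = (fine (P B))%:E by rewrite fineK// fin_num_measure.
have m2E A : m2 A = (P A * P B)%E by rewrite /m2 /mscale/= [in RHS]PBE muleC.
have := @g_sigma_algebra_measure_unique_trace _ R T C setT measurableT.
rewrite e => /(_ Cm CI m1 m2); rewrite /m1 /m2 => H A sA.
suff HA : m1 A = m2 A by rewrite -m2E -HA.
apply: H => //.
- transitivity (m2 setT) => //.
  by rewrite [RHS]m2E probability_setT mul1e -[in RHS](setTI B).
- move=> A' CA'; transitivity (m2 A') => //.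
  by rewrite m2E; exact: CB.
- apply: (@le_lt_trans _ _ (P (setT `&` B))) => //.
  by rewrite setTI (le_lt_trans (probability_le1 _ _))// ltry.
Qed.

Lemma indep_sigma (C D : set (set T)) : setI_closed C -> setI_closed D ->
  C `<=` measurable -> D `<=` measurable ->
  (forall A B, C A -> D B -> P (A `&` B) = (P A * P B)%E) ->
  forall A B, <<s C >> A -> <<s D >> B -> P (A `&` B) = (P A * P B)%E.
Proof.
move=> CI DI Cm Dm CD A B sA sB.
have mA : measurable A by exact: (smallest_sub (@sigma_algebra_measurable _ T) Cm).
rewrite setIC muleC; apply: (indep_sigma_l DI Dm mA _ sB) => B' DB'.
rewrite setIC muleC; apply: (indep_sigma_l CI Cm (Dm _ DB') _ sA) => A' CA'.
exact: CD.
Qed.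

Definition indep2 X Y := forall A B : set R, measurable A -> measurable B ->
  P (X @^-1` A `&` Y @^-1` B) = (P (X @^-1` A) * P (Y @^-1` B))%E.

Section product.
Variables X Y : T -> R.
Hypothesis mX : measurable_fun setT X.
Hypothesis mY : measurable_fun setT Y.
Hypothesis XY : indep2 X Y.

Let X' := mkmfun mX.
Let Y' := mkmfun mY.
Let XY' := mkmfun (measurable_fun_pair mX mY).

Lemma indep2_distribution (M : set (R * R)) : measurable M ->
  (distribution P X' \x distribution P Y')%E M = distribution P XY' M.
Proof.
apply: product_measure_unique => A B mA mB.
by rewrite /distribution /pushforward -XY.
Qed.

Let tonelli (f : R * R -> \bar R) : measurable_fun setT f ->
  (forall z, (0 <= f z)%E) ->
  (\int[P]_w f (X w, Y w) =
   \int[distribution P X']_x \int[distribution P Y']_y f (x, y))%E.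
Proof.
move=> mf f0; transitivity (\int[distribution P XY']_z f z)%E.
  by rewrite ge0_integral_distribution.
rewrite -(@fubini_tonelli1 _ _ _ _ _ (distribution P X') (distribution P Y') f)//.
by apply: eq_measure_integral => M mM _; exact/esym/indep2_distribution.
Qed.

(** The joint law is the product of the marginal laws. Tonelli applied to the absolute value of x y
    gives integrability of the product, then Fubini gives its mean. *)
Lemma indep2_exM : itg P X -> itg P Y ->
  itg P (fun w => X w * Y w) /\ ex P (fun w => X w * Y w) = ex P X * ex P Y.
Proof.
move=> iX iY.
pose f (z : R * R) : \bar R := (z.1 * z.2)%:E.
have mf : measurable_fun setT f.
  by apply/measurable_EFinP/measurable_funM.
have mid : measurable_fun setT (EFin : R -> \bar R) by exact/measurable_EFinP.
have absE (Z : T -> R) (mZ : measurable_fun setT Z) : itg P Z ->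
    (\int[distribution P (mkmfun mZ)]_x `|x|%:E = (ex P (fun w => `|Z w|))%:E)%E.
  move=> iZ; rewrite ge0_integral_distribution//; last first.
    exact/measurable_EFinP.
  by rewrite /ex /Rintegral fineK//; exact/integrable_fin_num/itg_norm.
have exE (Z : T -> R) (mZ : measurable_fun setT Z) : itg P Z ->
    (\int[distribution P (mkmfun mZ)]_x x%:E = (ex P Z)%:E)%E.
  move=> iZ; rewrite integral_distribution//.
  by rewrite /ex /Rintegral fineK//; exact/integrable_fin_num.
have idE (Z : T -> R) (mZ : measurable_fun setT Z) : itg P Z ->
    (distribution P (mkmfun mZ)).-integrable setT EFin.
  move=> iZ; apply/integrableP; split => //.
  by rewrite (absE _ mZ iZ) ltry.
have absXY : (\int[distribution P X']_x \int[distribution P Y']_y `|f (x, y)| =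
    (ex P (fun w => `|X w|) * ex P (fun w => `|Y w|))%:E)%E.
  transitivity (\int[distribution P X']_x (`|x|%:E * (ex P (fun w => `|Y w|))%:E))%E.
    apply: eq_integral => x _; rewrite -(absE _ mY iY) -ge0_integralZl//.
    - by apply: eq_integral => y _; rewrite /f/= normrM EFinM.
    - exact/measurable_EFinP.
  rewrite ge0_integralZr//; last 2 first.
    exact/measurable_EFinP.
    by rewrite lee_fin; exact: ex_ge0.
  by rewrite (absE _ mX iX) -EFinM.
have iXY : itg P (fun w => X w * Y w).
  apply/integrableP; split; first exact/measurable_EFinP/measurable_funM.
  rewrite (_ : integral _ _ _ = \int[P]_w `|f (X w, Y w)|)%E//.
  rewrite (@tonelli (abse \o f)) ?absXY ?ltry//; first exact: measurableT_comp.
  by move=> z; exact: abse_ge0.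
split => //.
apply: EFin_inj; transitivity (\int[P]_w (f \o (fun w => (X w, Y w))) w)%E.
  by rewrite /ex /Rintegral fineK//; exact: integrable_fin_num iXY.
rewrite -(@integral_distribution _ _ _ _ _ P XY')//.
transitivity (\int[distribution P X' \x distribution P Y']_z f z)%E.
  by apply: eq_measure_integral => M mM _; exact/esym/indep2_distribution.
rewrite -integral12_prod_meas1; last by apply/integrable12ltyP => //; rewrite absXY ltry.
rewrite /fubini_F/=.
transitivity (\int[distribution P X']_x (x%:E * (ex P Y)%:E))%E.
  apply: eq_integral => x _; rewrite -(exE _ mY iY) -integralZl//; last exact: idE.
rewrite integralZr//; last exact: idE.
by rewrite (exE _ mX iX) EFinM.
Qed.

End product.

(** Under independence the joint law is the product measure, so the marginals determine the law of
    the sum. This allows a weighted sum to be exchanged for a Wiener increment summand by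
    summand. *)
Lemma indep2_sum_law d2 (T2 : measurableType d2) (P2 : probability T2 R)
    X Y (X2 Y2 : T2 -> R) :
  measurable_fun setT X -> measurable_fun setT Y ->
  measurable_fun setT X2 -> measurable_fun setT Y2 ->
  indep2 X Y ->
  (forall A B : set R, measurable A -> measurable B ->
    P2 (X2 @^-1` A `&` Y2 @^-1` B) = (P2 (X2 @^-1` A) * P2 (Y2 @^-1` B))%E) ->
  (forall A, measurable A -> P (X @^-1` A) = P2 (X2 @^-1` A)) ->
  (forall A, measurable A -> P (Y @^-1` A) = P2 (Y2 @^-1` A)) ->
  forall A, measurable A ->
    P [set w | A (X w + Y w)] = P2 [set w | A (X2 w + Y2 w)].
Proof.
move=> mX mY mX2 mY2 XY XY2 lX lY A mA.
pose M := [set z : R * R | A (z.1 + z.2)].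
have mM : measurable M.
  have := @measurable_funD _ _ R setT (@fst R R) (@snd R R)
     measurable_fst measurable_snd measurableT A mA.
  by rewrite setTI.
pose XY' := mkmfun (measurable_fun_pair mX mY).
pose XY2' := mkmfun (measurable_fun_pair mX2 mY2).
transitivity (distribution P XY' M) => //.
transitivity (distribution P2 XY2' M) => //.
rewrite -(indep2_distribution mX mY)//.
apply: product_measure_unique => // B C mB mC.
transitivity (P2 (X2 @^-1` B `&` Y2 @^-1` C)) => //.
by rewrite XY2// -lX// -lY.
Qed.

End independence.

(** * Functions of disjoint subfamilies of an independent family *)

Section family.
Variables (d : measure_display) (T : measurableType d) (R : realType).
Variable P : probability T R.
Variables (I : finType) (G : I -> T -> R).
Hypothesis mG : forall i, measurable_fun setT (G i).

(** A pi-system generating the sigma-algebra of the G i with i in J. The sets B i range over all of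
    I, so that intersecting two cylinders is pointwise; only the B i with i in J matter. *)
Definition cylinders (J : {set I}) : set (set T) :=
  [set A | exists2 B : I -> set R, (forall i, measurable (B i)) &
     A = \bigcap_(i in [set` J]) G i @^-1` B i].

(** X is a function of the G i with i in J. Changing the measurable structure on the source lets the
    usual closure lemmas of [measurable_fun] apply unchanged. *)
Definition fam_meas (J : {set I}) (X : T -> R) :=
  measurable_fun setT (X : g_sigma_algebraType (cylinders J) -> R).

Lemma measurable_preim (X : T -> R) (B : set R) : measurable_fun setT X ->
  measurable B -> measurable (X @^-1` B).
Proof. by move=> mX mB; rewrite -[X in measurable X]setTI; exact: mX. Qed.

Lemma cylinders_measurable J : cylinders J `<=` measurable.
Proof.
move=> _ [B mB ->]; apply: fin_bigcap_measurable; first exact: finite_finset.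
by move=> i _; exact: measurable_preim.
Qed.

Lemma setI_closed_cylinders J : setI_closed (cylinders J).
Proof.
move=> _ _ [B mB ->] [C mC ->]; exists (fun i => B i `&` C i).
  by move=> i; exact: measurableI.
by rewrite -bigcapI.
Qed.

Lemma fam_measW J X : fam_meas J X -> measurable_fun setT X.
Proof.
move=> mX _ B mB; rewrite setTI; have := mX measurableT B mB; rewrite setTI.
apply: smallest_sub; first exact: sigma_algebra_measurable.
exact: cylinders_measurable.
Qed.

Lemma fam_meas_sub (J J' : {set I}) X : J \subset J' ->
  fam_meas J X -> fam_meas J' X.
Proof.
move=> JJ' mX _ B mB; have := mX measurableT B mB; rewrite !setTI.
move: (X @^-1` B); apply: smallest_sub; first exact: smallest_sigma_algebra.
move=> _ [C mC ->]; apply: sub_sigma_algebra.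
exists (fun i => if i \in J then C i else setT).
  by move=> i; case: ifP.
apply/seteqP; split => [w h i /= iJ'|w h i /= iJ].
  by case: ifPn => // iJ; exact: h.
by have /= := h i (fintype.subsetP JJ' _ iJ); rewrite iJ.
Qed.

Lemma fam_meas_coord (J : {set I}) i : i \in J -> fam_meas J (G i).
Proof.
move=> iJ _ B mB; rewrite setTI; apply: sub_sigma_algebra.
exists (fun j => if j == i then B else setT); first by move=> j; case: ifP.
apply/seteqP; split => [w h j /= jJ|w /(_ i iJ)/=]; last by rewrite eqxx.
by case: eqP => // ->.
Qed.

Hypothesis indG : independent_systems P (fun i => sigma_rv (G i)).

Lemma cylinder_prob (J : {set I}) (B : I -> set R) :
  (forall i, measurable (B i)) ->
  P (\bigcap_(i in [set` J]) G i @^-1` B i) =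
  (\prod_(i in J) P (G i @^-1` B i))%E.
Proof.
by move=> mB; apply: indG => i _; exists (B i) => //; rewrite setTI.
Qed.

(** The product rule is checked on cylinders: over disjoint index sets, two of them glue to one
    cylinder over the union. *)
Lemma fam_indep2 (J1 J2 : {set I}) X Y : [disjoint J1 & J2]%B ->
  fam_meas J1 X -> fam_meas J2 Y -> indep2 P X Y.
Proof.
move=> J12 mX mY A B mA mB.
apply: (@indep_sigma _ _ _ P (cylinders J1) (cylinders J2)).
- exact: setI_closed_cylinders.
- exact: setI_closed_cylinders.
- exact: cylinders_measurable.
- exact: cylinders_measurable.
- move=> _ _ [C mC ->] [D mD ->].
  rewrite !cylinder_prob//.
  pose E i := if i \in J1 then C i else D i.
  have mE i : measurable (E i) by rewrite /E; case: ifP.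
  have J21 i : i \in J2 -> (i \in J1) = false.
    by move=> iJ2; apply/negbTE; move: J12; rewrite disjoint_sym => /disjointFr -> .
  transitivity (P (\bigcap_(i in [set` J1 :|: J2]) G i @^-1` E i)).
    congr (P _); apply/seteqP; split => w /=.
      move=> [h1 h2] i /=; rewrite inE /E => /orP[iJ|iJ].
        by rewrite iJ; exact: h1.
      by rewrite J21//; exact: h2.
    move=> h; split => i /= iJ.
      by have := h i; rewrite /= inE iJ /E iJ => /(_ isT).
    by have := h i; rewrite /= inE iJ orbT /E J21// => /(_ isT).
  rewrite cylinder_prob// (eq_bigl (fun i => (i \in J1) || (i \in J2))); last first.
    by move=> i; rewrite inE.
  rewrite bigU//=; congr (_ * _)%E; apply: eq_bigr => i iJ.
    by rewrite /E iJ.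
  by rewrite /E J21.
- by have := mX measurableT A mA; rewrite setTI.
- by have := mY measurableT B mB; rewrite setTI.
Qed.

Lemma fam_exM (J1 J2 : {set I}) X Y : [disjoint J1 & J2]%B ->
  fam_meas J1 X -> fam_meas J2 Y -> itg P X -> itg P Y ->
  itg P (fun w => X w * Y w) /\ ex P (fun w => X w * Y w) = ex P X * ex P Y.
Proof.
move=> J12 mX mY; apply: indep2_exM; [exact: fam_measW mX|exact: fam_measW mY|].
exact: fam_indep2 mX mY.
Qed.

End family.

Section increments.
Variables (d : measure_display) (T : measurableType d) (R : realType).
Variable P : probability T R.
Variables (r : nat) (W : R -> T -> 'cV[R]_r).
Hypothesis hW : wiener P W.

Definition incr (t : nat -> R) (w_ : nat * 'I_r) (w : T) : R :=
  W (t w_.1.+1) w w_.2 0 - W (t w_.1) w w_.2 0.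

(** The time index is bounded because [independent_systems] speaks of finite families. *)
Definition fincr m (t : nat -> R) (i : 'I_m * 'I_r) := incr t (val i.1, i.2).

Lemma wiener_meas t i : 0 <= t -> measurable_fun setT (fun w => W t w i 0).
Proof. by move=> t0; have [/(_ i)[h _ _ _ _] _] := hW; exact: h. Qed.

Lemma fincr_meas m (t : nat -> R) i : (forall k, 0 <= t k) ->
  measurable_fun setT (@fincr m t i).
Proof. by move=> t0; apply: measurable_funB; exact: wiener_meas. Qed.

Lemma incr_sigma_process (t : nat -> R) k (a : 'I_r) (A : set R) :
  (forall k, 0 <= t k) -> measurable A ->
  sigma_process (fun t w => W t w a 0) (incr t (k, a) @^-1` A).
Proof.
move=> t0 mA.
pose G := [set B : set T | exists2 t, 0 <= t & sigma_rv (fun w => W t w a 0) B].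
have mW s : 0 <= s -> measurable_fun setT
    ((fun w => W s w a 0) : g_sigma_algebraType G -> R).
  move=> s0 _ B mB; apply: sub_sigma_algebra; exists s => //.
  by exists B => //; rewrite setTI.
have : measurable_fun setT (incr t (k, a) : g_sigma_algebraType G -> R).
  by apply: measurable_funB; exact: mW.
by move=> /(_ measurableT A mA); rewrite setTI.
Qed.

(** Events are grouped by coordinate: each group belongs to the sigma-algebra of one coordinate
    process, so that the groups are independent, and within a group the increments over successive
    intervals are. *)
Lemma incr_indep m (t : nat -> R) : 0 <= t 0%N ->
  {homo t : i j / (i <= j)%N >-> i <= j} ->
  independent_systems P (fun i => sigma_rv (@fincr m t i)).
Proof.
move=> t00 tm J A hA; have [h1 h2] := hW.
have t0 k : 0 <= t k by apply: le_trans t00 _; exact: tm.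
have hA' i : i \in J -> exists2 B : set R, measurable B & A i = fincr t i @^-1` B.
  by move=> iJ; have [B mB <-] := hA i iJ; exists B => //; rewrite setTI.
pose E (a : 'I_r) := \bigcap_(k in [set` [set k : 'I_m | (k, a) \in J]%SET]) A (k, a).
transitivity (P (\bigcap_(a in [set` [set: 'I_r]%SET]) E a)).
  congr (P _); apply/seteqP; split => w /=.
    by move=> h a _ k /=; rewrite inE => ka; exact: h.
  move=> h [k a] /= ka; apply: (h a); first by rewrite /= inE.
  by rewrite /= inE.
rewrite h2; last first.
  move=> a _.
  pose G := [set B : set T | exists2 t, 0 <= t & sigma_rv (fun w => W t w a 0) B].
  suff : measurable (E a : set (g_sigma_algebraType G)) by [].
  apply: fin_bigcap_measurable; first exact: finite_finset.
  move=> k /=; rewrite inE => ka; have [B mB ->] := hA' _ ka.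
  exact: incr_sigma_process.
transitivity (\prod_(a : 'I_r) \prod_(k : 'I_m | (k, a) \in J) P (A (k, a)))%E.
  apply: eq_big => [a|a _]; first by rewrite inE.
  have [_ _ /(_ m t t00 tm) h _ _] := h1 a.
  rewrite /E (h [set k : 'I_m | (k, a) \in J]%SET (fun k => A (k, a))); last first.
    by move=> k; rewrite inE => ka; exact: (hA _ ka).
  by apply: eq_bigl => k; rewrite inE.
rewrite (exchange_big_dep xpredT)//= pair_big_dep/=.
by apply: eq_big => [[k a]|[k a] _].
Qed.

End increments.

(** * Gaussian increments *)

Section normal_moments.
Variables (R : realType) (s : R).
Hypothesis s0 : 0 < s.
Local Notation mu := (@lebesgue_measure R).
Local Notation f := (normal_pdf 0 s).

Let s2 : s != 0. Proof. by rewrite gt_eqF. Qed.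

Let fE x : f x = normal_peak s * expR (- (x ^+ 2 / (s ^+ 2 *+ 2))).
Proof. by rewrite normal_pdfE// /normal_fun subr0 mulNr. Qed.

(** With y = x^2 / (4 s^2) the density is proportional to e^(-y) e^(-y). One factor absorbs the
    power of x, since y^(k+1) / (k+1)! is at most e^y; the other is a normal density of variance 2
    s^2. *)
Lemma normal_pdf_powM_le k : exists C : R, forall x,
  `|x| ^+ k * f x <= C * normal_pdf 0 (s * Num.sqrt 2) x.
Proof.
have t0 : s * Num.sqrt 2 != 0 by rewrite mulf_neq0// gt_eqF// sqrtr_gt0.
pose D : R := 1 + (4 * s ^+ 2) ^+ k.+1 * (k.+1)`!%:R.
have pt0 : 0 < normal_peak (s * Num.sqrt 2) by exact: normal_peak_gt0.
exists (D * normal_peak s / normal_peak (s * Num.sqrt 2)) => x.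
rewrite fE normal_pdfE// /normal_fun subr0 exprMn sqr_sqrtr// mulNr.
set y := x ^+ 2 / (4 * s ^+ 2).
have y0 : 0 <= y by rewrite divr_ge0 ?sqr_ge0// mulr_ge0 ?sqr_ge0.
have -> : x ^+ 2 / (s ^+ 2 *+ 2) = y + y.
  by rewrite /y -mulr_natr; field.
have -> : x ^+ 2 / ((s ^+ 2 * 2) *+ 2) = y.
  by rewrite /y -mulr_natr; field.
rewrite opprD expRD.
have ps0 : 0 < normal_peak s by exact: normal_peak_gt0.
have ey0 : 0 < expR (- y) by exact: expR_gt0.
have -> : D * normal_peak s / normal_peak (s * Num.sqrt 2) *
    (normal_peak (s * Num.sqrt 2) * expR (- y)) =
    normal_peak s * expR (- y) * D by field; rewrite gt_eqF.
have -> : `|x| ^+ k * (normal_peak s * (expR (- y) * expR (- y))) =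
    normal_peak s * expR (- y) * (`|x| ^+ k * expR (- y)) by ring.
rewrite ler_pM2l ?mulr_gt0// expRN ler_pdivrMr ?expR_gt0//.
have e1 : 1 <= expR y by rewrite -expR0 ler_expR.
(* An even exponent is forced, so that the power of x becomes an integer power of y. *)
have xk : `|x| ^+ k <= 1 + x ^+ (2 * k.+1).
  have [x1|x1] := leP `|x| 1.
    apply: (le_trans (exprn_ile1 _ (normr_ge0 x) x1)) => //; rewrite lerDl exprM.
    by rewrite exprn_ge0// sqr_ge0.
  rewrite -(ger0_norm (_ : 0 <= x ^+ (2 * k.+1))); last first.
    by rewrite exprM exprn_ge0// sqr_ge0.
  rewrite normrX -[leLHS]add0r lerD// ler_weXn2l ?(ltW x1)//.
  by rewrite mul2n -addnn addSn ltnW// ltnS leq_addr.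
apply: (le_trans xk); rewrite mulrDl mul1r lerD//.
have -> : x ^+ (2 * k.+1) = (4 * s ^+ 2) ^+ k.+1 * y ^+ k.+1.
  by rewrite exprM -exprMn; congr (_ ^+ _); rewrite /y; field.
rewrite -mulrA ler_wpM2l ?exprn_ge0 ?mulr_ge0 ?sqr_ge0 ?(ltW s0)//.
rewrite -ler_pdivrMl ?ltr0n ?fact_gt0// mulrC.
by apply: le_trans (expR_ge1Dxn k y0); rewrite lerDr.
Qed.

Lemma integrable_normal_pow k :
  mu.-integrable setT (fun x => (x ^+ k * f x)%:E).
Proof.
have [C hC] := normal_pdf_powM_le k.
apply: (@le_integrable _ _ _ mu setT measurableT _
    (fun x => (C * normal_pdf 0 (s * Num.sqrt 2) x)%:E)).
- apply/measurable_EFinP; apply: measurable_funM; first exact: measurable_funX.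
  exact: measurable_normal_pdf.
- move=> x _; rewrite /= lee_fin normrM normrX.
  by rewrite (ger0_norm (normal_pdf_ge0 _ _ _)) (le_trans (hC x))// ler_norm.
- under eq_fun do rewrite EFinM; apply: integrableZl => //.
  exact: integrable_normal_pdf.
Qed.

Let df x : is_derive x (1 : R) f (- (x / s ^+ 2) * f x).
Proof.
pose q := - ((s ^+ 2 *+ 2)^-1 \*: (@id R ^+ 2)) : R -> R.
have -> : f = normal_peak s \*: (expR \o q).
  by apply/funext => y; rewrite fE; congr (_ * expR _); rewrite /q/= mulrC.
have dq : is_derive x (1 : R) q (- (x / s ^+ 2)).
  apply: is_derive_eq; rewrite /GRing.scale/= -mulr_natr.
  by field.
have -> : - (x / s ^+ 2) * (normal_peak s \*: (expR \o q)) x =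
    normal_peak s *: (expR (q x) * (- (x / s ^+ 2))).
  transitivity (- (x / s ^+ 2) * (normal_peak s * expR (q x))) => //.
  by rewrite /GRing.scale/=; ring.
exact: is_deriveZ.
Qed.

(** Antiderivative whose derivative, integrated over the line, is the moment recursion. *)
Let F k := (@id R ^+ k.+1) * f.

Let dF k x : is_derive x (1 : R) (F k)
  (k.+1%:R * (x ^+ k * f x) - (s ^+ 2)^-1 * (x ^+ k.+2 * f x)).
Proof.
have := df x => h; apply: is_derive_eq; rewrite /GRing.scale/= !fctE.
by rewrite -(addn1 k) -(addn1 (k + 1)) !exprD addn1 /=; field.
Qed.

Let integral_sym (g : R -> R) : mu.-integrable setT (EFin \o g) ->
  \int[mu]_(x in `[(- n%:R), n%:R]) g x @[n --> \oo] --> \int[mu]_x g x.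
Proof.
move=> ig; rewrite /Rintegral; apply: fine_cvg.
rewrite fineK; last exact: integrable_fin_num.
under eq_fun do rewrite integral_mkcond.
have [] := @dominated_convergence _ _ _ mu setT measurableT
  (fun n => (EFin \o g) \_ (`[- n%:R, n%:R])) (EFin \o g) (abse \o (EFin \o g)).
- move=> n; apply/(measurable_restrictT _ _).1 => //.
  apply: measurable_funS (measurable_int _ ig) => //.
- exact: measurable_int ig.
- apply: aeW => x _; apply: cvg_near_cst.
  near=> n; rewrite patchE ifT// inE/= in_itv/= -ler_norml.
  by near: n; exact: nbhs_infty_ger.
- exact: integrable_abse.
- apply: aeW => x n _; rewrite patchE; case: ifPn => // _.
  by apply: (@le_trans _ _ 0%E); [rewrite (_ : point = 0%E)// abse0|exact: abse_ge0].
- by move=> _ _ h; exact: h.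
Unshelve. all: by end_near. Qed.

Let cvgF k : F k n%:R - F k (- n%:R) @[n --> \oo] --> (0 : R).
Proof.
(* One power more than in [F k], which bounds [F k x] by a constant over the absolute value of x. *)
have [C hC] := normal_pdf_powM_le k.+2.
pose C' := `|C| * normal_peak (s * Num.sqrt 2).
have bF x : 0 < `|x| -> `|F k x| <= C' / `|x|.
  move=> x0; rewrite ler_pdivlMr// /F !fctE normrM normrX.
  rewrite (ger0_norm (normal_pdf_ge0 _ _ _)) mulrAC -exprSr.
  apply: (le_trans (hC x)).
  rewrite (le_trans (ler_wpM2r (normal_pdf_ge0 _ _ _) (ler_norm C)))//.
  rewrite /C' ler_wpM2l//.
  by apply: normal_pdf_ub; rewrite mulf_neq0// gt_eqF// sqrtr_gt0.
apply/norm_cvg0P; apply: (@squeeze_cvgr _ _ _ _ (cst 0) (fun n => 2 * C' * n%:R^-1)).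
- near=> n.
  have n0 : 0 < (n%:R : R) by rewrite ltr0n; near: n; exact: nbhs_infty_gt.
  rewrite normr_ge0/= (le_trans (ler_normB _ _))//.
  have := bF n%:R; have := bF (- n%:R); rewrite normrN (ger0_norm (ltW n0)).
  by move=> /(_ n0) h1 /(_ n0) h2; rewrite (le_trans (lerD h2 h1))// -mulrA mulrDl mul1r.
- exact: cvg_cst.
- rewrite -(mulr0 (2 * C')); apply: cvgM; first exact: cvg_cst.
  apply/gtr0_cvgV0; last exact: cvgr_idn.
  by near=> n; rewrite ltr0n; near: n; exact: nbhs_infty_gt.
Unshelve. all: by end_near. Qed.

Let ftc_sym (g G : R -> R) : mu.-integrable setT (EFin \o g) ->
  continuous g -> (forall x, is_derive x (1 : R) G (g x)) ->
  G n%:R - G (- n%:R) @[n --> \oo] --> (0 : R) -> \int[mu]_x g x = 0.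
Proof.
move=> ig cg dG G0.
apply: (cvg_unique _ (integral_sym ig)) => //.
have cG x : {for x, continuous G}.
  by apply/differentiable_continuous/derivable1_diffP; have := dG x; case.
apply: cvg_trans G0; apply: near_eq_cvg.
near=> n; rewrite /Rintegral (@continuous_FTC2 _ g G) => //.
- rewrite -subr_gt0 opprK -natrD ltr0n addn_gt0; apply/orP; left.
  by near: n; exact: nbhs_infty_gt.
- exact: continuous_subspaceT.
- split => //.
  + by apply: cvg_at_right_filter; exact: cG.
  + by apply: cvg_at_left_filter; exact: cG.
- by move=> x _; rewrite derive1E derive_val.
Unshelve. all: by end_near. Qed.

(** The integral of the derivative of [F k] over [-n, n] is a boundary term that tends to 0.
    Iterated from order 0, the recursion gives the constants 1, 3 and 105 of orders 2, 4 and 8. *)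
Lemma normal_ibp k : \int[mu]_x (x ^+ k.+2 * f x) =
  k.+1%:R * s ^+ 2 * \int[mu]_x (x ^+ k * f x).
Proof.
have ik := integrable_normal_pow k; have ik2 := integrable_normal_pow k.+2.
pose g x := k.+1%:R * (x ^+ k * f x) - (s ^+ 2)^-1 * (x ^+ k.+2 * f x).
have i1 : mu.-integrable setT (fun x => (k.+1%:R * (x ^+ k * f x))%:E).
  by under eq_fun do rewrite EFinM; exact: integrableZl.
have i2 : mu.-integrable setT (fun x => ((s ^+ 2)^-1 * (x ^+ k.+2 * f x))%:E).
  by under eq_fun do rewrite EFinM; exact: integrableZl.
have ig : mu.-integrable setT (EFin \o g).
  by have := integrableB measurableT i1 i2.
have : \int[mu]_x g x = 0.
  apply: (@ftc_sym g (F k) ig); [|exact: dF|exact: cvgF].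
  move=> x; have cf := @continuous_normal_pdf R 0 s s2.
  apply: cvgB; apply: cvgM; try exact: cvg_cst; apply: cvgM; try exact: cf.
    exact: exprn_continuous.
  exact: exprn_continuous.
rewrite /g RintegralB// !RintegralZl//.
move=> /eqP; rewrite subr_eq0 => /eqP h.
by rewrite mulrAC h mulrAC mulVf ?mul1r// expf_neq0.
Qed.

Lemma normal_mean : \int[mu]_x (x ^+ 1 * f x) = 0.
Proof.
have ig := integrable_normal_pow 1.
have : \int[mu]_x (- (s ^+ 2)^-1 * (x ^+ 1 * f x)) = 0.
  (* The integrand is the derivative of the density itself, whose boundary terms cancel because it
     is even. *)
  apply: (@ftc_sym _ f).
  - by apply: eq_integrable (integrableZl measurableT (- (s ^+ 2)^-1) ig) => // x _ /=; rewrite EFinM.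
  - move=> x; apply: cvgM; first exact: cvg_cst.
    apply: cvgM; last exact: continuous_normal_pdf.
    exact: exprn_continuous.
  - move=> x; rewrite (_ : _ * _ = - (x / s ^+ 2) * f x) ?expr1; first exact: df.
    by ring.
  - have e (n : nat) : f n%:R - f (- n%:R) = 0 by rewrite !fE sqrrN subrr.
    by under eq_fun do rewrite e; exact: cvg_cst.
rewrite RintegralZl// => /eqP; rewrite mulf_eq0 oppr_eq0 invr_eq0.
by rewrite expf_eq0/= (negbTE s2)/= => /eqP.
Qed.

(** The Radon-Nikodym derivative of the normal law is almost everywhere the density, since both have
    the same integral over every measurable set. *)
Lemma ge0_integral_normal (g : R -> \bar R) : measurable_fun setT g ->
  (forall x, (0 <= g x)%E) ->
  (\int[normal_prob 0 s]_x g x = \int[mu]_x (g x * (f x)%:E))%E.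
Proof.
move=> mg g0.
have dom : normal_prob 0 s `<< mu by exact: normal_prob_dominates.
rewrite -(@Radon_Nikodym_SigmaFinite.change_of_variables _ _ _ _ mu dom)//.
have mRN : measurable_fun setT (Radon_Nikodym_SigmaFinite.f (normal_prob 0 s) mu).
  exact: measurable_int (Radon_Nikodym_SigmaFinite.f_integrable dom).
apply: ge0_ae_eq_integral => //.
- exact: emeasurable_funM.
- apply: emeasurable_funM => //; apply/measurable_EFinP.
  exact: measurable_normal_pdf.
- by move=> x _; rewrite mule_ge0// Radon_Nikodym_SigmaFinite.f_ge0.
- by move=> x _; rewrite mule_ge0// lee_fin normal_pdf_ge0.
apply: ae_eqe_mul2l; apply: integral_ae_eq => //.
- exact: Radon_Nikodym_SigmaFinite.f_integrable.
- by apply/measurable_EFinP; exact: measurable_normal_pdf.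
- by move=> E _ mE; rewrite -Radon_Nikodym_SigmaFinite.f_integral.
Qed.

Lemma Rintegral_normal (g : R -> R) : measurable_fun setT g ->
  mu.-integrable setT (fun x => (g x * f x)%:E) ->
  (normal_prob 0 s).-integrable setT (EFin \o g) /\
  \int[normal_prob 0 s]_x g x = \int[mu]_x (g x * f x).
Proof.
move=> mg ig.
have ig' : (normal_prob 0 s).-integrable setT (EFin \o g).
  apply/integrableP; split; first exact/measurable_EFinP.
  rewrite ge0_integral_normal//; last first.
    by apply: measurableT_comp => //; exact/measurable_EFinP.
  have /integrableP[_] := ig; apply: le_lt_trans.
  by rewrite le_eqVlt; apply/orP; left; apply/eqP; apply: eq_integral => x _ /=;
    rewrite -EFinM normrM (ger0_norm (normal_pdf_ge0 _ _ _)).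
split => //; congr fine.
have dom : normal_prob 0 s `<< mu by exact: normal_prob_dominates.
rewrite -(Radon_Nikodym_change_of_variables dom)//=.
have mf : measurable_fun setT (fun x => (f x)%:E).
  by apply/measurable_EFinP; exact: measurable_normal_pdf.
under [RHS]eq_integral do rewrite EFinM.
apply: ae_eq_integral => //.
- apply: emeasurable_funM; first exact/measurable_EFinP.
  by apply: (measurable_int mu); exact: Radon_Nikodym_integrable.
- by apply: emeasurable_funM => //; exact/measurable_EFinP.
apply: ae_eqe_mul2l; apply: integral_ae_eq => //.
  exact: Radon_Nikodym_integrable.
by move=> E _ mE; rewrite -Radon_Nikodym_integral.
Qed.

End normal_moments.

Section gaussian_rv.
Variables (d : measure_display) (T : measurableType d) (R : realType).
Variable P : probability T R.
Variables (s : R) (X : T -> R).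
Hypothesis s0 : 0 < s.
Hypothesis mX : measurable_fun setT X.
Hypothesis lX : forall A, measurable A -> P [set w | A (X w)] = normal_prob 0 s A.

Lemma gauss_itg_ex (g : R -> R) : measurable_fun setT g ->
  (normal_prob 0 s).-integrable setT (EFin \o g) ->
  itg P (g \o X) /\ ex P (g \o X) = \int[normal_prob 0 s]_x g x.
Proof.
move=> mg ig.
have e (h : R -> \bar R) : (\int[normal_prob 0 s]_x h x =
    \int[distribution P (mkmfun (mX :
       measurable_fun setT (X : T -> measurableTypeR R)))]_x h x)%E.
  by apply: eq_measure_integral => A mA _; exact/esym/lX.
have i : itg P (g \o X).
  apply/integrableP; split; first exact/measurable_EFinP/measurableT_comp.
  have /integrableP[_] := ig; rewrite e ge0_integral_distribution//.
  by apply: measurableT_comp => //; exact/measurable_EFinP.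
split => //; congr fine; rewrite e integral_distribution//.
exact/measurable_EFinP.
Qed.

Lemma gauss_itg_pow k : itg P (fun w => X w ^+ k).
Proof.
have mk : measurable_fun setT (fun x : R => x ^+ k) by exact: measurable_funX.
have [h _] := Rintegral_normal mk (integrable_normal_pow s0 k).
by have [] := gauss_itg_ex mk h.
Qed.

Lemma gauss_ex_pow k : ex P (fun w => X w ^+ k) =
  \int[lebesgue_measure]_x (x ^+ k * normal_pdf 0 s x).
Proof.
have mk : measurable_fun setT (fun x : R => x ^+ k) by exact: measurable_funX.
have [h <-] := Rintegral_normal mk (integrable_normal_pow s0 k).
by have [] := gauss_itg_ex mk h.
Qed.

Lemma gauss_ex1 : ex P X = 0.
Proof. by rewrite -(normal_mean s0) -gauss_ex_pow. Qed.

Lemma gauss_ex2 : ex P (fun w => X w ^+ 2) = s ^+ 2.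
Proof.
rewrite gauss_ex_pow normal_ibp// -gauss_ex_pow.
under eq_fun do rewrite expr0; rewrite ex_cst; ring.
Qed.

Lemma gauss_ex4 : ex P (fun w => X w ^+ 4) = 3 * s ^+ 4.
Proof. by rewrite gauss_ex_pow normal_ibp// -gauss_ex_pow gauss_ex2; ring. Qed.

Lemma gauss_ex8 : ex P (fun w => X w ^+ 8) = 105 * s ^+ 8.
Proof.
rewrite gauss_ex_pow normal_ibp// (@normal_ibp _ _ _ 4)// -gauss_ex_pow gauss_ex4.
ring.
Qed.

End gaussian_rv.

(** * Scaling of Lebesgue measure and of centred normal laws *)

Section scaling.
Variable R : realType.
Local Notation mu := (@lebesgue_measure R).

Section mulr_lebesgue.
Variable a : R.
Hypothesis a0 : a != 0.

Let scale (x : R) : measurableTypeR R := a * x.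

Let mscale_fun : measurable_fun setT scale.
Proof. exact: measurable_funM. Qed.

Let pushforward_scale : {measure set (measurableTypeR R) -> \bar R}.
Proof. refine [the measure _ _ of pushforward mu scale]; exact: mscale_fun. Defined.

(** By uniqueness of Lebesgue measure only half-open intervals have to be checked. A negative factor
    exchanges the end points and the closed side. *)
Lemma lebesgue_measure_mulr (A : set R) : measurable A ->
  (`|a|%:E * mu [set x | A (a * x)%R] = mu A)%E.
Proof.
move=> mA.
pose m := mscale (NngNum (normr_ge0 a)) pushforward_scale.
rewrite -[LHS]/(m A); apply/esym/lebesgue_measure_unique => // _ [[c e]] _ <-.
transitivity (`|a|%:E * mu (scale @^-1` `]c, e]))%E; last by [].
have aN0 : 0 < `|a| by rewrite normr_gt0.
have [ap|an] := ltP 0 a.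
  rewrite (_ : scale @^-1` _ = `](c / a), (e / a)]%classic); last first.
    apply/seteqP; split => x /=; rewrite !in_itv/= ltr_pdivrMr// ler_pdivlMr//;
      by rewrite /scale mulrC.
  rewrite !lebesgue_measure_itv/= !lte_fin ltr_pM2r ?invr_gt0//.
  case: ifPn => _; last by rewrite mule0.
  by rewrite -!EFinB -EFinM (gtr0_norm ap) -mulrBl mulrC divfK.
have {}an : a < 0 by rewrite lt_neqAle a0.
rewrite (_ : scale @^-1` _ = `[(e / a), (c / a)[%classic); last first.
  apply/seteqP; split => x /=; rewrite !in_itv/= ler_ndivrMr// ltr_ndivlMr//;
      by rewrite /scale mulrC andbC.
rewrite !lebesgue_measure_itv/= !lte_fin ltr_nM2r ?invr_lt0//.
case: ifPn => _; last by rewrite mule0.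
rewrite -!EFinB -EFinM (ltr0_norm an) -mulrBl mulrC; congr (_%:E).
by field.
Qed.

Lemma ge0_integral_mulr (g : R -> \bar R) : measurable_fun setT g ->
  (forall x, (0 <= g x)%E) ->
  (`|a|%:E * \int[mu]_x g (a * x)%R = \int[mu]_x g x)%E.
Proof.
move=> mg g0.
pose m := mscale (NngNum (normr_ge0 a)) pushforward_scale.
transitivity (\int[m]_x g x)%E; last first.
  by apply: eq_measure_integral => A mA _; exact: lebesgue_measure_mulr.
rewrite ge0_integral_mscale// ge0_integral_pushforward//.
Qed.

End mulr_lebesgue.

Lemma normal_prob_scale (a s : R) (A : set R) : a != 0 -> 0 < s -> measurable A ->
  normal_prob 0 s [set x | A (a * x)] = normal_prob 0 (`|a| * s) A.
Proof.
move=> a0 s0 mA.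
have aN0 : 0 < `|a| by rewrite normr_gt0.
have sN0 : s != 0 by rewrite gt_eqF.
have asN0 : `|a| * s != 0 by rewrite mulf_neq0// gt_eqF.
rewrite /normal_prob integral_mkcond [RHS]integral_mkcond.
rewrite -[RHS](ge0_integral_mulr a0); last 2 first.
- apply/(measurable_restrictT _ _).1 => //; apply: measurable_funTS.
  by apply/measurable_EFinP; exact: measurable_normal_pdf.
- by move=> x; rewrite patchE; case: ifP => // _; rewrite lee_fin normal_pdf_ge0.
rewrite -ge0_integralZl//; last 2 first.
- apply: (measurableT_comp (f := (fun x => (normal_pdf 0 (`|a| * s) x)%:E) \_ A)).
    apply/(measurable_restrictT _ _).1 => //; apply: measurable_funTS.
    by apply/measurable_EFinP; exact: measurable_normal_pdf.
  exact: measurable_funM.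
- by move=> x _; rewrite patchE; case: ifP => // _; rewrite lee_fin normal_pdf_ge0.
apply: eq_integral => x _; rewrite !patchE.
have -> : (x \in [set x0 | A (a * x0)]) = (a * x \in A).
  by apply/idP/idP; rewrite !inE.
case: ifP => _; last by rewrite mule0.
rewrite -EFinM !normal_pdfE// /normal_fun !subr0; congr (_%:E).
rewrite mulrA; congr (_ * expR _); last first.
  rewrite [(a * x) ^+ 2]exprMn [(`|a| * s) ^+ 2]exprMn real_normK ?num_real//.
  have a20 : a ^+ 2 != 0 by rewrite sqrf_eq0.
  by rewrite -[in RHS]mulrnAr -[in RHS]mulrN invfM mulrACA (divff a20) mul1r.
rewrite /normal_peak exprMn real_normK ?num_real//.
have -> : a ^+ 2 * s ^+ 2 * pi *+ 2 = a ^+ 2 * (s ^+ 2 * pi *+ 2).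
  by rewrite -mulrnAr -mulrA mulrnAr.
by rewrite (sqrtrM _ (sqr_ge0 a)) sqrtr_sqr invfM mulrA (divff (lt0r_neq0 aN0)) mul1r.
Qed.

End scaling.

Section gaussian_sums.
Variables (d : measure_display) (T : measurableType d) (R : realType).
Variable P : probability T R.
Variable b : R -> T -> R.
Hypothesis hb : wiener1 P b.

Lemma measurable_affine (a : R) : measurable_fun setT (fun x : R => a * x).
Proof. exact: measurable_funM. Qed.

Lemma wiener1_meas t : 0 <= t -> measurable_fun setT (b t).
Proof. by have [h _ _ _ _] := hb; exact: h. Qed.

Lemma wiener1_law s t : 0 <= s -> s < t -> forall A, measurable A ->
  P [set w | A (b t w - b s w)] = normal_prob 0 (Num.sqrt (t - s)) A.
Proof. by move=> s0 st A mA; have [_ _ _ h _] := hb; exact: h. Qed.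

(* A weighted sum of independent standard normal increments has the same law as
   an increment of b over an interval of length the sum of the squared weights. *)
Lemma wiener1_sum_law m (G : 'I_m -> T -> R) (a : 'I_m -> R) :
  (forall i, measurable_fun setT (G i)) ->
  independent_systems P (fun i => sigma_rv (G i)) ->
  (forall i A, measurable A -> P [set w | A (G i w)] = normal_prob 0 1 A) ->
  forall A, measurable A ->
    P [set w | A (\sum_i a i * G i w)] = normal_law 0 (\sum_i a i ^+ 2) A.
Proof.
move=> mG iG lG A mA.
(* The clock: b is observed at the variance accumulated by the first k summands. *)
pose t k : R := \sum_(i < m | (i < k)%N) a i ^+ 2.
pose S k (w : T) : R := \sum_(i < m | (i < k)%N) a i * G i w.
have t0 k : 0 <= t k by apply: sumr_ge0 => i _; exact: sqr_ge0.
have stepE (F : 'I_m -> R) k (km : (k < m)%N) :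
    \sum_(i < m | (i < k.+1)%N) F i = \sum_(i < m | (i < k)%N) F i + F (Ordinal km).
  rewrite (bigD1 (Ordinal km)) ?ltnSn//= addrC; congr (_ + _); apply: eq_bigl => i.
  by rewrite -val_eqE/= ltnS leq_eqVlt; case: ltngtP.
have Smeas k : fam_meas G [set i : 'I_m | (i < k)%N]%SET (S k).
  rewrite /S; under [X in fam_meas _ _ X]eq_fun do rewrite big_mkcond/=.
  apply: measurable_sum => i; have [ik|ik] := boolP (i < k)%N; last exact: measurable_cst.
  by apply: measurable_funM => //; apply: fam_meas_coord; rewrite inE.
have mS k : measurable_fun setT (S k) by exact: fam_measW (Smeas k).
suff H k : (k <= m)%N -> forall A, measurable A ->
    P (S k @^-1` A) = P ((fun w => b (t k) w - b 0 w) @^-1` A).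
  have -> : \sum_i a i ^+ 2 = t m by apply: eq_bigl => i; rewrite ltn_ord.
  transitivity (P (S m @^-1` A)).
    have SmE w : S m w = \sum_i a i * G i w by apply: eq_bigl => i; rewrite ltn_ord.
    by congr (P _); apply/seteqP; split => w /=; rewrite SmE.
  rewrite H// /normal_law; have [tm0|tm0] := eqVneq (t m) 0.
    rewrite tm0; have [A0|A0] := pselect (A 0).
      rewrite (_ : _ @^-1` _ = setT); last by apply/seteqP; split => w //= _; rewrite subrr.
      by rewrite probability_setT diracE mem_set.
    rewrite (_ : _ @^-1` _ = set0); last by apply/seteqP; split => w //=; rewrite subrr.
    by rewrite measure0 diracE memNset.
  have tp : 0 < t m by rewrite lt_neqAle eq_sym tm0 t0.
  by have := wiener1_law (lexx 0) tp mA; rewrite subr0.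
elim: k => [|k IH] km B mB.
  have -> : t 0%N = 0 by apply: big_pred0 => i; rewrite ltn0.
  have S0 w : S 0%N w = 0 by apply: big_pred0 => i; rewrite ltn0.
  by congr (P _); apply/seteqP; split => w /=; rewrite S0 subrr.
have tS : t k.+1 = t k + a (Ordinal km) ^+ 2 by exact: stepE.
transitivity (P [set w | B (S k w + a (Ordinal km) * G (Ordinal km) w)]).
  have SS w : S k.+1 w = S k w + a (Ordinal km) * G (Ordinal km) w.
    exact: (stepE (fun i => a i * G i w)).
  by congr (P _); apply/seteqP; split => w /=; rewrite SS.
transitivity (P [set w | B ((b (t k) w - b 0 w) + (b (t k.+1) w - b (t k) w))]); last first.
  have e w : b (t k) w - b 0 w + (b (t k.+1) w - b (t k) w) = b (t k.+1) w - b 0 w.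
    by rewrite addrC addrA subrK.
  by congr (P _); apply/seteqP; split => w /=; rewrite e.
(* Adding a summand: on both sides an independent sum is formed, with the same two marginal laws. *)
apply: indep2_sum_law => //.
- exact: measurable_funM.
- by apply: measurable_funB; exact: wiener1_meas.
- by apply: measurable_funB; exact: wiener1_meas.
- apply: (@fam_indep2 _ _ _ _ _ G mG iG [set i : 'I_m | (i < k)%N]%SET
    [set Ordinal km]%SET).
  + by rewrite disjoint_sym disjoints1 inE/= ltnn.
  + exact: Smeas.
  + by apply: measurable_funM => //; apply: fam_meas_coord; rewrite inE.
(* The times 0, t k, t k.+1, continued as a constant, because [wiener1] quantifies over infinite
   nondecreasing sequences. *)
- move=> C D mC mD; pose u (i : nat) : R := if i is i'.+1 then
    (if i' is _.+1 then t k.+1 else t k) else 0.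
  have [_ _ /(_ 2%N u) + _ _] := hb; rewrite /= lexx => /(_ isT).
  have mu : {homo u : i j / (i <= j)%N >-> i <= j}.
    move=> [|[|i]] [|[|j]] //= _; rewrite ?lexx//.
    by rewrite tS lerDl sqr_ge0.
  move=> /(_ mu [set: 'I_2]%SET (fun i => if i == ord0
    then (fun w => b (t k) w - b 0 w) @^-1` C
    else (fun w => b (t k.+1) w - b (t k) w) @^-1` D)).
  rewrite (_ : \bigcap_(i in _) _ = (fun w => b (t k) w - b 0 w) @^-1` C `&`
    (fun w => b (t k.+1) w - b (t k) w) @^-1` D); last first.
    apply/seteqP; split => [w h|w [h1 h2] [[|[|i]] ilt] _] //=.
    by split; [apply: (h ord0)|apply: (h ord_max)]; rewrite /= inE.
  rewrite (eq_bigl xpredT) => [|i]; last by rewrite inE.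
  rewrite big_ord_recl big_ord1/= => -> // -[[|[|i]] ilt] _ //=.
  + by exists C => //; rewrite setTI.
  + by exists D => //; rewrite setTI.
- exact: IH (ltnW km).
(* A zero weight leaves the clock unchanged; the law of increments is given only for s < t. *)
- move=> C mC; have [a0|a0] := eqVneq (a (Ordinal km)) 0.
    have -> : t k.+1 = t k by rewrite tS a0 expr0n/= addr0.
    by rewrite a0; congr (P _); apply/seteqP; split => w /=; rewrite mul0r subrr.
  have tlt : t k < t k.+1 by rewrite tS ltrDl lt_neqAle eq_sym sqrf_eq0 a0 sqr_ge0.
  have := wiener1_law (t0 k) tlt mC.
  rewrite tS [t k + _]addrC addrK sqrtr_sqr -[X in normal_prob _ X](mulr1 `|_|).
  rewrite -normal_prob_scale// -(lG (Ordinal km)).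
    by move=> <-.
  by have := measurable_affine (a (Ordinal km)) measurableT mC; rewrite setTI.
Qed.

End gaussian_sums.

(** * Convergence of the Euler scheme *)

Section matrix_norm.
Variable R : realType.

Lemma mx_norm_leP m n (x : 'M[R]_(m, n)) (e : R) : 0 <= e ->
  (forall i j, `|x i j| <= e) -> `|x| <= e.
Proof.
move=> e0 h; rewrite -[`|x|]/(mx_norm x) mx_normrE.
by apply/bigmax_leP; split => // -[i j] _; exact: h.
Qed.

Lemma coord_norm_le m n (x : 'M[R]_(m, n)) i j : `|x i j| <= `|x|.
Proof.
rewrite -[`|x|]/(mx_norm x) mx_normrE.
exact: (le_bigmax _ (fun ij : 'I_m * 'I_n => `|x ij.1 ij.2|) (i, j)).
Qed.

End matrix_norm.

Section heine_cantor.
Variables (R : realType) (T : pseudoMetricType R).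

(** Two sets occur because a path is continuous on the half-line K' while only one of the two times
    has to stay in the compact interval K. *)
Lemma heine_cantor (f : T -> R) (K K' : set T) (e : R) : compact K ->
  (forall x, K x -> f z @[z --> within K' (nbhs x)] --> f x) -> 0 < e ->
  \forall d \near (0 : R)^'+, forall x y, K x -> K' x -> K' y -> ball x d y ->
    `|f x - f y| < e.
Proof.
move=> cK cf e0.
pose Q (d : R) x := forall y, K' x -> K' y -> ball x d y -> `|f x - f y| < e.
suff : \forall d \near (0 : R)^'+, K `<=` Q d.
  by apply: filterS => d KQ x y Kx K'x K'y; exact: KQ.
(* Compactness in its covering form: a property valid near each point for all small d holds on K for
   all small d. *)
apply: (proj1 (compact_near_coveringP K)) => // x Kx.
have /cvgrPdist_lt/(_ (e / 2)) := cf _ Kx.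
rewrite divr_gt0// => /(_ isT); rewrite near_withinE => /nbhs_ballP[r /= r0 xr].
near=> x' d => /= y K'x' K'y x'y.
have xx' : ball x (r / 2) x'.
  near: x'; exact: nbhsx_ballx (divr_gt0 r0 _).
have dr : d <= r / 2 by near: d; apply: nbhs_right_le; rewrite divr_gt0.
have h1 : `|f x - f x'| < e / 2.
  by apply: xr => //; apply: le_ball xx'; rewrite ler_pdivrMr// ler_peMr// ?(ltW r0)// ler1n.
have h2 : `|f x - f y| < e / 2.
  apply: xr => //; rewrite (splitr r); apply: ball_triangle xx' _.
  exact: le_ball x'y.
rewrite (splitr e) (le_lt_trans (ler_distD (f x) _ _))// distrC.
exact: ltrD.
Unshelve. all: by end_near. Qed.

End heine_cantor.

Section path.
Variables (R : realType) (k r : nat).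
Variables (y : R -> 'cV[R]_k) (v : R -> 'cV[R]_r) (B : 'cV[R]_k -> 'cV[R]_k).
Variables (S : 'M[R]_(k, r)) (c : 'cV[R]_k) (L : R).
Local Notation mu := (@lebesgue_measure R).
Hypothesis L0 : 0 <= L.
Hypothesis LB : forall x z, `|B x - B z| <= L * `|x - z|.
Hypothesis cy : forall i, {within `[0, +oo[, continuous (fun t => y t i 0)}.
Hypothesis ey : forall t, 0 <= t -> forall i,
  y t i 0 = c i 0 + \int[mu]_(s in `[0, t]) B (y s) i 0 + (S *m v t) i 0.

Lemma path_modulus (H e : R) : 0 < e -> \forall d \near (0 : R)^'+,
  forall s t : R, 0 <= s -> s <= H -> 0 <= t -> `|s - t| < d -> `|y s - y t| <= e.
Proof.
move=> e0.
have h (i : 'I_k) : \forall d \near (0 : R)^'+, forall s t : R,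
    `[0, H]%classic s -> `[0, +oo[%classic s -> `[0, +oo[%classic t -> ball s d t ->
    `|y s i 0 - y t i 0| < e.
  apply: (@heine_cantor _ R (fun t => y t i 0)) => //; first exact: segment_compact.
  move=> x /=; rewrite in_itv/= => /andP[x0 _].
  by have /subspace_continuousP := @cy i; apply; rewrite /= in_itv/= x0.
apply: filterS (filter_forall _ h) => d hd s t s0 sH t0 st.
apply: mx_norm_leP => [|i j]; first exact: ltW.
rewrite !mxE ord1; apply/ltW/hd => //=; rewrite ?in_itv/= ?s0 ?t0//.
Qed.

Lemma drift_modulus (H e : R) : 0 < e -> \forall d \near (0 : R)^'+,
  forall (s t : R) i, 0 <= s -> s <= H -> 0 <= t -> `|s - t| < d ->
  `|B (y s) i 0 - B (y t) i 0| <= e.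
Proof.
move=> e0; have e1 : 0 < e / (L + 1) by rewrite divr_gt0// ltr_wpDl.
apply: filterS (path_modulus H e1) => d hd s t i s0 sH t0 st.
have -> : B (y s) i 0 - B (y t) i 0 = (B (y s) - B (y t)) i 0 by rewrite !mxE.
apply: (le_trans (coord_norm_le _ _ _)); apply: (le_trans (LB _ _)).
apply: (le_trans (ler_wpM2l L0 (hd s t s0 sH t0 st))).
by rewrite mulrCA ler_piMr ?(ltW e0)// ler_pdivrMr ?ltr_wpDl// mul1r lerDl.
Qed.

Lemma drift_continuous i (H : R) :
  {within `[0, H], continuous (fun t => B (y t) i 0)}.
Proof.
apply/subspace_continuousP => x /=; rewrite in_itv/= => /andP[x0 xH].
apply/cvgrPdist_le => e e0.
near (0 : R)^'+ => d.
have d0 : 0 < d by near: d; exact: nbhs_right_gt.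
have hd : forall (s t : R) i, 0 <= s -> s <= H -> 0 <= t -> `|s - t| < d ->
    `|B (y s) i 0 - B (y t) i 0| <= e by near: d; exact: drift_modulus.
rewrite near_withinE; apply/nbhs_ballP; exists d => //= z xz.
by rewrite in_itv/= => /andP[z0 _]; exact: hd.
Unshelve. all: by end_near. Qed.

Lemma drift_integrable i (a b : R) : 0 <= a ->
  mu.-integrable `[a, b] (EFin \o (fun t => B (y t) i 0)).
Proof.
move=> a0; apply: (@integrableS _ _ _ mu `[0, b]) => //.
  by apply: subset_itvr; rewrite bnd_simp.
apply: continuous_compact_integrable; first exact: segment_compact.
exact: drift_continuous.
Qed.

Lemma drift_step (H e : R) : 0 < e -> \forall d \near (0 : R)^'+,
  forall a b : R, 0 <= a -> a <= b -> b <= H -> b - a < d -> forall i,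
  `|\int[mu]_(s in `[0, b]) B (y s) i 0 - \int[mu]_(s in `[0, a]) B (y s) i 0
    - (b - a) * B (y a) i 0| <= (b - a) * e.
Proof.
move=> e0; apply: filterS (drift_modulus H e0) => d hd a b a0 ab bH bad i.
have iab := drift_integrable i b a0.
rewrite Rintegral_itvB//; [|exact: drift_integrable|by rewrite bnd_simp..].
rewrite Rintegral_itv_obnd_cbnd; last first.
  by apply: integrableS iab => //; apply: subset_itvr; rewrite bnd_simp.
have icst (x : R) : mu.-integrable `[a, b] (EFin \o cst x).
  by apply: continuous_compact_integrable; [exact: segment_compact|move=> ?; exact: cvg_cst].
have cstE (x : R) : \int[mu]_(_ in `[a, b]) x = (b - a) * x.
  transitivity (x * fine (mu `[a, b]%classic)); first by rewrite Rintegral_cst.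
  rewrite mulrC lebesgue_measure_itv/= lte_fin.
  by move: ab; rewrite le_eqVlt => /predU1P[->|->]; rewrite ?ltxx ?subrr.
rewrite -cstE -RintegralB//; last exact: icst.
have iB : mu.-integrable `[a, b] (EFin \o (fun x => B (y x) i 0 - B (y a) i 0)).
  by apply: (integrableB _ iab (icst (B (y a) i 0))).
apply: (le_trans (le_normr_Rintegral _ iB)) => //.
rewrite -cstE; apply: le_Rintegral => //.
- exact: integrable_norm.
- exact: icst.
- move=> x /=; rewrite in_itv/= => /andP[ax xb].
  rewrite distrC; apply: hd => //; first exact: le_trans bH.
    exact: le_trans ax.
  by rewrite distrC ger0_norm ?subr_ge0// (le_lt_trans _ bad)// lerD2r.
Qed.

(** Step l reads only the first l increments; this is the adaptedness exploited later. *)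
Fixpoint euler (tau : R) (dv : nat -> 'cV[R]_r) (l : nat) : 'cV[R]_k :=
  if l is l'.+1 then
    euler tau dv l' + tau *: B (euler tau dv l') + S *m dv l'
  else c.

Lemma path_increment (s t : R) i : 0 <= s -> 0 <= t -> y t i 0 - y s i 0 -
    (S *m (v t - v s)) i 0 =
  \int[mu]_(u in `[0, t]) B (y u) i 0 - \int[mu]_(u in `[0, s]) B (y u) i 0.
Proof.
move=> s0 t0; rewrite (ey s0) (ey t0) mulmxBr [(S *m v t - _) _ _]mxE.
by rewrite [(- (S *m v s)) _ _]mxE; ring.
Qed.

(** A discrete Gronwall argument. The one-step error tau e' comes from uniform continuity of the
    path, so there is convergence along each path but no rate. *)
Lemma euler_cvg (H e : R) : 0 <= H -> 0 < e -> v 0 = 0 ->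
  \forall d \near (0 : R)^'+, forall (tau : R) (n : nat), 0 < tau -> tau < d ->
    n%:R * tau <= H ->
    `|y (n%:R * tau) -
      euler tau (fun l => v (l.+1%:R * tau) - v (l%:R * tau)) n| <= e.
Proof.
move=> H0 e0 v0.
(* Chosen so that the accumulated error H e' e^(L H) stays below e; the 1 covers H = 0. *)
pose e' := e / (H * expR (L * H) + 1).
have D0 : 0 < H * expR (L * H) + 1 by rewrite ltr_wpDl// mulr_ge0// expR_ge0.
have e'0 : 0 < e' by rewrite divr_gt0.
have He : H * e' * expR (L * H) <= e.
  rewrite mulrAC /e' mulrA ler_pdivrMr// mulrC ler_wpM2l ?(ltW e0)//.
  by rewrite lerDl.
clearbody e'.
apply: filterS (drift_step H e'0) => d hd tau n tau0 taud nH.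
have tau0' := ltW tau0; have e'0' := ltW e'0.
set E := euler tau _.
suff bnd l : (l <= n)%N -> `|y (l%:R * tau) - E l| <=
    l%:R * tau * e' * expR (L * (l%:R * tau)).
  apply: (le_trans (bnd _ (leqnn n))).
  apply: le_trans He.
    apply: ler_pM => //.
    - by rewrite !mulr_ge0 ?ler0n.
    - by rewrite ler_wpM2r.
    - by rewrite ler_expR ler_wpM2l.
elim: l => [|l IH] ln.
  rewrite !mul0r (_ : y 0 - E 0%N = 0) ?normr0//.
  apply/matrixP => i j; rewrite !mxE !ord1 ey// v0 mulmx0 !mxE.
  rewrite (_ : [set` `[0, 0]] = [set 0]) ?set_itv1// Rintegral_set1.
  by rewrite !addr0 subrr.
have {}IH := IH (ltnW ln).
have lt0 : 0 <= l%:R * tau by rewrite mulr_ge0// ltW.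
have lS : l.+1%:R * tau - l%:R * tau = tau by rewrite -mulrBl -natrB// subSnn mul1r.
have lt1 : l%:R * tau <= l.+1%:R * tau by rewrite ler_wpM2r ?(ltW tau0)// ler_nat.
have lSH : l.+1%:R * tau <= H.
  by apply: le_trans nH; rewrite ler_wpM2r ?(ltW tau0)// ler_nat.
set yl := y (l%:R * tau) in IH *.
have step : `|y (l.+1%:R * tau) - E l.+1| <=
    `|yl - E l| + tau * (L * `|yl - E l|) + tau * e'.
  apply: mx_norm_leP => [|i j].
    by rewrite !addr_ge0// ?mulr_ge0 ?ler0n.
  rewrite ord1 /E /= -/E.
  have := hd _ _ lt0 lt1 lSH; rewrite lS => /(_ taud i) h.
  have := path_increment i lt0 (le_trans lt0 lt1); rewrite -/yl => h2.
  rewrite -h2 -/yl in h.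
  have -> : (y (l.+1%:R * tau) - (E l + tau *: B (E l) +
      S *m (v (l.+1%:R * tau) - v (l%:R * tau)))) i 0 =
     (yl - E l) i 0 + tau * (B yl - B (E l)) i 0 +
     (y (l.+1%:R * tau) i 0 - yl i 0 -
      (S *m (v (l.+1%:R * tau) - v (l%:R * tau))) i 0 - tau * B yl i 0).
    set z := S *m _; rewrite !mxE; ring.
  apply: (le_trans (ler_normD _ _)); apply: lerD => //.
  apply: (le_trans (ler_normD _ _)); apply: lerD; first exact: coord_norm_le.
  rewrite normrM (gtr0_norm tau0) ler_wpM2l ?(ltW tau0)//.
  exact: le_trans (coord_norm_le _ _ _) (LB _ _).
apply: (le_trans step).
set X := `|yl - E l| in IH *.
set a := l%:R * tau in IH lt0 lt1 *.
have -> : l.+1%:R * tau = a + tau by rewrite /a -natr1 mulrDl mul1r.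
rewrite [X in expR X]mulrDr expRD.
have tL : 1 + tau * L <= expR (L * tau) by rewrite mulrC expR_ge1Dx.
have ea1 : 1 <= expR (L * a) by rewrite -expR0 ler_expR mulr_ge0.
have et1 : 1 <= expR (L * tau).
  by rewrite -expR0 ler_expR mulr_ge0.
(* The factor 1 + tau L is at most e^(L tau), and the fresh error tau e' is then absorbed because
   the exponentials are at least 1. *)
apply: (@le_trans _ _ (a * e' * (expR (L * a) * expR (L * tau)) + tau * e')).
  rewrite lerD2r -[X in X + _]mulr1 [tau * _]mulrA [_ * X]mulrC -mulrDr.
  rewrite mulrA; apply: ler_pM => //; first exact: normr_ge0.
  by rewrite addr_ge0// mulr_ge0.
rewrite [(a + tau) * e']mulrDl mulrDl lerD2l ler_peMr//.
  by rewrite mulr_ge0// ltW.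
by rewrite mulr_ege1.
Qed.

(** The limit is written through the path and its driving noise instead of the time integral, so
    that the probabilistic estimates handle only finite sums of random variables. *)
Lemma riemann_cvg (s t : R) i : 0 <= s -> s <= t ->
  \sum_(l < n) ((t - s) / n%:R) * B (y (s + l%:R * ((t - s) / n%:R))) i 0
     @[n --> \oo] --> y t i 0 - y s i 0 - (S *m (v t - v s)) i 0.
Proof.
move=> s0 st; have t0 := le_trans s0 st.
rewrite path_increment//; apply/cvgrPdist_le => e e0.
have ts0 : 0 <= t - s by rewrite subr_ge0.
have e'0 : 0 < e / (t - s + 1) by rewrite divr_gt0// ltr_wpDl.
near (0 : R)^'+ => d.
have d0 : 0 < d by near: d; exact: nbhs_right_gt.
have hd : forall a b : R, 0 <= a -> a <= b -> b <= t -> b - a < d -> forall i,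
  `|\int[mu]_(s in `[0, b]) B (y s) i 0 - \int[mu]_(s in `[0, a]) B (y s) i 0
    - (b - a) * B (y a) i 0| <= (b - a) * (e / (t - s + 1)).
  by near: d; exact: drift_step.
near=> n.
have n0 : (0 < n)%N by near: n; exact: nbhs_infty_gt.
have nR0 : 0 < (n%:R : R) by rewrite ltr0n.
have nd : (t - s) / n%:R < d.
  rewrite ltr_pdivrMr// mulrC -ltr_pdivrMr//.
  by near: n; exact: nbhs_infty_gtr.
set tau := (t - s) / n%:R in nd *.
have tau0 : 0 <= tau by rewrite divr_ge0// ltW.
pose J u := \int[mu]_(u in `[0, u]) B (y u) i 0.
have tel : J t - J s = \sum_(l < n) (J (s + l.+1%:R * tau) - J (s + l%:R * tau)).
  rewrite -(big_mkord xpredT (fun l => J (s + l.+1%:R * tau) - J (s + l%:R * tau))).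
  rewrite telescope_sumr// mul0r addr0; congr (J _ - _).
  by rewrite /tau mulrC divfK ?gt_eqF// addrC subrK.
rewrite -/(J t) -/(J s) tel -sumrB.
apply: (le_trans (ler_norm_sum _ _ _)).
apply: (@le_trans _ _ (\sum_(l < n) tau * (e / (t - s + 1)))).
  apply: ler_sum => l _.
  have e1 : s + l.+1%:R * tau - (s + l%:R * tau) = tau.
    by rewrite -natr1; ring.
  have := hd (s + l%:R * tau) (s + l.+1%:R * tau).
  rewrite e1 => h; apply: h => //.
  - by rewrite addr_ge0// mulr_ge0.
  - by rewrite lerD2l ler_wpM2r// ler_nat.
  - rewrite -lerBrDl /tau mulrCA ler_piMr// ler_pdivrMr// mul1r ler_nat.
    exact: ltn_ord.
rewrite sumr_const card_ord -mulr_natl mulrA [n%:R * tau]mulrC /tau divfK ?gt_eqF//.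
by rewrite mulrA ler_pdivrMr ?ltr_wpDl// mulrC ler_wpM2l ?(ltW e0)// lerDl.
Unshelve. all: by end_near. Qed.

End path.

(** * Borel measurability of random vectors *)

Section borel_vectors.
Variables (R : realType) (k : nat).

Definition ratbox (qm : 'cV[rat]_k * nat) : set 'cV[R]_k :=
  [set z | forall i, `|z i 0 - ratr (qm.1 i 0)| < qm.2.+1%:R^-1].

(** Boxes with rational centres and radii 1/(m+1) form a countable base. The union runs over
    pickling codes; codes of nothing, or of a box not contained in O, contribute the empty set. *)
Lemma open_ratbox (O : set 'cV[R]_k) : open O ->
  O = \bigcup_n (if unpickle n is Some qm then
    (if pselect (ratbox qm `<=` O) then ratbox qm else set0) else set0).
Proof.
move=> oO; apply/seteqP; split => [x Ox|x [n _]]; last first.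
  by case: (unpickle n) => [qm|//]; case: pselect => // h /h.
have /nbhs_ballP[e /= e0 xe] : nbhs x O by exact: open_nbhs_nbhs.
near \oo => m.
have m0 : 0 < (m.+1%:R^-1 : R) by rewrite invr_gt0.
have me : m.+1%:R^-1 < e / 2.
  by near: m; apply: near_infty_natSinv_lt (PosNum (divr_gt0 e0 (ltr0n R 2))).
have hq (i : 'I_k) : exists q : rat, `|x i 0 - ratr q| < m.+1%:R^-1.
  have : x i 0 - m.+1%:R^-1 < x i 0 + m.+1%:R^-1.
    by rewrite ltrD2l gtrN.
  move=> /rat_in_itvoo[q]; rewrite in_itv/= => /andP[q1 q2]; exists q.
  by rewrite distrC ltr_norml ltrBrDl q1 ltrBlDl.
have [q hq'] := choice hq.
pose qm : 'cV[rat]_k * nat := (\col_i q i, m).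
have xq : ratbox qm x by move=> i; rewrite /= mxE.
exists (pickle qm) => //; rewrite pickleK; case: pselect => // -[].
move=> z zq; apply: xe; split => // i j; rewrite ord1.
have := zq i; rewrite /= mxE => h1.
rewrite /ball/= (splitr e) (le_lt_trans (ler_distD (ratr (q i)) _ _))//.
by rewrite ltrD//; [exact: lt_trans (hq' i) me|rewrite distrC; exact: lt_trans h1 me].
Unshelve. all: by end_near. Qed.

Lemma measurable_cV d (T : measurableType d) (X : T -> 'cV[R]_k) :
  (forall i, measurable_fun setT (fun w => X w i 0)) ->
  measurable_fun setT (X : T -> borel_cV R k).
Proof.
move=> mX; apply: (@measurability _ _ T (borel_cV R k) setT X (@open 'cV[R]_k)) => //.
move=> _ [U oU <-]; rewrite setTI (open_ratbox oU) preimage_bigcup.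
apply: bigcupT_measurable => n; case: (unpickle n) => [qm|]; last first.
  by rewrite preimage_set0.
case: pselect => ? /=; last by rewrite preimage_set0.
rewrite (_ : _ @^-1` _ = \bigcap_(i in [set` [set: 'I_k]%SET])
   (fun w => `|X w i 0 - ratr (qm.1 i 0)|) @^-1` `]-oo, (qm.2.+1%:R^-1)[%classic); last first.
  apply/seteqP; split => [w h i _ /=|w h i /=]; first by rewrite in_itv/=; exact: h.
  by have := h i; rewrite /= in_itv/= inE => /(_ isT).
apply: fin_bigcap_measurable => [|i _]; first exact: finite_finset.
rewrite -[X in measurable X]setTI.
have mf : measurable_fun setT (fun w => `|X w i 0 - ratr (qm.1 i 0)|).
  apply: measurableT_comp; first exact: normr_measurable.
  by apply: measurable_funB => //; exact: measurable_cst.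
by apply: mf => //; exact: measurable_itv.
Qed.

Lemma continuous_borel_measurable (f : 'cV[R]_k -> R) : continuous f ->
  measurable_fun setT (f : borel_cV R k -> R).
Proof.
move=> cf; apply: (measurability _ (RGenOpens.measurableE R)) => //.
move=> _ [_ [a [b ->]] <-]; rewrite setTI; apply: sub_sigma_algebra.
by move/continuousP : cf; apply; exact: interval_open.
Qed.

Lemma measurable_comp_cV d (T : measurableType d) (X : T -> 'cV[R]_k)
    (f : 'cV[R]_k -> R) : continuous f ->
  (forall i, measurable_fun setT (fun w => X w i 0)) ->
  measurable_fun setT (fun w => f (X w)).
Proof.
move=> cf mX.
exact: (measurableT_comp (continuous_borel_measurable cf) (measurable_cV mX)).
Qed.

Lemma borel_coord_measurable d (T : measurableType d) (X : T -> 'cV[R]_k) i :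
  measurable_fun setT (X : T -> borel_cV R k) ->
  measurable_fun setT (fun w => X w i 0).
Proof.
move=> mX; apply: (measurableT_comp (f := fun z : borel_cV R k => z i 0)) => //.
by apply: continuous_borel_measurable; exact: coord_continuous.
Qed.

End borel_vectors.

(** * Orthogonality of sums of past-dependent coefficients times centred increments *)

Section orthogonal_sums.
Variables (d : measure_display) (T : measurableType d) (R : realType).
Variable P : probability T R.
Variables (I : finType) (G : I -> T -> R).
Hypothesis mG : forall i, measurable_fun setT (G i).
Hypothesis indG : independent_systems P (fun i => sigma_rv (G i)).
Variables (psi D : nat -> T -> R) (J J' : nat -> {set I}) (K v : R) (n : nat).
Hypothesis JS : forall j, J j \subset J j.+1.
Hypothesis JJ' : forall j, [disjoint J j & J' j]%B.
Hypothesis mpsi : forall j, (j < n)%N -> fam_meas G (J j) (psi j).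
Hypothesis mD : forall j, (j < n)%N -> fam_meas G (J j.+1) (D j).
Hypothesis mD' : forall j, (j < n)%N -> fam_meas G (J' j) (D j).
Hypothesis psiK : forall j w, `|psi j w| <= K.
Hypothesis sD : forall j, (j < n)%N -> sqi P (D j).
Hypothesis D1 : forall j, (j < n)%N -> ex P (D j) = 0.
Hypothesis D2 : forall j, (j < n)%N -> ex P (fun w => D j w ^+ 2) = v.

(** A martingale-difference computation without conditional expectations: the partial sum times
    [psi q] is a function of the past [J q], while [D q] is a centred function of the disjoint set
    [J' q], so the cross term vanishes. Bounded coefficients make all products integrable. *)
Lemma orthogonal_sum q : (q <= n)%N ->
  [/\ fam_meas G (J q) (fun w => \sum_(j < q) psi j w * D j w),
      sqi P (fun w => \sum_(j < q) psi j w * D j w) &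
      ex P (fun w => (\sum_(j < q) psi j w * D j w) ^+ 2) =
      \sum_(j < q) ex P (fun w => psi j w ^+ 2) * v].
Proof.
elim: q => [_|q IH qn].
  have -> : (fun w => \sum_(j < 0) psi j w * D j w) = fun=> 0.
    by apply/funext => w; rewrite big_ord0.
  rewrite big_ord0; split; [exact: measurable_cst|exact: sqi_cst|].
  have -> : (fun w : T => (\sum_(j < 0) psi j w * D j w) ^+ 2) = fun=> 0.
    by apply/funext => w; rewrite big_ord0 expr0n.
  exact: ex_cst.
have [IHm IHs IHe] := IH (ltnW qn).
set Sq := (fun w => \sum_(j < q) psi j w * D j w) in IHm IHs IHe.
have SE w : \sum_(j < q.+1) psi j w * D j w = Sq w + psi q w * D q w.
  by rewrite big_ord_recr.
have -> : (fun w => \sum_(j < q.+1) psi j w * D j w) =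
    fun w => Sq w + psi q w * D q w by apply/funext => w.
have -> : (fun w => (\sum_(j < q.+1) psi j w * D j w) ^+ 2) =
    fun w => (Sq w + psi q w * D q w) ^+ 2 by apply/funext => w; rewrite SE.
have mpT : measurable_fun setT (psi q) by exact: fam_measW (mpsi qn).
have [mDT iD2] := sD qn.
have iD := sqi_itg (sD qn).
have psi2 w : `|psi q w ^+ 2| <= K ^+ 2.
  by rewrite normrX lerXn2r ?nnegrE// (le_trans _ (psiK q w)).
have ip2 : itg P (fun w => psi q w ^+ 2).
  by apply: itg_bounded psi2; exact: measurable_funX.
have sp : sqi P (psi q) by split.
have iSp : itg P (fun w => Sq w * psi q w) by exact: sqi_itgM.
have mSp : fam_meas G (J q) (fun w => Sq w * psi q w).
  by apply: measurable_funM => //; exact: mpsi.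
have mp2 : fam_meas G (J q) (fun w => psi q w ^+ 2).
  by apply: measurable_funX => //; exact: mpsi.
have mD2 : fam_meas G (J' q) (fun w => D q w ^+ 2).
  by apply: measurable_funX => //; exact: mD'.
have [i1 e1] := fam_exM mG indG (JJ' q) mSp (mD' qn) iSp iD.
have [i2 e2] := fam_exM mG indG (JJ' q) mp2 mD2 ip2 iD2.
have spD : sqi P (fun w => psi q w * D q w).
  split; first exact: measurable_funM.
  by under eq_fun do rewrite exprMn.
split.
- apply: measurable_funD.
    by apply: fam_meas_sub IHm.
  apply: measurable_funM; last exact: mD.
  by apply: fam_meas_sub (mpsi qn).
- exact: sqiD.
rewrite big_ord_recr/= -IHe.
have -> : (fun w => (Sq w + psi q w * D q w) ^+ 2) =
    fun w => (Sq w ^+ 2 + 2 * (Sq w * psi q w * D q w)) + psi q w ^+ 2 * D q w ^+ 2.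
  by apply/funext => w; ring.
have [_ iS2] := IHs.
rewrite exD//; last by apply: itgD => //; exact: itgZ.
rewrite exD//; last exact: itgZ.
by rewrite exZ// e1 D1// mulr0 mulr0 addr0 e2 D2.
Qed.

End orthogonal_sums.

Section wiener_moments.
Variables (d : measure_display) (T : measurableType d) (R : realType).
Variable P : probability T R.
Variables (r : nat) (W : R -> T -> 'cV[R]_r).
Hypothesis hW : wiener P W.

Lemma wiener_law a s t : 0 <= s -> s < t -> forall A, measurable A ->
  P [set w | A (W t w a 0 - W s w a 0)] = normal_prob 0 (Num.sqrt (t - s)) A.
Proof.
move=> s0 st A mA; have [/(_ a)[_ _ _ h _] _] := hW; exact: (h s t A).
Qed.

Lemma wiener_incr_meas a s t : 0 <= s -> 0 <= t ->
  measurable_fun setT (fun w => W t w a 0 - W s w a 0).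
Proof. by move=> s0 t0; apply: measurable_funB; exact: (wiener_meas hW). Qed.

Lemma wiener_incr_pow a s t q : 0 <= s -> s < t ->
  itg P (fun w => (W t w a 0 - W s w a 0) ^+ q).
Proof.
move=> s0 st; have t0 := ltW (le_lt_trans s0 st).
apply: (@gauss_itg_pow _ _ _ P (Num.sqrt (t - s)) (fun w => W t w a 0 - W s w a 0)).
- by rewrite sqrtr_gt0 subr_gt0.
- exact: wiener_incr_meas.
- exact: wiener_law.
Qed.

Lemma wiener_incr_sqi a s t : 0 <= s -> s <= t ->
  sqi P (fun w => W t w a 0 - W s w a 0).
Proof.
move=> s0; rewrite le_eqVlt => /predU1P[<-|st].
  by under eq_fun do rewrite subrr; exact: sqi_cst.
have t0 := ltW (le_lt_trans s0 st).
by split; [exact: wiener_incr_meas|exact: wiener_incr_pow].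
Qed.

Lemma wiener_incr_ex1 a s t : 0 <= s -> s < t ->
  ex P (fun w => W t w a 0 - W s w a 0) = 0.
Proof.
move=> s0 st; have t0 := ltW (le_lt_trans s0 st).
apply: (@gauss_ex1 _ _ _ P (Num.sqrt (t - s))).
- by rewrite sqrtr_gt0 subr_gt0.
- exact: wiener_incr_meas.
- exact: wiener_law.
Qed.

Lemma wiener_incr_ex2 a s t : 0 <= s -> s <= t ->
  ex P (fun w => (W t w a 0 - W s w a 0) ^+ 2) = t - s.
Proof.
move=> s0; rewrite le_eqVlt => /predU1P[<-|st].
  by under eq_fun do rewrite subrr expr0n; rewrite ex_cst subrr.
have t0 := ltW (le_lt_trans s0 st).
rewrite -[RHS]sqr_sqrtr ?subr_ge0 ?(ltW st)//.
apply: (@gauss_ex2 _ _ _ P (Num.sqrt (t - s)) (fun w => W t w a 0 - W s w a 0)).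
- by rewrite sqrtr_gt0 subr_gt0.
- exact: wiener_incr_meas.
- exact: wiener_law.
Qed.

End wiener_moments.

Lemma cvg_fsum (R : realType) (I : finType) (F : nat -> I -> R) (l : I -> R) :
  (forall i, F N i @[N --> \oo] --> l i) ->
  \sum_i F N i @[N --> \oo] --> \sum_i l i.
Proof.
move=> Fl; apply: (@cvg_big R I +%R 0 xpredT) => //; exact: add_continuous.
Qed.

Section clip.
Variable R : realType.
Implicit Types K x : R.

(** Truncation supplies the bounded coefficients required by [orthogonal_sum]; it is continuous,
    hence compatible with the limit of the Euler schemes. *)
Definition clip (K x : R) : R := Num.max (- K) (Num.min x K).

Lemma clip_norm K x : 0 <= K -> `|clip K x| <= K.
Proof.
move=> K0; rewrite ler_norml /clip le_max lexx/= ge_max ge_min lexx orbT andbT.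
by rewrite (le_trans _ K0)// oppr_le0.
Qed.

Lemma clip_sqr K x : 0 <= K -> clip K x ^+ 2 <= x ^+ 2.
Proof.
move=> K0; rewrite -(real_normK (num_real (clip K x))) -(real_normK (num_real x)).
rewrite lerXn2r ?nnegrE// /clip.
have [xK|xK] := leP x K.
  have [Kx|Kx] := leP (- K) x => //.
  rewrite normrN (ger0_norm K0) ltr0_norm ?(lt_le_trans Kx) ?oppr_le0//.
  by rewrite lerNr ltW.
rewrite max_r; last by rewrite (le_trans _ K0)// oppr_le0.
by rewrite !ger0_norm// ?ltW// (le_lt_trans K0).
Qed.

Lemma clip_continuous K : continuous (clip K).
Proof.
move=> x; apply: (@continuous_max R R (cst (- K)) (fun x => Num.min x K) x).
  exact: cvg_cst.
by apply: (@continuous_min R R id (cst K) x); [exact: cvg_id|exact: cvg_cst].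
Qed.

Lemma clip_id K x : `|x| <= K -> clip K x = x.
Proof. by rewrite ler_norml => /andP[h1 h2]; rewrite /clip min_l// max_r. Qed.

End clip.

Section linear.
Variables (d : measure_display) (T : measurableType d) (R : realType).
Variable P : probability T R.
Lemma ex_lin_le (I : finType) (c : I -> R) (X : I -> T -> R) (m : R) :
  (forall i, itg P (X i) /\ ex P (fun w => `|X i w|) <= m) ->
  itg P (fun w => \sum_i c i * X i w) /\
  ex P (fun w => `|\sum_i c i * X i w|) <= (\sum_i `|c i|) * m.
Proof.
move=> hX.
have ic i : itg P (fun w => c i * X i w) by apply: itgZ; have [] := hX i.
have iS : itg P (fun w => \sum_i c i * X i w) by apply: itg_sum => i _.
split => //.
have ia i : itg P (fun w => `|c i| * `|X i w|).
  by apply: itgZ; apply: itg_norm; have [] := hX i.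
apply: (@le_trans _ _ (ex P (fun w => \sum_i `|c i| * `|X i w|))).
  apply: ex_le; [exact: itg_norm|by apply: itg_sum => i _|].
  move=> w; apply: (le_trans (ler_norm_sum _ _ _)).
  by apply: ler_sum => i _; rewrite normrM.
rewrite ex_sum// mulr_suml; apply: ler_sum => i _.
have [iX eX] := hX i.
by rewrite exZ ?ler_wpM2l//; exact: itg_norm.
Qed.

End linear.

Section pairing.
Variable R : realType.

(** The Frobenius inner product. Entries and linear forms of the estimation error are all treated as
    pairings with a symmetric matrix. *)
Definition pairing m n (D N : 'M[R]_(m, n)) := \sum_(x : 'I_m * 'I_n) D x.1 x.2 * N x.1 x.2.

Lemma pairingE m n (D N : 'M[R]_(m, n)) : pairing D N = \tr (D^T *m N).
Proof.
rewrite /pairing -(pair_bigA _ (fun i j => D i j * N i j)) exchange_big.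
by apply: eq_bigr => j _; rewrite mxE; apply: eq_bigr => i _; rewrite !mxE.
Qed.

Lemma pairing_conj p r (A : 'M[R]_(p, r)) (D : 'M[R]_p) (N : 'M[R]_r) :
  pairing D (A *m N *m A^T) = pairing (A^T *m D *m A) N.
Proof.
by rewrite !pairingE !trmx_mul trmxK mulmxA mxtrace_mulC !mulmxA.
Qed.

(** Symmetrised so that an entry of a symmetric matrix becomes a pairing with a symmetric matrix, as
    the variance formula for quadratic forms requires. *)
Definition symdelta p (a b : 'I_p) : 'M[R]_p := 2^-1 *: (delta_mx a b + delta_mx b a).

Lemma symdelta_sym p (a b : 'I_p) : (symdelta a b)^T = symdelta a b.
Proof. by rewrite linearZ/= linearD/= !trmx_delta addrC. Qed.

Lemma pairing_symdelta p (a b : 'I_p) (N : 'M[R]_p) : N^T = N ->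
  pairing (symdelta a b) N = N a b.
Proof.
move=> NT.
have h c e : pairing (delta_mx c e) N = N c e.
  rewrite /pairing (bigD1 (c, e))//= mxE !eqxx mul1r big1 ?addr0// => -[x y] xy.
  rewrite mxE; move: xy; rewrite xpair_eqE => /negbTE /= ->; exact: mul0r.
have -> : pairing (symdelta a b) N =
    2^-1 * (pairing (delta_mx a b) N + pairing (delta_mx b a) N).
  rewrite /pairing -big_split mulr_sumr; apply: eq_bigr => x _ /=.
  by rewrite /symdelta !mxE -mulrA mulrDl.
have ba : N b a = N a b by rewrite -[in LHS]NT mxE.
by rewrite !h ba; field.
Qed.

End pairing.

Section limits.
Variable R : realType.

Lemma cvg_dist_le (u b : nat -> R) (l : R) :
  (\forall n \near \oo, `|u n - l| <= b n) -> b n @[n --> \oo] --> 0 ->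
  u n @[n --> \oo] --> l.
Proof.
move=> ub b0; apply/cvgrPdist_le => e e0; near=> n.
rewrite distrC; apply: (@le_trans _ _ (b n)); first by near: n.
apply: (le_trans (ler_norm _)); rewrite -[b n]subr0 -normrN opprB.
by near: n; move/cvgrPdist_le : b0; exact.
Unshelve. all: by end_near. Qed.

Lemma cvg_sqrt0 (u : nat -> R) : u n @[n --> \oo] --> 0 ->
  Num.sqrt (u n) @[n --> \oo] --> 0.
Proof.
move=> u0; rewrite -[X in _ --> X]sqrtr0.
exact: (@continuous_cvg _ _ _ _ _ _ Num.sqrt _ (@sqrt_continuous R _) u0).
Qed.

Lemma cvg_invn : (n%:R : R)^-1 @[n --> \oo] --> 0.
Proof. by rewrite -(cvg_shiftS (fun n => n%:R^-1 : R)); exact: cvg_harmonic. Qed.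

Lemma cvg_inv_sqrtn : (Num.sqrt n%:R : R)^-1 @[n --> \oo] --> 0.
Proof.
rewrite (_ : (fun n => _) = fun n => Num.sqrt (n%:R^-1)); last first.
  by apply/funext => n; rewrite sqrtrV.
exact/cvg_sqrt0/cvg_invn.
Qed.

End limits.

(** * Comparison of cosine means *)

Section taylor.
Variable R : realType.

(** One integration raises the exponent by one. Dropping the factorials keeps the constant equal to
    1 through all Taylor bounds below. *)
Lemma mvt_pow (f df : R -> R) (m : nat) :
  f 0 = 0 -> (forall x : R, is_derive x (1 : R) f (df x)) ->
  (forall x, `|df x| <= `|x| ^+ m) -> forall x, `|f x| <= `|x| ^+ m.+1.
Proof.
move=> f0 fdf dfm x.
have cf (a b : R) : {within `[a, b], continuous f}.
  by apply: derivable_within_continuous => z _; have [] := fdf z.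
have key c : `|c| <= `|x| -> `|df c * x| <= `|x| ^+ m.+1.
  move=> cx; rewrite normrM exprSr ler_wpM2r//.
  by rewrite (le_trans (dfm c))// lerXn2r ?nnegrE.
have [x0|x0] := leP 0 x.
  have [c] := MVT_segment x0 (fun z _ => fdf z) (cf _ _).
  rewrite in_itv/= f0 !subr0 => /andP[c0 cx] ->; apply: key.
  by rewrite !ger0_norm.
have [c] := MVT_segment (ltW x0) (fun z _ => fdf z) (cf _ _).
rewrite in_itv/= f0 !sub0r => /andP[cx c0] e.
rewrite -normrN e mulrN normrN; apply: key.
by rewrite !ler0_norm ?(ltW x0)// lerN2.
Qed.

Lemma norm_cos_le1 (x : R) : `|cos x| <= 1.
Proof. by rewrite ler_norml cos_geN1 cos_le1. Qed.

Lemma norm_sin_le1 (x : R) : `|sin x| <= 1.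
Proof. by rewrite ler_norml sin_geN1 sin_le1. Qed.

Lemma sin_taylor1 (x : R) : `|sin x| <= `|x|.
Proof.
rewrite -[leRHS]expr1; apply: (@mvt_pow sin cos 0); first exact: sin0.
by move=> z; rewrite expr0 norm_cos_le1.
Qed.

Lemma cos_lipschitz (x y : R) : `|cos x - cos y| <= `|x - y|.
Proof.
wlog xy : x y / x <= y.
  move=> H; have [xy|/ltW yx] := leP x y; first exact: H.
  by rewrite distrC [leRHS]distrC; exact: H.
have cs : {within `[x, y], continuous (@cos R)}.
  by apply: continuous_subspaceT => z; exact: continuous_cos.
have [c _ e] := @MVT_segment R cos (fun z => - sin z) x y xy (fun z _ => is_derive_cos z) cs.
by rewrite distrC [leRHS]distrC e normrM ler_piMl// normrN norm_sin_le1.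
Qed.

Lemma cos_taylor2 (x : R) : `|cos x - 1| <= `|x| ^+ 2.
Proof.
apply: (@mvt_pow (fun x => cos x - 1) (fun x => - sin x) 1).
- by rewrite cos0 subrr.
- by move=> z; apply: is_derive_eq; rewrite oppr0 addr0.
- by move=> z; rewrite normrN expr1 sin_taylor1.
Qed.

Lemma sin_taylor3 (x : R) : `|sin x - x| <= `|x| ^+ 3.
Proof.
apply: (@mvt_pow (fun x => sin x - x) (fun x => cos x - 1) 2).
- by rewrite sin0 subr0.
- exact: cos_taylor2.
Qed.

Lemma cos_taylor4 (x : R) : `|cos x - 1 + x ^+ 2 / 2| <= `|x| ^+ 4.
Proof.
apply: (@mvt_pow (fun x => cos x - 1 + x ^+ 2 / 2) (fun x => - (sin x - x)) 3).
- by rewrite cos0 subrr expr0n mul0r addr0.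
- move=> z; apply: is_derive_eq.
  by rewrite scaler0 scaler0 add0r subr0 [z%:A]mulr1 -mulr2n -[z *+ 2]mulr_natl
    [_ *: _]mulKf ?pnatr_eq0// opprB addrC.
- by move=> z; rewrite normrN sin_taylor3.
Qed.

End taylor.

Section cosine_means.
Variables (d : measure_display) (T : measurableType d) (R : realType).
Variable P : probability T R.
Implicit Types X Y : T -> R.

Lemma cos_meas X (t : R) : measurable_fun setT X ->
  measurable_fun setT (fun w => cos (X w + t)).
Proof.
move=> mX; apply: (measurableT_comp (f := cos)).
  by apply: continuous_measurable_fun; exact: continuous_cos.
by apply: measurable_funD => //; exact: measurable_cst.
Qed.

Lemma sin_meas X (t : R) : measurable_fun setT X ->
  measurable_fun setT (fun w => sin (X w + t)).
Proof.
move=> mX; apply: (measurableT_comp (f := sin)).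
  by apply: continuous_measurable_fun; exact: continuous_sin.
by apply: measurable_funD => //; exact: measurable_cst.
Qed.

Lemma cos_itg X (t : R) : measurable_fun setT X ->
  itg P (fun w => cos (X w + t)).
Proof.
move=> mX; apply: (@itg_bounded _ _ _ _ _ 1); first exact: cos_meas.
by move=> w; exact: norm_cos_le1.
Qed.

Lemma sin_itg X (t : R) : measurable_fun setT X ->
  itg P (fun w => sin (X w + t)).
Proof.
move=> mX; apply: (@itg_bounded _ _ _ _ _ 1); first exact: sin_meas.
by move=> w; exact: norm_sin_le1.
Qed.

Let cos0_itg X : measurable_fun setT X -> itg P (fun w => cos (X w)).
Proof. by move=> /(cos_itg 0); under eq_fun do rewrite addr0. Qed.

Let sin0_itg X : measurable_fun setT X -> itg P (fun w => sin (X w)).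
Proof. by move=> /(sin_itg 0); under eq_fun do rewrite addr0. Qed.

Lemma ex_cosD X (t : R) : measurable_fun setT X ->
  ex P (fun w => cos (X w + t)) =
  cos t * ex P (fun w => cos (X w)) - sin t * ex P (fun w => sin (X w)).
Proof.
move=> mX; have ic := cos0_itg mX; have is_ := sin0_itg mX.
rewrite -exZ// -exZ// -exB; [|exact: itgZ..].
by congr ex; apply/funext => w; rewrite cosD; ring.
Qed.

Lemma ex_sinD X (t : R) : measurable_fun setT X ->
  ex P (fun w => sin (X w + t)) =
  cos t * ex P (fun w => sin (X w)) + sin t * ex P (fun w => cos (X w)).
Proof.
move=> mX; have ic := cos0_itg mX; have is_ := sin0_itg mX.
rewrite -exZ// -exZ// -exD; [|exact: itgZ..].
by congr ex; apply/funext => w; rewrite sinD; ring.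
Qed.

(** Taylor expansion of order four for the cosine and of order three for the sine. The third
    absolute moment is interpolated between the second and the fourth, with a free weight a. *)
Lemma cos_moments X (s m a : R) : 0 < a -> measurable_fun setT X ->
  itg P (fun w => X w ^+ 4) -> ex P X = 0 -> ex P (fun w => X w ^+ 2) = s ->
  ex P (fun w => X w ^+ 4) <= m ->
  `|ex P (fun w => cos (X w)) - (1 - s / 2)| <= m /\
  `|ex P (fun w => sin (X w))| <= a * s + a^-1 * m.
Proof.
move=> a0 mX i4 e1 e2 e4.
have mX2 : measurable_fun setT (fun w => X w ^+ 2) by exact: measurable_funX.
have s2 : sqi P (fun w => X w ^+ 2).
  by split => //; under eq_fun do rewrite -exprM.
have i2 := sqi_itg s2.
have i1 : itg P X by apply: sqi_itg; split.
have ic := cos0_itg mX; have is_ := sin0_itg mX.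
have p4 x : `|x : R| ^+ 4 = x ^+ 4.
  by rewrite -[4%N]/(2 * 2)%N !exprM real_normK ?num_real.
have p2 x : `|x : R| ^+ 2 = x ^+ 2 by rewrite real_normK ?num_real.
split.
  have ig : itg P (fun w => cos (X w) - 1 + X w ^+ 2 / 2).
    apply: itgD; first by apply: itgB => //; exact: itg_cst.
    by under eq_fun do rewrite mulrC; exact: itgZ.
  have -> : ex P (fun w => cos (X w)) - (1 - s / 2) =
      ex P (fun w => cos (X w) - 1 + X w ^+ 2 / 2).
    have -> : (fun w => cos (X w) - 1 + X w ^+ 2 / 2) =
        (fun w => cos (X w) + 2^-1 * X w ^+ 2 - 1) by apply/funext => w; ring.
    rewrite exB; [|by apply: itgD => //; exact: itgZ|exact: itg_cst].
    by rewrite exD ?exZ ?ex_cst ?e2//; [ring|exact: itgZ].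
  apply: (le_trans (ex_norm ig)); apply: le_trans e4; apply: ex_le => //.
    exact: itg_norm.
  by move=> w; rewrite -p4 cos_taylor4.
have ig : itg P (fun w => sin (X w) - X w) by exact: itgB.
have -> : ex P (fun w => sin (X w)) = ex P (fun w => sin (X w) - X w).
  by rewrite exB// e1 subr0.
have ir : itg P (fun w => a * X w ^+ 2 + a^-1 * X w ^+ 4).
  by apply: itgD; exact: itgZ.
apply: (le_trans (ex_norm ig)).
apply: (@le_trans _ _ (ex P (fun w => a * X w ^+ 2 + a^-1 * X w ^+ 4))).
  apply: ex_le => //; first exact: itg_norm.
  move=> w; apply: (le_trans (sin_taylor3 _)); rewrite -p2 -p4.
  set x := `|X w|.
  have x0 : 0 <= x by exact: normr_ge0.
  rewrite -subr_ge0 (_ : _ - _ = a^-1 * x ^+ 2 * ((a - x) ^+ 2 + a * x)); last first.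
    by field; rewrite gt_eqF.
  by have a0' := ltW a0; rewrite !mulr_ge0 ?invr_ge0 ?addr_ge0 ?sqr_ge0 ?mulr_ge0.
rewrite exD ?exZ//; [|exact: itgZ..].
by rewrite e2 lerD2l ler_wpM2l// invr_ge0 ltW.
Qed.

(** Equal means and variances cancel the leading terms. The bound is uniform in the phase t, into
    which the other summands of a sum will be put. *)
Lemma cos_step X X' (s m a : R) : 0 < a ->
  measurable_fun setT X -> itg P (fun w => X w ^+ 4) -> ex P X = 0 ->
  ex P (fun w => X w ^+ 2) = s -> ex P (fun w => X w ^+ 4) <= m ->
  measurable_fun setT X' -> itg P (fun w => X' w ^+ 4) -> ex P X' = 0 ->
  ex P (fun w => X' w ^+ 2) = s -> ex P (fun w => X' w ^+ 4) <= m ->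
  forall t, `|ex P (fun w => cos (X w + t)) - ex P (fun w => cos (X' w + t))| <=
    2 * (m + (a * s + a^-1 * m)).
Proof.
move=> a0 mX i4 e1 e2 e4 mX' i4' e1' e2' e4' t.
have [c1 s1] := cos_moments a0 mX i4 e1 e2 e4.
have [c2 s2] := cos_moments a0 mX' i4' e1' e2' e4'.
rewrite !ex_cosD//.
set u := ex P _ in c1 *; set v := ex P _ in s1 *.
set u' := ex P _ in c2 *; set v' := ex P _ in s2 *.
have -> : cos t * u - sin t * v - (cos t * u' - sin t * v') =
  cos t * ((u - (1 - s / 2)) - (u' - (1 - s / 2))) - sin t * (v - v') by ring.
apply: (le_trans (ler_normB _ _)); rewrite !normrM mulrDr; apply: lerD.
  rewrite -[leRHS]mul1r mulr_natl; apply: ler_pM => //; first exact: norm_cos_le1.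
  by rewrite mulr2n (le_trans (ler_normB _ _))// lerD.
rewrite -[leRHS]mul1r; apply: ler_pM => //; first exact: norm_sin_le1.
by rewrite mulr_natl mulr2n (le_trans (ler_normB _ _))// lerD.
Qed.

(** The fragment of independence that the addition formulas use; it passes at once to rescaled
    variables. *)
Definition bounded_indep X Y := forall f g : R -> R, continuous f -> continuous g ->
  (forall x, `|f x| <= 1) -> (forall x, `|g x| <= 1) ->
  ex P (fun w => f (X w) * g (Y w)) = ex P (f \o X) * ex P (g \o Y).

Lemma ex_cos_indep X Y t : measurable_fun setT X -> measurable_fun setT Y ->
  bounded_indep X Y -> ex P (fun w => cos (X w + Y w + t)) =
  ex P (fun w => cos (X w)) * ex P (fun w => cos (Y w + t)) -
  ex P (fun w => sin (X w)) * ex P (fun w => sin (Y w + t)).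
Proof.
move=> mX mY XY.
have cD : continuous (fun x : R => cos (x + t)).
  move=> x; apply: continuous_comp; last exact: continuous_cos.
  by apply: cvgD; [exact: cvg_id|exact: cvg_cst].
have sD : continuous (fun x : R => sin (x + t)).
  move=> x; apply: continuous_comp; last exact: continuous_sin.
  by apply: cvgD; [exact: cvg_id|exact: cvg_cst].
have pm f g : measurable_fun setT f -> measurable_fun setT g ->
    (forall w, `|f w : R| <= 1) -> (forall w, `|g w : R| <= 1) ->
    itg P (fun w => f w * g w).
  move=> mf mg f1 g1; apply: (@itg_bounded _ _ _ _ _ 1); first exact: measurable_funM.
  by move=> w; rewrite normrM mulr_ile1.
have <- := XY _ _ (@continuous_cos R) cD (@norm_cos_le1 _) (fun x => norm_cos_le1 (x + t)).
have <- := XY _ _ (@continuous_sin R) sD (@norm_sin_le1 _) (fun x => norm_sin_le1 (x + t)).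
have mc := cos_meas 0 mX; have ms := sin_meas 0 mX.
have mc0 : measurable_fun setT (fun w => cos (X w)) by under eq_fun do rewrite -[X _]addr0.
have ms0 : measurable_fun setT (fun w => sin (X w)) by under eq_fun do rewrite -[X _]addr0.
have mct := cos_meas t mY; have mst := sin_meas t mY.
have i1 := pm _ _ mc0 mct (fun w => norm_cos_le1 _) (fun w => norm_cos_le1 _).
have i2 := pm _ _ ms0 mst (fun w => norm_sin_le1 _) (fun w => norm_sin_le1 _).
rewrite -exB//; apply: congr1; apply/funext => w.
have -> : X w + Y w + t = X w + (Y w + t) by rewrite addrA.
exact: cosD.
Qed.

(* Both sides are compared with the mixed sum in which only the first summand
   is replaced. *)
Lemma cos_indep_le X Y X' Y' (e1 e2 : R) :
  measurable_fun setT X -> measurable_fun setT Y ->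
  measurable_fun setT X' -> measurable_fun setT Y' ->
  bounded_indep X Y -> bounded_indep X' Y' ->
  (forall t, `|ex P (fun w => cos (X w + t)) - ex P (fun w => cos (X' w + t))| <= e1) ->
  (forall t, `|ex P (fun w => cos (Y w + t)) - ex P (fun w => cos (Y' w + t))| <= e2) ->
  forall t, `|ex P (fun w => cos (X w + Y w + t)) -
             ex P (fun w => cos (X' w + Y' w + t))| <= e1 + e2.
Proof.
move=> mX mY mX' mY' iXY iXY' h1 h2 t.
(* Replacing U by U' with Z kept: the hypothesis is applied at the random phase Z w + t for each w,
   then averaged over w. By [ex_cos_indep], the combinations are the factorised means of cos (U + Z
   + t) and cos (U' + Z + t). *)
have half (Z U U' : T -> R) (e : R) : measurable_fun setT Z ->
    measurable_fun setT U -> measurable_fun setT U' ->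
    (forall t, `|ex P (fun w => cos (U w + t)) - ex P (fun w => cos (U' w + t))| <= e) ->
    `|(ex P (fun w => cos (U w)) * ex P (fun w => cos (Z w + t)) -
       ex P (fun w => sin (U w)) * ex P (fun w => sin (Z w + t))) -
      (ex P (fun w => cos (U' w)) * ex P (fun w => cos (Z w + t)) -
       ex P (fun w => sin (U' w)) * ex P (fun w => sin (Z w + t)))| <= e.
  move=> mZ mU mU' hU.
  have ic := cos_itg t mZ; have is_ := sin_itg t mZ.
  have comb (p q : R) : itg P (fun w => p * cos (Z w + t) - q * sin (Z w + t)) /\
      ex P (fun w => p * cos (Z w + t) - q * sin (Z w + t)) =
      p * ex P (fun w => cos (Z w + t)) - q * ex P (fun w => sin (Z w + t)).
    by split; [by apply: itgB; exact: itgZ|rewrite exB ?exZ//; exact: itgZ].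
  have [j1 <-] := comb (ex P (fun w => cos (U w))) (ex P (fun w => sin (U w))).
  have [j2 <-] := comb (ex P (fun w => cos (U' w))) (ex P (fun w => sin (U' w))).
  rewrite -exB//; apply: (le_trans (ex_norm (itgB j1 j2))).
  rewrite -[leRHS](ex_cst P); apply: ex_le; [|exact: itg_cst|].
    by apply: itg_norm; exact: itgB.
  move=> w; have := hU (Z w + t); rewrite !ex_cosD//.
  by congr (`|_| <= _); ring.
have := half Y X X' e1 mY mX mX' h1.
have := half X' Y Y' e2 mX' mY mY' h2.
rewrite !ex_cos_indep//.
rewrite !ex_cosD// !ex_sinD//.
set cx := ex P (fun w => cos (X w)); set sx := ex P (fun w => sin (X w)).
set cy := ex P (fun w => cos (Y w)); set sy := ex P (fun w => sin (Y w)).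
set cx' := ex P (fun w => cos (X' w)); set sx' := ex P (fun w => sin (X' w)).
set cy' := ex P (fun w => cos (Y' w)); set sy' := ex P (fun w => sin (Y' w)).
move=> a2 a1; apply: le_trans (lerD a1 a2); apply: le_trans (ler_normD _ _).
by rewrite le_eqVlt; apply/orP; left; apply/eqP; congr `|_|; ring.
Qed.

End cosine_means.

Section cosine_of_sums.
Variables (d : measure_display) (T : measurableType d) (R : realType).
Variable P : probability T R.

Lemma fam_bounded_indep (I : finType) (G : I -> T -> R) (J J' : {set I}) X Y :
  (forall i, measurable_fun setT (G i)) ->
  independent_systems P (fun i => sigma_rv (G i)) -> [disjoint J & J']%B ->
  fam_meas G J X -> fam_meas G J' Y -> bounded_indep P X Y.
Proof.
move=> mG indG JJ' mX mY f g cf cg f1 g1.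
have mf : measurable_fun setT f by exact: continuous_measurable_fun.
have mg : measurable_fun setT g by exact: continuous_measurable_fun.
have mfX : fam_meas G J (f \o X) by exact: (measurableT_comp mf mX).
have mgY : fam_meas G J' (g \o Y) by exact: (measurableT_comp mg mY).
have if_ : itg P (f \o X).
  by apply: (@itg_bounded _ _ _ _ _ 1) => [|w]; [exact: fam_measW mfX|exact: f1].
have ig : itg P (g \o Y).
  by apply: (@itg_bounded _ _ _ _ _ 1) => [|w]; [exact: fam_measW mgY|exact: g1].
by have [_] := fam_exM mG indG JJ' mfX mgY if_ ig.
Qed.

(** Each mean factors within its own family, so the two families may be built from the same Wiener
    process and depend on each other. *)
Lemma cos_sum_le (n : nat) (X X' : nat -> T -> R) (e : R) :
  (forall j, (j < n)%N -> measurable_fun setT (X j)) ->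
  (forall j, (j < n)%N -> measurable_fun setT (X' j)) ->
  (forall q, (q < n)%N -> bounded_indep P (fun w => \sum_(j < q) X j w) (X q)) ->
  (forall q, (q < n)%N -> bounded_indep P (fun w => \sum_(j < q) X' j w) (X' q)) ->
  (forall j, (j < n)%N -> forall t,
    `|ex P (fun w => cos (X j w + t)) - ex P (fun w => cos (X' j w + t))| <= e) ->
  forall t, `|ex P (fun w => cos (\sum_(j < n) X j w + t)) -
              ex P (fun w => cos (\sum_(j < n) X' j w + t))| <= n%:R * e.
Proof.
move=> mX mX' iX iX' h.
suff H q : (q <= n)%N -> [/\ measurable_fun setT (fun w => \sum_(j < q) X j w),
    measurable_fun setT (fun w => \sum_(j < q) X' j w) &
    forall t, `|ex P (fun w => cos (\sum_(j < q) X j w + t)) -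
              ex P (fun w => cos (\sum_(j < q) X' j w + t))| <= q%:R * e].
  by have [] := H n (leqnn n).
elim: q => [_|q IH qn].
  have e0 (Z : nat -> T -> R) : (fun w => \sum_(j < 0) Z j w) = fun=> 0.
    by apply/funext => w; rewrite big_ord0.
  split; [by rewrite e0; exact: measurable_cst..|move=> t].
  under eq_fun do rewrite big_ord0.
  under [X in _ - ex P X]eq_fun do rewrite big_ord0.
  by rewrite subrr normr0 mul0r.
have [m1 m2 IHe] := IH (ltnW qn).
have eS (Z : nat -> T -> R) : (fun w => \sum_(j < q.+1) Z j w) =
    fun w => \sum_(j < q) Z j w + Z q w by apply/funext => w; rewrite big_ord_recr.
split; [by rewrite eS; apply: measurable_funD; auto..|move=> t].
under eq_fun do rewrite big_ord_recr/=.
under [X in _ - ex P X]eq_fun do rewrite big_ord_recr/=.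
rewrite -natr1 mulrDl mul1r; apply: cos_indep_le => //.
- exact: mX.
- exact: mX'.
- exact: iX.
- exact: iX'.
- exact: h.
Qed.

End cosine_of_sums.

(** * Moments of quadratic forms in standard normal variables *)

Section all_moments.
Variables (d : measure_display) (T : measurableType d) (R : realType).
Variable P : probability T R.
Implicit Types X Y : T -> R.

(** A class closed under sums and products, which settles the integrability of every polynomial in
    the increments. *)
Definition allm X := measurable_fun setT X /\ forall q, itg P (fun w => X w ^+ q).

Lemma allm_sqi X q : allm X -> sqi P (fun w => X w ^+ q).
Proof.
move=> [mX iX]; split; first exact: measurable_funX.
by under eq_fun do rewrite -exprM.
Qed.

Lemma allm_itg X : allm X -> itg P X.
Proof. by move=> [_ /(_ 1%N)]; under eq_fun do rewrite expr1. Qed.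

Lemma allmM X Y : allm X -> allm Y -> allm (fun w => X w * Y w).
Proof.
move=> aX aY; split; first by have [mX _] := aX; have [mY _] := aY; exact: measurable_funM.
move=> q; under eq_fun do rewrite exprMn.
by apply: sqi_itgM; exact: allm_sqi.
Qed.

Lemma allm_cst (c : R) : allm (fun=> c).
Proof. by split => [|q]; [exact: measurable_cst|exact: itg_cst]. Qed.

Lemma allmD X Y : allm X -> allm Y -> allm (fun w => X w + Y w).
Proof.
move=> aX aY; split; first by have [mX _] := aX; have [mY _] := aY; exact: measurable_funD.
move=> q; under eq_fun do rewrite exprDn.
apply: itg_sum => i _; under eq_fun do rewrite -mulr_natl; apply: itgZ.
by apply: sqi_itgM; exact: allm_sqi.
Qed.

Lemma allm_sum (I : finType) (F : I -> T -> R) :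
  (forall i, allm (F i)) -> allm (fun w => \sum_i F i w).
Proof.
move=> aF.
suff H (s : seq I) : allm (fun w => \sum_(i <- s) F i w) by exact: H.
elim: s => [|i s IH].
  by under eq_fun do rewrite big_nil; exact: allm_cst.
by under eq_fun do rewrite big_cons; exact: allmD.
Qed.

End all_moments.

Section quadratic_forms.
Variables (d : measure_display) (T : measurableType d) (R : realType).
Variable P : probability T R.
Variables (I : finType) (G : I -> T -> R).
Hypothesis mG : forall i, measurable_fun setT (G i).
Hypothesis indG : independent_systems P (fun i => sigma_rv (G i)).
Variables (r : nat) (kap : 'I_r -> I) (Z : 'I_r -> T -> R).
Hypothesis kap_inj : injective kap.
Hypothesis mZ : forall a, fam_meas G [set kap a]%SET (Z a).
Hypothesis aZ : forall a, allm P (Z a).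
Hypothesis Z1 : forall a, ex P (Z a) = 0.
Hypothesis Z2 : forall a, ex P (fun w => Z a w ^+ 2) = 1.
Hypothesis Z4 : forall a, ex P (fun w => Z a w ^+ 4) = 3.
Hypothesis Z8 : forall a, ex P (fun w => Z a w ^+ 8) = 105.

Let mZC a b : b != a -> fam_meas G [set~ kap a]%SET (Z b).
Proof.
move=> ba; apply: fam_meas_sub (@mZ b); apply/fintype.subsetP => i; rewrite !inE => /eqP ->.
by rewrite (inj_eq kap_inj).
Qed.

Let disjC a : [disjoint [set kap a]%SET & [set~ kap a]%SET]%B.
Proof. by rewrite -finset.setI_eq0 finset.setICr. Qed.

Let E2 a b := ex P (fun w => Z a w * Z b w).
Let E4 a b c e := ex P (fun w => Z a w * Z b w * Z c w * Z e w).

Let E2E a b : E2 a b = (a == b)%:R.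
Proof.
have [<-|ab] := eqVneq a b; first by rewrite -[RHS](Z2 a) /E2; apply: congr1; apply/funext => w; rewrite expr2.
have ba : b != a by rewrite eq_sym.
rewrite /E2; have [_ ->] := fam_exM mG indG (disjC a) (@mZ a) (mZC ba) (allm_itg (aZ a)) (allm_itg (aZ b)).
by rewrite Z1 mul0r.
Qed.

Let E4_isolated a b c e : b != a -> c != a -> e != a -> E4 a b c e = 0.
Proof.
move=> ba ca ea.
have mP : fam_meas G [set~ kap a]%SET (fun w => Z b w * Z c w * Z e w).
  by apply: measurable_funM; [apply: measurable_funM|]; exact: mZC.
have iP : itg P (fun w => Z b w * Z c w * Z e w).
  by apply: allm_itg; apply: allmM => //; exact: allmM.
have [_ e1] := fam_exM mG indG (disjC a) (@mZ a) mP (allm_itg (aZ a)) iP.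
rewrite /E4; transitivity (ex P (fun w => Z a w * (Z b w * Z c w * Z e w))).
  by apply: congr1; apply/funext => w; ring.
by rewrite e1 Z1 mul0r.
Qed.

Let E4R a b c e : E4 a b c e = E4 b c e a.
Proof. by rewrite /E4; apply: congr1; apply/funext => w; ring. Qed.

Let E4_two a c e : E4 a a c e = (c == e)%:R + 2 * ((a == c) && (a == e))%:R.
Proof.
have [<-|ce] := eqVneq c e.
  rewrite andbb; have [<-|ac] := eqVneq a c.
    transitivity (3 : R); last by rewrite /=; ring.
    by rewrite -[RHS](Z4 a) /E4; apply: congr1; apply/funext => w; ring.
  have ca : c != a by rewrite eq_sym.
  have m1 : fam_meas G [set kap a]%SET (fun w => Z a w ^+ 2).
    by apply: measurable_funX; exact: mZ.
  have m2 : fam_meas G [set~ kap a]%SET (fun w => Z c w ^+ 2).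
    by apply: measurable_funX; exact: mZC.
  have [_ i1] := aZ a; have [_ i2] := aZ c.
  have [_ e1] := fam_exM mG indG (disjC a) m1 m2 (i1 2%N) (i2 2%N).
  rewrite mulr0 addr0 -[RHS]mul1r -{1}(Z2 a) -(Z2 c) -e1 /E4.
  by apply: congr1; apply/funext => w; ring.
have ec : e != c by rewrite eq_sym.
rewrite add0r; have [ac|ac] := eqVneq a c; last first.
  by rewrite mulr0 E4R E4R E4_isolated.
subst c; rewrite (negbTE ce) mulr0 E4R E4R E4R E4_isolated//.
Qed.

(** If a differs from the three other indices, its factor splits off with mean 0. Otherwise a equals
    one of them, and a permutation reduces to [E4_two]. *)
Lemma isserlis a b c e : ex P (fun w => Z a w * Z b w * Z c w * Z e w) =
  ((a == b) && (c == e))%:R + ((a == c) && (b == e))%:R + ((a == e) && (b == c))%:R.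
Proof.
rewrite -/(E4 a b c e); have [->|ab] := eqVneq a b.
  by rewrite E4_two /= [in RHS](andbC (b == e)); ring.
have [<-|ac] := eqVneq a c.
  have -> : E4 a b a e = E4 a a b e by rewrite /E4; apply: congr1; apply/funext => w; ring.
  by rewrite E4_two (negbTE ab) [b == a]eq_sym (negbTE ab) andbF/= mulr0 add0r !addr0.
have [<-|ae] := eqVneq a e.
  have -> : E4 a b c a = E4 a a b c by rewrite /E4; apply: congr1; apply/funext => w; ring.
  by rewrite E4_two (negbTE ab)/= mulr0 !add0r addr0.
by rewrite E4_isolated 1?eq_sym// !addr0.
Qed.

Variable q : 'M[R]_r.
Hypothesis qT : q^T = q.

(** The centred quadratic form z^T q z - tr q. *)
Definition quad w := \sum_(x : 'I_r * 'I_r)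
  q x.1 x.2 * (Z x.1 w * Z x.2 w - (x.1 == x.2)%:R).

Let eab (x : 'I_r * 'I_r) w := Z x.1 w * Z x.2 w - (x.1 == x.2)%:R.

Let eab_allm x : allm P (eab x).
Proof. by apply: allmD; [exact: allmM|exact: allm_cst]. Qed.

Lemma quad_allm : allm P quad.
Proof. by apply: allm_sum => x; apply: allmM; [exact: allm_cst|exact: eab_allm]. Qed.

Lemma quad_ex1 : ex P quad = 0.
Proof.
have i x : itg P (eab x) by apply: allm_itg; exact: eab_allm.
rewrite ex_sum; last by move=> x _; apply: itgZ; exact: i.
apply: big1 => x _; rewrite exZ; last exact: i.
rewrite exB; [|by apply: allm_itg; exact: allmM|exact: itg_cst].
by rewrite ex_cst -/(E2 _ _) E2E subrr mulr0.
Qed.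

Let eab_cov x y : ex P (fun w => eab x w * eab y w) =
  ((x.1 == y.1) && (x.2 == y.2))%:R + ((x.1 == y.2) && (x.2 == y.1))%:R.
Proof.
pose ZZ (x : 'I_r * 'I_r) w := Z x.1 w * Z x.2 w.
have aZZ z : allm P (ZZ z) by exact: allmM.
have iZZ z : itg P (ZZ z) by exact: allm_itg.
have iZ4 : itg P (fun w => ZZ x w * ZZ y w) by apply: allm_itg; exact: allmM.
have -> : (fun w => eab x w * eab y w) = fun w => ZZ x w * ZZ y w -
    ((x.1 == x.2)%:R * ZZ y w + (y.1 == y.2)%:R * ZZ x w) + (x.1 == x.2)%:R * (y.1 == y.2)%:R.
  by apply/funext => w; rewrite /eab /ZZ; ring.
have il : itg P (fun w => (x.1 == x.2)%:R * ZZ y w + (y.1 == y.2)%:R * ZZ x w).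
  by apply: itgD; exact: itgZ.
rewrite exD; [|by exact: itgB|exact: itg_cst].
rewrite exB// exD; [|exact: itgZ..].
rewrite ex_cst !exZ// -/(E2 _ _) -/(E2 _ _) !E2E.
have -> : ex P (fun w => ZZ x w * ZZ y w) =
    ((x.1 == x.2) && (y.1 == y.2))%:R + ((x.1 == y.1) && (x.2 == y.2))%:R +
    ((x.1 == y.2) && (x.2 == y.1))%:R.
  by rewrite -isserlis; apply: congr1; apply/funext => w; rewrite /ZZ; ring.
by case: (x.1 == x.2) (y.1 == y.2) => [] []; rewrite /=; ring.
Qed.

(** The two surviving pairings contribute q_ab q_ab and q_ab q_ba, which coincide by symmetry of q;
    hence the factor 2. *)
Lemma quad_ex2 : ex P (fun w => quad w ^+ 2) = 2 * \sum_(x : 'I_r * 'I_r) q x.1 x.2 ^+ 2.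
Proof.
have -> : (fun w => quad w ^+ 2) = fun w => \sum_x \sum_y
    (q x.1 x.2 * q y.1 y.2) * (eab x w * eab y w).
  apply/funext => w; rewrite expr2 /quad big_distrlr/=; apply: eq_bigr => x _.
  by apply: eq_bigr => y _; rewrite /eab; ring.
have i x y : itg P (fun w => (q x.1 x.2 * q y.1 y.2) * (eab x w * eab y w)).
  by apply: itgZ; apply: allm_itg; apply: allmM; exact: eab_allm.
rewrite ex_sum; last by move=> x _; apply: itg_sum => y _; exact: i.
rewrite mulr_sumr; apply: eq_bigr => x _.
rewrite ex_sum; last by move=> y _; exact: i.
transitivity (\sum_(y : 'I_r * 'I_r) (q x.1 x.2 * q y.1 y.2 * (y == x)%:R +
    q x.1 x.2 * q y.1 y.2 * (y == (x.2, x.1))%:R)).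
  apply: eq_bigr => y _; rewrite exZ; last by apply: allm_itg; apply: allmM; exact: eab_allm.
  rewrite eab_cov mulrDr; case: x => x1 x2; case: y => y1 y2; rewrite /= !xpair_eqE.
  by rewrite ![_ == x1]eq_sym ![_ == x2]eq_sym (andbC (x1 == y2)).
rewrite big_split/= (bigD1 x)//= eqxx mulr1 big1 ?addr0; last first.
  by move=> y yx; rewrite (negbTE yx) mulr0.
rewrite (bigD1 (x.2, x.1))//= eqxx mulr1 big1 ?addr0; last first.
  by move=> y yx; rewrite (negbTE yx) mulr0.
have -> : q x.2 x.1 = q x.1 x.2 by rewrite -[in LHS]qT mxE.
by ring.
Qed.

Let sq1 := \sum_(x : 'I_r * 'I_r) `|q x.1 x.2|.

(** The form is at most the sum of the absolute values of the entries of q times 1 + sum Z_a^2. Two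
    uses of Cauchy-Schwarz on r + 1 terms give the factor (r+1)^3 and eighth powers, whose means are
    105. *)
Definition quad4 := (\sum_(x : 'I_r * 'I_r) `|q x.1 x.2|) ^+ 4 *
  (r.+1%:R ^+ 3 * (1 + r%:R * 105)).

Lemma quad_ex4 : ex P (fun w => quad w ^+ 4) <= quad4.
Proof.
have [_ iq] := quad_allm.
pose g w := r.+1%:R ^+ 3 * (1 + \sum_a Z a w ^+ 8).
have iS : itg P (fun w => \sum_a Z a w ^+ 8).
  by apply: itg_sum => a _; have [_] := aZ a.
have ig : itg P g by apply: itgZ; apply: itgD => //; exact: itg_cst.
apply: (@le_trans _ _ (ex P (fun w => sq1 ^+ 4 * g w))).
  apply: ex_le => //; first exact: itgZ.
  move=> w; pose rho := 1 + \sum_a Z a w ^+ 2.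
  have s2 : 0 <= \sum_a Z a w ^+ 2 by apply: sumr_ge0 => a _; exact: sqr_ge0.
  have rho0 : 0 <= rho by rewrite addr_ge0.
  have Zle a : Z a w ^+ 2 <= \sum_a Z a w ^+ 2.
    by rewrite (bigD1 a)//= lerDl; apply: sumr_ge0 => b _; exact: sqr_ge0.
  have le1 : `|quad w| <= sq1 * rho.
    apply: (le_trans (ler_norm_sum _ _ _)); rewrite mulr_suml.
    apply: ler_sum => x _; rewrite normrM ler_wpM2l//.
    apply: (le_trans (ler_normB _ _)); rewrite addrC; apply: lerD.
      by rewrite normr_nat; case: (_ == _); rewrite ?lexx ?ler01.
    have := Zle x.1; have := Zle x.2; rewrite ler_norml.
    have := sqr_ge0 (Z x.1 w - Z x.2 w); have := sqr_ge0 (Z x.1 w + Z x.2 w).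
    by move=> *; apply/andP; split; nra.
  (* The 1 is treated as an additional summand, at index [ord0]. *)
  have quart (n : nat) (F : 'I_n -> R) :
      (1 + \sum_i F i) ^+ 2 <= n.+1%:R * (1 + \sum_i F i ^+ 2).
    have := sqr_sum_le (fun i : 'I_n.+1 => if unlift ord0 i is Some j then F j else 1).
    rewrite !big_ord_recl unlift_none expr1n.
    by under eq_bigr do rewrite liftK; under [X in _ * (_ + X)]eq_bigr do rewrite liftK.
  have -> : quad w ^+ 4 = `|quad w| ^+ 4 by rewrite -normrX ger0_norm// exprn_even_ge0.
  apply: (@le_trans _ _ ((sq1 * rho) ^+ 4)); first by rewrite lerXn2r ?nnegrE// (le_trans _ le1).
  rewrite exprMn ler_wpM2l ?exprn_ge0 ?sumr_ge0//.
  have -> : rho ^+ 4 = (rho ^+ 2) ^+ 2 by rewrite -exprM.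
  rewrite /g (exprSr (r.+1%:R : R) 2) -mulrA.
  apply: (@le_trans _ _ ((r.+1%:R * (1 + \sum_a (Z a w ^+ 2) ^+ 2)) ^+ 2)).
    rewrite lerXn2r ?nnegrE ?sqr_ge0 ?mulr_ge0 ?addr_ge0 ?sumr_ge0 ?ler0n ?quart//.
    by move=> a _; exact: sqr_ge0.
  rewrite exprMn ler_wpM2l ?sqr_ge0//; apply: (le_trans (quart _ _)).
  rewrite ler_wpM2l ?ler0n// lerD2l; apply: ler_sum => a _.
  by rewrite -!exprM.
rewrite exZ// /quad4 ler_wpM2l ?exprn_ge0 ?sumr_ge0//.
rewrite exZ; last by apply: itgD => //; exact: itg_cst.
rewrite ler_wpM2l ?exprn_ge0// exD; [|exact: itg_cst|by []].
rewrite ex_cst lerD2l ex_sum; last by move=> a _; have [_] := aZ a.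
by under eq_bigr do rewrite Z8; rewrite sumr_const card_ord mulr_natl.
Qed.

End quadratic_forms.

Section wiener_quadratic.
Variables (d : measure_display) (T : measurableType d) (R : realType).
Variable P : probability T R.
Variables (r : nat) (W : R -> T -> 'cV[R]_r).
Hypothesis hW : wiener P W.
Variables (n : nat) (q : 'M[R]_r).
Hypothesis qT : q^T = q.

Section blocks.
Variable h : R.
Hypothesis h0 : 0 < h.

Definition nincr j (a : 'I_r) w :=
  (Num.sqrt h)^-1 * (W (j.+1%:R * h) w a 0 - W (j%:R * h) w a 0).

Definition qblock j := quad (nincr j) q.

Let t (l : nat) : R := l%:R * h.
Let G := @fincr _ _ _ _ W n t.
Let t0 l : 0 <= t l. Proof. by rewrite mulr_ge0// ltW. Qed.
Let tm : {homo t : i j / (i <= j)%N >-> i <= j}.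
Proof. by move=> i j ij; rewrite ler_wpM2r ?(ltW h0)// ler_nat. Qed.
Let mG i : measurable_fun setT (G i). Proof. exact: (fincr_meas hW). Qed.
Let indG : independent_systems P (fun i => sigma_rv (G i)).
Proof. by apply: (incr_indep hW) => //; exact: tm. Qed.

Let nincr_allm j a : allm P (nincr j a).
Proof.
have tj : t j < t j.+1 by rewrite ltr_pM2r// ltr_nat.
split.
  apply: measurable_funM; first exact: measurable_cst.
  exact: (wiener_incr_meas hW a (t0 j) (t0 j.+1)).
move=> m; under eq_fun do rewrite exprMn; apply: itgZ.
exact: (wiener_incr_pow hW a m (t0 j) tj).
Qed.

Let sh0 : 0 < Num.sqrt h. Proof. by rewrite sqrtr_gt0. Qed.

Let nincr_moment j a (m : nat) (c : R) :
  (forall X : T -> R, measurable_fun setT X ->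
     (forall A, measurable A -> P [set w | A (X w)] = normal_prob 0 (Num.sqrt h) A) ->
     ex P (fun w => X w ^+ m) = c * Num.sqrt h ^+ m) ->
  ex P (fun w => nincr j a w ^+ m) = c.
Proof.
have tj : t j < t j.+1 by rewrite ltr_pM2r// ltr_nat.
move=> H.
have -> : (fun w => nincr j a w ^+ m) = fun w => (Num.sqrt h)^-1 ^+ m *
    (W (t j.+1) w a 0 - W (t j) w a 0) ^+ m.
  by apply/funext => w; rewrite exprMn.
rewrite exZ; last exact: (wiener_incr_pow hW a m (t0 j) tj).
rewrite (H (fun w => W (t j.+1) w a 0 - W (t j) w a 0)); last first.
  move=> A mA; rewrite (wiener_law hW a (t0 j) tj mA).
  by rewrite (_ : t j.+1 - t j = h)// /t -natr1; ring.
  exact: (wiener_incr_meas hW a (t0 j) (t0 j.+1)).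
by rewrite mulrCA -exprMn mulVf ?gt_eqF// expr1n mulr1.
Qed.

Let m1 j a : ex P (nincr j a) = 0.
Proof.
have -> : nincr j a = fun w => nincr j a w ^+ 1 by apply/funext => w; rewrite expr1.
apply: nincr_moment => X mX lX; rewrite mul0r.
by rewrite -[RHS](gauss_ex1 sh0 mX lX); apply: congr1; apply/funext => w; rewrite expr1.
Qed.

Let m2 j a : ex P (fun w => nincr j a w ^+ 2) = 1.
Proof. by apply: nincr_moment => X mX lX; rewrite mul1r; exact: (gauss_ex2 sh0 mX lX). Qed.

Let m4 j a : ex P (fun w => nincr j a w ^+ 4) = 3.
Proof. by apply: nincr_moment => X mX lX; exact: (gauss_ex4 sh0 mX lX). Qed.

Let m8 j a : ex P (fun w => nincr j a w ^+ 8) = 105.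
Proof. by apply: nincr_moment => X mX lX; exact: (gauss_ex8 sh0 mX lX). Qed.

Let nincr_fam (j : 'I_n) (J : {set 'I_n * 'I_r}) a : (j, a) \in J ->
  fam_meas G J (nincr j a).
Proof.
move=> jJ; apply: measurable_funM; first exact: measurable_cst.
exact: (@fam_meas_coord _ _ _ _ G J (j, a)).
Qed.

Let qblock_fam (j : 'I_n) (J : {set 'I_n * 'I_r}) : (forall a, (j, a) \in J) ->
  fam_meas G J (qblock j).
Proof.
move=> jJ.
have hx (x : 'I_r * 'I_r) : fam_meas G J (fun w => q x.1 x.2 *
    (nincr j x.1 w * nincr j x.2 w - (x.1 == x.2)%:R)).
  apply: measurable_funM; first exact: measurable_cst.
  apply: measurable_funB; last exact: measurable_cst.
  by apply: measurable_funM; exact: nincr_fam.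
exact: (measurable_sum _ hx).
Qed.

Let kap (j : 'I_n) (a : 'I_r) := (j, a).
Let kap_inj j : injective (kap j). Proof. by move=> a b []. Qed.
Let kap_fam j a : fam_meas G [set kap j a]%SET (nincr j a).
Proof. by apply: nincr_fam; rewrite inE. Qed.

Lemma qblock_allm j : allm P (qblock j).
Proof. by apply: quad_allm => a; exact: nincr_allm. Qed.

Lemma qblock_ex1 (j : 'I_n) : ex P (qblock j) = 0.
Proof.
exact: (quad_ex1 mG indG (@kap_inj j) (@kap_fam j) (fun a => nincr_allm j a)
  (m1 j) (m2 j) q).
Qed.

Lemma qblock_ex2 (j : 'I_n) :
  ex P (fun w => qblock j w ^+ 2) = 2 * \sum_(x : 'I_r * 'I_r) q x.1 x.2 ^+ 2.
Proof.
exact: (quad_ex2 mG indG (@kap_inj j) (@kap_fam j) (fun a => nincr_allm j a)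
  (m1 j) (m2 j) (m4 j) qT).
Qed.

Lemma qblock_ex4 j : ex P (fun w => qblock j w ^+ 4) <= quad4 q.
Proof. exact: (quad_ex4 (fun a => nincr_allm j a) (m8 j) q). Qed.

Let J p : {set 'I_n * 'I_r} := [set x : 'I_n * 'I_r | (x.1 < p)%N]%SET.
Let J' p : {set 'I_n * 'I_r} := [set x : 'I_n * 'I_r | (p <= x.1)%N]%SET.

Let disjJ p : [disjoint J p & J' p]%B.
Proof.
by rewrite disjoint_subset; apply/fintype.subsetP => x; rewrite !inE -ltnNge.
Qed.

(** Blocks over distinct steps are centred and independent: [orthogonal_sum] with all coefficients
    equal to 1. *)
Lemma qblock_sum_ex2 :
  ex P (fun w => (\sum_(j < n) qblock j w) ^+ 2) =
  n%:R * (2 * \sum_(x : 'I_r * 'I_r) q x.1 x.2 ^+ 2).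
Proof.
have := @orthogonal_sum _ _ _ P _ G mG indG (fun _ _ => 1) qblock J J' 1
  (2 * \sum_(x : 'I_r * 'I_r) q x.1 x.2 ^+ 2) n.
move=> H; have [] // := H _ _ _ _ _ _ _ _ _ n (leqnn n).
- move=> j; apply/fintype.subsetP => x; rewrite !inE => /leq_trans; apply.
  exact: leqnSn.
- by move=> j _; exact: measurable_cst.
- by move=> j jn; apply: (@qblock_fam (Ordinal jn)) => a; rewrite inE.
- by move=> j jn; apply: (@qblock_fam (Ordinal jn)) => a; rewrite inE.
- by move=> j w; rewrite normr1.
- by move=> j jn; have := allm_sqi 1 (qblock_allm j); under eq_fun do rewrite expr1.
- by move=> j jn; exact: (qblock_ex1 (Ordinal jn)).
- by move=> j jn; exact: (qblock_ex2 (Ordinal jn)).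
move=> _ _; under eq_fun do under eq_bigr do rewrite mul1r.
move=> ->; under eq_bigr do under eq_fun do rewrite expr1n.
under eq_bigr do rewrite ex_cst mul1r.
by rewrite sumr_const card_ord -[_ *+ n]mulr_natl.
Qed.

Lemma qblock_sum_indep p : (p < n)%N ->
  bounded_indep P (fun w => \sum_(j < p) qblock j w) (qblock p).
Proof.
move=> pn; apply: (fam_bounded_indep mG indG (disjJ p)).
  have hj (j : 'I_p) : fam_meas G (J p) (qblock j).
    have jn := ltn_trans (ltn_ord j) pn.
    by apply: (@qblock_fam (Ordinal jn)) => a; rewrite inE/=.
  exact: (measurable_sum _ hj).
by apply: (@qblock_fam (Ordinal pn)) => a; rewrite inE/=.
Qed.

End blocks.

Section path_increments.
Variables (v : R) (a : 'I_r).
Hypothesis v0 : 0 <= v.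
Let t (l : nat) : R := l%:R * v.
Let G := @fincr _ _ _ _ W n t.
Let t0 l : 0 <= t l. Proof. by rewrite mulr_ge0. Qed.
Let tm : {homo t : i j / (i <= j)%N >-> i <= j}.
Proof. by move=> i j ij; rewrite ler_wpM2r// ler_nat. Qed.
Let mG i : measurable_fun setT (G i). Proof. exact: (fincr_meas hW). Qed.
Let indG : independent_systems P (fun i => sigma_rv (G i)).
Proof. by apply: (incr_indep hW) => //; exact: tm. Qed.

Let J p : {set 'I_n * 'I_r} := [set x : 'I_n * 'I_r | (x.1 < p)%N]%SET.
Let J' p : {set 'I_n * 'I_r} := [set x : 'I_n * 'I_r | (p <= x.1)%N]%SET.

Let disjJ p : [disjoint J p & J' p]%B.
Proof.
by rewrite disjoint_subset; apply/fintype.subsetP => x; rewrite !inE -ltnNge.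
Qed.

Definition gincr j w := W (j.+1%:R * v) w a 0 - W (j%:R * v) w a 0.

Lemma gincr_sum_indep p : (p < n)%N ->
  bounded_indep P (fun w => \sum_(j < p) gincr j w) (gincr p).
Proof.
move=> pn; apply: (fam_bounded_indep mG indG (disjJ p)).
  have hj (j : 'I_p) : fam_meas G (J p) (gincr j).
    have jn := ltn_trans (ltn_ord j) pn.
    by apply: (@fam_meas_coord _ _ _ _ G (J p) (Ordinal jn, a)); rewrite inE/=.
  exact: (measurable_sum _ hj).
by apply: (@fam_meas_coord _ _ _ _ G (J' p) (Ordinal pn, a)); rewrite inE/=.
Qed.

Lemma gincr_sum w : \sum_(j < n) gincr j w = W (n%:R * v) w a 0 - W 0 w a 0.
Proof.
by rewrite -(big_mkord xpredT (fun j => gincr j w)) telescope_sumr// mul0r.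
Qed.

(** The step v may be 0, when the limit variance degenerates; the increments are then identically 0
    and have the same moment formulas. *)
Lemma gincr_moments j : [/\ measurable_fun setT (gincr j),
  itg P (fun w => gincr j w ^+ 4), ex P (gincr j) = 0,
  ex P (fun w => gincr j w ^+ 2) = v & ex P (fun w => gincr j w ^+ 4) = 3 * v ^+ 2].
Proof.
have tj : t j <= t j.+1 by exact: tm.
have tE : t j.+1 - t j = v by rewrite /t -natr1; ring.
have mg : measurable_fun setT (gincr j).
  exact: (wiener_incr_meas hW a (t0 j) (t0 j.+1)).
have e2 : ex P (fun w => gincr j w ^+ 2) = v by rewrite (wiener_incr_ex2 hW a (t0 j) tj).
move: v0; rewrite le_eqVlt => /predU1P[v00|vp].
  have g0 w : gincr j w = 0 by rewrite /gincr -v00 !mulr0 subrr.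
  have -> : gincr j = fun=> 0 by apply/funext.
  have e k : (fun w : T => (0 : R) ^+ k.+1) = fun=> 0.
    by apply/funext => w; rewrite expr0n.
  rewrite !e !ex_cst -v00 expr0n mulr0.
  by split => //; exact: itg_cst.
have tj' : t j < t j.+1 by rewrite -subr_gt0 tE.
have lg A : measurable A -> P [set w | A (gincr j w)] = normal_prob 0 (Num.sqrt v) A.
  by move=> mA; rewrite -tE (wiener_law hW a (t0 j) tj' mA).
have sv : 0 < Num.sqrt v by rewrite sqrtr_gt0.
split => //; [exact: (wiener_incr_pow hW a 4 (t0 j) tj')|exact: (wiener_incr_ex1 hW a (t0 j) tj')|].
rewrite (gauss_ex4 sv mg lg) (exprM _ 2 2) sqr_sqrtr//.
Qed.

End path_increments.

Definition qvar := 2 * \sum_(x : 'I_r * 'I_r) q x.1 x.2 ^+ 2.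

Lemma qvar_ge0 : 0 <= qvar.
Proof. by rewrite mulr_ge0// sumr_ge0// => x _; exact: sqr_ge0. Qed.

Lemma quad4_ge0 : 0 <= quad4 q.
Proof. by rewrite mulr_ge0 ?exprn_ge0 ?sumr_ge0// ?addr_ge0 ?mulr_ge0. Qed.

(* The normalised sum is compared with the path of one coordinate of the Wiener
   process at time [qvar], cut into n increments. *)
Lemma qblock_clt (h : R) (a : 'I_r) : 0 < h -> (0 < n)%N -> forall t : R,
  `|ex P (fun w => cos ((Num.sqrt n%:R)^-1 * (\sum_(j < n) qblock h j w) + t)) -
    ex P (fun w => cos (W qvar w a 0 - W 0 w a 0 + t))| <=
  2 * (2 * (quad4 q + 3 * qvar ^+ 2) + qvar) / Num.sqrt n%:R.
Proof.
move=> h0 n0 t.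
set s := Num.sqrt n%:R.
have nR : 0 < (n%:R : R) by rewrite ltr0n.
have s0 : 0 < s by rewrite sqrtr_gt0.
have sn : s ^+ 2 = n%:R by rewrite sqr_sqrtr// ltW.
have s1 : 1 <= s.
  by rewrite -sqrtr1 ler_wsqrtr// ler1n.
pose v := qvar / n%:R.
have v0 : 0 <= v by rewrite divr_ge0 ?qvar_ge0.
set K := quad4 q + 3 * qvar ^+ 2.
have K0 : 0 <= K by rewrite addr_ge0 ?quad4_ge0// mulr_ge0// sqr_ge0.
pose m := K / n%:R ^+ 2.
(* The bound of [cos_step] with a = 1 / sqrt n: the variance is of order 1/n and the fourth moment
   of order 1/n^2, so both parts of the sine term are of order n^(-3/2). *)
pose e := 2 * (m + (s^-1 * v + s * m)).
pose X j w := s^-1 * qblock h j w.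
pose X' := gincr v a.
have q1 j : allm P (qblock h j) by exact: qblock_allm.
have mX j : measurable_fun setT (X j).
  by have [mq _] := q1 j; apply: measurable_funM => //; exact: measurable_cst.
have step (j : nat) : (j < n)%N -> forall t,
    `|ex P (fun w => cos (X j w + t)) - ex P (fun w => cos (X' j w + t))| <= e.
  move=> jn; have [mX' i4' e1' e2' e4'] := gincr_moments a v0 j.
  have [mq iq] := q1 j.
  rewrite /e -{2}[s]invrK; apply: (@cos_step _ _ _ P (X j) (X' j) v m s^-1) => //.
  - by rewrite invr_gt0.
  - by under eq_fun do rewrite exprMn; exact: itgZ.
  - rewrite exZ; last exact: allm_itg.
    by rewrite (qblock_ex1 h0 (Ordinal jn)) mulr0.
  - under eq_fun do rewrite exprMn; rewrite exZ// (qblock_ex2 h0 (Ordinal jn)).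
    by rewrite exprVn sn mulrC.
  - under eq_fun do rewrite exprMn; rewrite exZ// exprVn (exprM s 2 2) sn.
    rewrite mulrC /m ler_wpM2r ?invr_ge0 ?exprn_ge0//.
    by rewrite (le_trans (qblock_ex4 h0 j))// lerDl mulr_ge0// sqr_ge0.
  - rewrite e4' /v expr_div_n mulrA /m ler_wpM2r ?invr_ge0 ?exprn_ge0//.
    by rewrite lerDr quad4_ge0.
have := @cos_sum_le _ _ _ P n X X' e (fun j _ => mX j) _ _ _ step t.
have -> : (fun w => cos (\sum_(j < n) X j w + t)) =
    fun w => cos (s^-1 * (\sum_(j < n) qblock h j w) + t).
  by apply/funext => w; rewrite mulr_sumr.
have -> : (fun w => cos (\sum_(j < n) X' j w + t)) =
    fun w => cos (W qvar w a 0 - W 0 w a 0 + t).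
  apply/funext => w; rewrite gincr_sum /v mulrC divfK// gt_eqF//.
move=> H; apply: (le_trans (H _ _ _)).
- by move=> j _; have [] := gincr_moments a v0 j.
- move=> p pn f g cf cg f1 g1.
  have csc : continuous (fun x : R => s^-1 * x).
    by move=> x; apply: cvgMr; exact: cvg_id.
  have cf' : continuous (fun x : R => f (s^-1 * x)).
    by move=> x; apply: continuous_comp; [exact: csc|exact: cf].
  have cg' : continuous (fun x : R => g (s^-1 * x)).
    by move=> x; apply: continuous_comp; [exact: csc|exact: cg].
  have := qblock_sum_indep h0 pn cf' cg' (fun x => f1 _) (fun x => g1 _).
  have -> : (f \o fun w => \sum_(j < p) X j w) =
      (fun x => f (s^-1 * x)) \o (fun w => \sum_(j < p) qblock h j w).
    by apply/funext => w /=; rewrite mulr_sumr.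
  move=> <-; apply: congr1; apply/funext => w.
  by rewrite mulr_sumr.
- by move=> p pn; exact: gincr_sum_indep.
(* Only the term K / n is weakened, to K / sqrt n. *)
rewrite /e /m /v -!sn -subr_ge0.
rewrite (_ : _ - _ = 2 * K * (s - 1) / s ^+ 2); last by field; rewrite gt_eqF.
by rewrite divr_ge0 ?sqr_ge0// mulr_ge0 ?subr_ge0// mulr_ge0.
Qed.

End wiener_quadratic.

(** * Cosine means determine convergence in distribution *)

Section bernoulli_weights.
Variables (R : realType) (N k : nat) (y : 'I_k -> R).
Local Notation I := ('I_N * 'I_k)%type.
Implicit Types (o : {ffun I -> bool}) (b : bool).

Definition bern (x : R) b : R := if b then x else 1 - x.
(** Probability of the outcome o of N independent trials for each coordinate i, with success
    probability [y i]. Summing over outcomes instead of counts gives Bernstein polynomials without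
    binomial coefficients. *)
Definition weight o : R := \prod_(z : I) bern (y z.2) (o z).
Definition freq o (i : 'I_k) : R := N%:R^-1 * \sum_(l < N) (o (l, i))%:R.

(** Independence of the trials: the mean of a product of functions of single trials is the product
    of the means. *)
Lemma weight_expand (phi : I -> bool -> R) :
  \sum_o weight o * \prod_z phi z (o z) =
  \prod_z (bern (y z.2) true * phi z true + bern (y z.2) false * phi z false).
Proof.
transitivity (\prod_z \sum_b bern (y z.2) b * phi z b); last first.
  by apply: eq_bigr => z _; rewrite big_bool.
rewrite bigA_distr_bigA/=; apply: eq_bigr => o _.
by rewrite /weight -big_split.
Qed.

Lemma weight_sum : \sum_o weight o = 1.
Proof.
transitivity (\prod_(z : I) (bern (y z.2) true * 1 + bern (y z.2) false * 1)).
  rewrite -(weight_expand (fun _ _ => 1)); apply: eq_bigr => o _.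
  by rewrite big1 ?mulr1.
by rewrite big1// => z _; rewrite /= !mulr1 subrKC.
Qed.

Lemma weight_variance i :
  \sum_o weight o * (\sum_(l < N) ((o (l, i))%:R - y i)) ^+ 2 =
  N%:R * (y i * (1 - y i)).
Proof.
pose D (l : 'I_N) b : R := b%:R - y i.
transitivity (\sum_(l < N) \sum_(m < N) \sum_o weight o *
    (D l (o (l, i)) * D m (o (m, i)))).
  under [in RHS]eq_bigr do rewrite exchange_big/=.
  rewrite [RHS]exchange_big/=; apply: eq_bigr => o _.
  rewrite expr2 big_distrlr/= mulr_sumr; apply: eq_bigr => l _.
  by rewrite mulr_sumr.
have key l m : \sum_o weight o * (D l (o (l, i)) * D m (o (m, i))) =
    if m == l then y i * (1 - y i) else 0.
  pose phi (z : I) (b : bool) := (if z == (l, i) then D l b else 1) *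
    (if z == (m, i) then D m b else 1).
  have -> : \sum_o weight o * (D l (o (l, i)) * D m (o (m, i))) =
      \sum_o weight o * \prod_z phi z (o z).
    apply: eq_bigr => o _; rewrite big_split/=; congr (_ * (_ * _)).
      by rewrite (bigD1 (l, i))//= eqxx big1 ?mulr1// => z /negbTE ->.
    by rewrite (bigD1 (m, i))//= eqxx big1 ?mulr1// => z /negbTE ->.
  rewrite weight_expand (bigD1 (l, i))//= /phi eqxx xpair_eqE eqxx andbT.
  rewrite [l == m]eq_sym; have [->|ml] := eqVneq m l.
    rewrite big1 ?mulr1; first by rewrite /bern /D/=; ring.
    by move=> z /negbTE ->; rewrite !mulr1 /bern subrKC.
  by rewrite (_ : _ + _ = 0) ?mul0r// /bern /D/=; ring.
under eq_bigr do under eq_bigr do rewrite key.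
under eq_bigr do rewrite -big_mkcond big_pred1_eq.
by rewrite sumr_const card_ord -[_ *+ N]mulr_natl.
Qed.

Hypothesis y01 : forall i, 0 <= y i <= 1.

Lemma weight_ge0 o : 0 <= weight o.
Proof.
apply: prodr_ge0 => z _; rewrite /bern; have /andP[y0 y1] := y01 z.2.
by case: (o z); rewrite ?subr_ge0.
Qed.

Lemma weight_chebyshev (i : 'I_k) : (0 < N)%N ->
  \sum_o weight o * (freq o i - y i) ^+ 2 <= N%:R^-1.
Proof.
move=> N0; have Np : 0 < (N%:R : R) by rewrite ltr0n.
rewrite (_ : \sum_o _ = \sum_o N%:R^-1 ^+ 2 *
    (weight o * (\sum_(l < N) ((o (l, i))%:R - y i)) ^+ 2)); last first.
  apply: eq_bigr => o _.
  rewrite [in RHS]mulrCA -exprMn; congr (_ * _ ^+ 2).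
  by rewrite sumrB mulrBr sumr_const card_ord -[y i *+ _]mulr_natl mulKf ?gt_eqF.
rewrite -mulr_sumr weight_variance expr2 -mulrA mulKf ?gt_eqF//.
rewrite ler_piMr ?invr_ge0 ?ler0n//.
by have /andP[y0 y1] := y01 i; rewrite mulr_ile1 ?subr_ge0// gerBl.
Qed.

End bernoulli_weights.

Section trigonometric_approximation.
Variables (R : realType) (k : nat).
Implicit Types (x u : 'cV[R]_k) (f g : 'cV[R]_k -> R).

Definition dot u x : R := (u^T *m x) 0 0.

Lemma dotE u x : dot u x = \sum_i u i 0 * x i 0.
Proof. by rewrite /dot mxE; apply: eq_bigr => i _; rewrite mxE. Qed.

Lemma dotDl u v x : dot (u + v) x = dot u x + dot v x.
Proof. by rewrite /dot linearD mulmxDl mxE. Qed.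

Lemma dotNl u x : dot (- u) x = - dot u x.
Proof. by rewrite /dot linearN mulNmx mxE. Qed.

Lemma dot_delta (c : R) i x : dot (c *: delta_mx i 0) x = c * x i 0.
Proof.
rewrite dotE (bigD1 i)//= !mxE !eqxx mulr1 big1 ?addr0// => j /negbTE ji.
by rewrite !mxE ji mulr0 mul0r.
Qed.

(** The phases make this span of cosines contain the sines; the product-to-sum formula makes it an
    algebra. *)
Inductive trig : ('cV[R]_k -> R) -> Prop :=
| trig_cos (a t : R) u : trig (fun x => a * cos (dot u x + t))
| trigD f g : trig f -> trig g -> trig (fun x => f x + g x).

Lemma trig_cst (c : R) : trig (fun=> c).
Proof.
rewrite (_ : (fun=> c) = fun x => c * cos (dot 0 x + 0)); first exact: trig_cos.
by apply/funext => x; rewrite /dot trmx0 mul0mx mxE addr0 cos0 mulr1.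
Qed.

Lemma trigM f g : trig f -> trig g -> trig (fun x => f x * g x).
Proof.
move=> tf tg; elim: tf => [a t u|f1 f2 _ IH1 _ IH2]; last first.
  by under eq_fun do rewrite mulrDl; exact: trigD.
elim: tg => [b s v|g1 g2 _ IH1 _ IH2]; last first.
  by under eq_fun do rewrite mulrDr; exact: trigD.
rewrite (_ : (fun x => _) = fun x => (a * b / 2) * cos (dot (u + v) x + (t + s)) +
    (a * b / 2) * cos (dot (u - v) x + (t - s))).
  by apply: trigD; exact: trig_cos.
apply/funext => x; rewrite !dotDl dotNl.
have -> : dot u x + dot v x + (t + s) = (dot u x + t) + (dot v x + s) by ring.
have -> : dot u x - dot v x + (t - s) = (dot u x + t) - (dot v x + s) by ring.
by move: (dot u x + t) (dot v x + s) => p q; rewrite cosD cosB; field.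
Qed.

Lemma trig_sum (I : Type) (s : seq I) (F : I -> 'cV[R]_k -> R) :
  (forall i, trig (F i)) -> trig (fun x => \sum_(i <- s) F i x).
Proof.
move=> tF; elim: s => [|i s IH].
  by under eq_fun do rewrite big_nil; exact: trig_cst.
by under eq_fun do rewrite big_cons; exact: trigD.
Qed.

Lemma trig_prod (I : Type) (s : seq I) (F : I -> 'cV[R]_k -> R) :
  (forall i, trig (F i)) -> trig (fun x => \prod_(i <- s) F i x).
Proof.
move=> tF; elim: s => [|i s IH].
  by under eq_fun do rewrite big_nil; exact: trig_cst.
by under eq_fun do rewrite big_cons; exact: trigM.
Qed.

Lemma trig_sin (c : R) i : trig (fun x => sin (c * x i 0)).
Proof.
rewrite (_ : (fun x => _) = fun x => 1 * cos (dot (c *: delta_mx i 0) x + (- (pi / 2)))).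
  exact: trig_cos.
by apply/funext => x; rewrite mul1r dot_delta cosBpihalf.
Qed.

Lemma trmx_continuous m n : continuous (fun x : 'M[R]_(m, n) => x^T).
Proof.
move=> x s /= /nbhs_ballP[e /= e0 es]; apply/nbhs_ballP; exists e => //= z [_ xz].
by apply: es; split => // i j; rewrite !mxE; exact: xz.
Qed.

Lemma box_modulus f (K e : R) : continuous f -> 0 < e ->
  exists2 dl : R, 0 < dl & forall x z : 'cV[R]_k, (forall i, `|x i 0| <= K) ->
    (forall i, `|z i 0| <= K) -> (forall i, `|x i 0 - z i 0| < dl) ->
    `|f x - f z| < e.
Proof.
move=> cf e0.
(* Compactness of boxes is used for row vectors, and f is transported by transposition. *)
pose box := [set v : 'rV[R]_k | forall i, `[- K, K]%classic (v ord0 i)].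
have cbox : compact box.
  by apply: (@rV_compact R k (fun=> `[- K, K]%classic)) => i; exact: segment_compact.
have cg : continuous (fun v : 'rV[R]_k => f v^T).
  by move=> v; apply: continuous_comp; [exact: trmx_continuous|exact: cf].
have cw v : box v -> f z^T @[z --> within box (nbhs v)] --> f v^T.
  by move=> _; apply: cvg_within_filter; exact: cg.
have := @heine_cantor R 'rV[R]_k (fun v => f v^T) box box e cbox cw e0.
move=> hd; near (0 : R)^'+ => dl; exists dl.
  by near: dl; exact: nbhs_right_gt.
have H : forall x z : 'rV[R]_k, box x -> box x -> box z -> ball x dl z -> `|f x^T - f z^T| < e.
  by near: dl.
move=> x z xK zK xz.
have bx (v : 'cV[R]_k) : (forall i, `|v i 0| <= K) -> box v^T.
  by move=> vK i; rewrite /= in_itv/= mxE -ler_norml.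
rewrite -(trmxK x) -(trmxK z); apply: H; [exact: bx..|].
split; first by near: dl; exact: nbhs_right_gt.
by move=> i j; rewrite !mxE ord1; exact: xz.
Unshelve. all: by end_near. Qed.

(** The derivative cos is at least 1/2 there. A quantitative injectivity of the sine, in place of
    its inverse. *)
Lemma sin_sub_ge (a b : R) : `|a| <= 2^-1 -> `|b| <= 2^-1 ->
  2^-1 * `|a - b| <= `|sin a - sin b|.
Proof.
wlog ab : a b / a <= b.
  move=> H ha hb; have [ab|/ltW ba] := leP a b; first exact: H.
  by rewrite distrC [leRHS]distrC; exact: H.
move=> ha hb.
have cs : {within `[a, b], continuous (@sin R)}.
  by apply: continuous_subspaceT => z; exact: continuous_sin.
have [c] := @MVT_segment R sin cos a b ab (fun z _ => is_derive_sin z) cs.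
rewrite in_itv/= => /andP[ac cb] e.
rewrite distrC [leRHS]distrC e normrM ler_wpM2r//.
have hc : `|c| <= 2^-1.
  move: ha hb; rewrite !ler_norml => /andP[a1 _] /andP[_ b2].
  by rewrite (le_trans a1 ac) (le_trans cb b2).
have := cos_taylor2 c; have c2 : `|c| ^+ 2 <= 2^-1.
  apply: (@le_trans _ _ (2^-1 * 1)); last by rewrite mulr1.
  rewrite expr2 ler_pM// (le_trans hc)// invf_le1 ?ler1n// ltr0n.
move=> /le_trans /(_ c2); rewrite ler_norml => /andP[h _].
by apply: le_trans (ler_norm _); lra.
Qed.

Section approximation.
Variables (f : 'cV[R]_k -> R) (M K e : R).
Hypothesis cf : continuous f.
Hypothesis fM : forall x, `|f x| <= M.
Hypothesis K0 : 0 < K.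
Hypothesis e0 : 0 < e.

(** This scale sends the box into [-1/2, 1/2], where [sin_sub_ge] applies. *)
Let c := (2 * K)^-1.
Let c0 : 0 < c. Proof. by rewrite invr_gt0 mulr_gt0. Qed.
Let s (x : 'cV[R]_k) (i : 'I_k) : R := (1 + sin (c * x i 0)) / 2.

Let s01 x i : 0 <= s x i <= 1.
Proof.
have := sin_geN1 (c * x i 0); have := sin_le1 (c * x i 0).
rewrite /s ler_pdivrMr// divr_ge0 => //=; lra.
Qed.

Let s_sub (x z : 'cV[R]_k) i : `|x i 0| <= K -> `|z i 0| <= K ->
  c / 4 * `|x i 0 - z i 0| <= `|s x i - s z i|.
Proof.
move=> xK zK.
have cK (v : R) : `|v| <= K -> `|c * v| <= 2^-1.
  move=> vK; rewrite normrM (gtr0_norm c0) /c invfM -mulrA ler_piMr// mulrC.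
  by rewrite ler_pdivrMr// mul1r.
have -> : s x i - s z i = (sin (c * x i 0) - sin (c * z i 0)) / 2 by rewrite /s; field.
rewrite normrM [`|2^-1|]ger0_norm// ler_pdivlMr//.
apply: le_trans (sin_sub_ge (cK _ xK) (cK _ zK)).
by rewrite -mulrBr normrM (gtr0_norm c0) le_eqVlt; apply/orP; left; apply/eqP; field.
Qed.

(* Bernstein-type operator in the variables [s x i], which are trigonometric in
   [x]; instead of inverting [s], each value of the frequencies is assigned a
   point of the box that realises them up to [eta]. *)
Lemma trig_approx : exists g, [/\ trig g, forall x, `|g x| <= M &
  forall x, (forall i, `|x i 0| <= K) -> `|g x - f x| <= e].
Proof.
have e20 : 0 < e / 2 by rewrite divr_gt0.
have [dl dl0 hdl] := box_modulus K cf e20.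
(* Two points of the box whose s-values differ by at most 2 eta are at distance at most 2 dl / 3,
   hence below dl, by [s_sub]. *)
pose eta := c / 4 * dl / 3.
have eta0 : 0 < eta by rewrite !(divr_gt0, mulr_gt0).
have M0 : 0 <= M by rewrite (le_trans _ (fM 0)).
(* B / N bounds the contribution of the outcomes whose frequencies are off by more than eta: error 2
   M times the Chebyshev bound, summed over the k coordinates. *)
pose B := 2 * M * k%:R / eta ^+ 2.
have B0 : 0 <= B by rewrite divr_ge0 ?sqr_ge0// mulr_ge0 ?mulr_ge0.
near \oo => N'; pose N := N'.+1.
have Np : 0 < (N%:R : R) by rewrite ltr0n.
have NB : N%:R^-1 * B <= e / 2.
  have -> : N%:R^-1 * B = B / N%:R by rewrite mulrC.
  rewrite ler_pdivrMr// -ler_pdivrMl//.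
  apply: (@le_trans _ _ N'%:R); last by rewrite ler_nat.
  near: N'; exact: nbhs_infty_ger.
pose I := ('I_N * 'I_k)%type.
(* The default 0 is taken only for frequencies that no point of the box realises; for an outcome
   that is good for x, the point x itself shows that the set is inhabited. *)
pose xo (o : {ffun I -> bool}) := xget 0 [set x : 'cV[R]_k |
  (forall i, `|x i 0| <= K) /\ forall i, `|freq R o i - s x i| <= eta].
pose g x := \sum_o f (xo o) * weight (s x) o.
exists g; split.
- apply: trig_sum => o; apply: trigM; first exact: trig_cst.
  apply: trig_prod => z; rewrite /bern.
  have ts : trig (fun x => s x z.2).
    rewrite (_ : (fun x => _) = fun x => 2^-1 + 2^-1 * sin (c * x z.2 0)); last first.
      by apply/funext => x; rewrite /s; field.
    by apply: trigD; [exact: trig_cst|apply: trigM; [exact: trig_cst|exact: trig_sin]].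
  case: (o z) => //; apply: trigD; first exact: trig_cst.
  by under eq_fun do rewrite -mulN1r; apply: trigM => //; exact: trig_cst.
- move=> x; rewrite -[M]mulr1 -(weight_sum N (s x)) mulr_sumr.
  apply: (le_trans (ler_norm_sum _ _ _)); apply: ler_sum => o _.
  have w0 : 0 <= weight (s x) o by exact: weight_ge0.
  by rewrite normrM (ger0_norm w0) ler_wpM2r.
move=> x xK.
have w0 (o : {ffun I -> bool}) : 0 <= weight (s x) o by exact: weight_ge0.
have -> : g x - f x = \sum_(o : {ffun I -> bool}) (f (xo o) - f x) * weight (s x) o.
  under eq_bigr do rewrite mulrBl.
  by rewrite sumrB -mulr_sumr weight_sum mulr1.
have pt (o : {ffun I -> bool}) : `|f (xo o) - f x| <=
    e / 2 + 2 * M / eta ^+ 2 * \sum_i (freq R o i - s x i) ^+ 2.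
  have sum0 : 0 <= \sum_i (freq R o i - s x i) ^+ 2.
    by apply: sumr_ge0 => i _; exact: sqr_ge0.
  have c20 : 0 <= 2 * M / eta ^+ 2 by rewrite divr_ge0 ?sqr_ge0// mulr_ge0.
  have [good|/existsNP[i /negP]] := pselect (forall i, `|freq R o i - s x i| <= eta).
    apply: (@le_trans _ _ (e / 2)); last by rewrite lerDl mulr_ge0.
    have [xoK xoe] : (forall i, `|xo o i 0| <= K) /\
        forall i, `|freq R o i - s (xo o) i| <= eta.
      by rewrite /xo; case: xgetP => [v -> []//|/(_ x)]; case; split.
    apply/ltW/hdl => // i.
    have h1 : `|s (xo o) i - s x i| <= eta + eta.
      by rewrite (le_trans (ler_distD (freq R o i) _ _))// lerD// distrC.
    have h2 := le_trans (s_sub (xoK i) (xK i)) h1.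
    have c4 : 0 < c / 4 by rewrite divr_gt0.
    rewrite -(ltr_pM2l c4) (le_lt_trans h2)// /eta.
    have : 0 < c / 4 * dl by rewrite mulr_gt0.
    by set q := c / 4 * dl; lra.
  rewrite -ltNge => bad.
  apply: (@le_trans _ _ (2 * M)).
    by rewrite (le_trans (ler_normB _ _))// mulr_natl mulr2n lerD.
  apply: (@le_trans _ _ (2 * M / eta ^+ 2 * \sum_i (freq R o i - s x i) ^+ 2)); last first.
    by rewrite lerDr ltW.
  rewrite -mulrA ler_peMr ?mulr_ge0// mulrC ler_pdivlMr ?exprn_gt0// mul1r.
  rewrite (bigD1 i)//= -[leLHS]addr0; apply: lerD; last first.
    by apply: sumr_ge0 => j _; exact: sqr_ge0.
  rewrite -[leRHS]real_normK ?num_real//.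
  by rewrite lerXn2r ?nnegrE// ltW.
apply: (le_trans (ler_norm_sum _ _ _)).
apply: (@le_trans _ _ (\sum_(o : {ffun I -> bool})
   (e / 2 * weight (s x) o + 2 * M / eta ^+ 2 *
     \sum_i weight (s x) o * (freq R o i - s x i) ^+ 2))).
  apply: ler_sum => o _; rewrite normrM (ger0_norm (w0 o)).
  apply: (le_trans (ler_wpM2r (w0 o) (pt o))).
  rewrite mulrDl lerD2l -[leLHS]mulrA ler_wpM2l//.
    by rewrite divr_ge0 ?sqr_ge0// mulr_ge0.
  by rewrite mulr_suml; apply: ler_sum => i _; rewrite mulrC.
rewrite big_split/= -mulr_sumr weight_sum mulr1 -mulr_sumr exchange_big/=.
rewrite [leRHS]splitr lerD2l; apply: le_trans NB.
have -> : N%:R^-1 * B = 2 * M / eta ^+ 2 * (k%:R * N%:R^-1) by rewrite /B; ring.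
rewrite ler_wpM2l//; first by rewrite divr_ge0 ?sqr_ge0// mulr_ge0.
apply: (@le_trans _ _ (\sum_(i < k) N%:R^-1)).
  by apply: ler_sum => i _; apply: weight_chebyshev.
by rewrite sumr_const card_ord -[_ *+ k]mulr_natl.
Unshelve. all: by end_near. Qed.

End approximation.

End trigonometric_approximation.

Section trigonometric_tests.
Variables (d : measure_display) (T : measurableType d) (R : realType).
Variable P : probability T R.
Variable k : nat.
Implicit Type X : T -> 'cV[R]_k.

Lemma dot_meas X (u : 'cV[R]_k) :
  (forall i, measurable_fun setT (fun w => X w i 0)) ->
  measurable_fun setT (fun w => dot u (X w)).
Proof.
move=> mX; under eq_fun do rewrite dotE.
have h (i : 'I_k) : measurable_fun setT (fun w => u i 0 * X w i 0).
  by apply: measurable_funM => //; exact: measurable_cst.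
exact: (measurable_sum _ h).
Qed.

Lemma trig_itg X (g : 'cV[R]_k -> R) :
  (forall i, measurable_fun setT (fun w => X w i 0)) -> trig g ->
  itg P (fun w => g (X w)).
Proof.
move=> mX; elim => [a t u|f1 f2 _ IH1 _ IH2]; last exact: itgD.
by apply: itgZ; apply: cos_itg; exact: dot_meas.
Qed.

(* M bounds both functions outside the box, where the last sum exceeds 1. *)
Lemma ex_box_approx X (f g : 'cV[R]_k -> R) (M K e C : R) :
  itg P (fun w => f (X w)) -> itg P (fun w => g (X w)) -> 0 < K -> 0 <= e ->
  (forall x, `|f x| <= M) -> (forall x, `|g x| <= M) ->
  (forall x : 'cV[R]_k, (forall i, `|x i 0| <= K) -> `|g x - f x| <= e) ->
  (forall i, itg P (fun w => X w i 0) /\ ex P (fun w => `|X w i 0|) <= C) ->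
  `|ex P (fun w => g (X w)) - ex P (fun w => f (X w))| <=
    e + 2 * M / K * (k%:R * C).
Proof.
move=> if_ ig K0 e0 fM gM gf hX.
have M0 : 0 <= M by rewrite (le_trans _ (fM 0)).
have c0 : 0 <= 2 * M / K by rewrite divr_ge0 ?mulr_ge0// ltW.
have ia i : itg P (fun w => `|X w i 0|) by apply: itg_norm; have [] := hX i.
have is_ : itg P (fun w => \sum_i `|X w i 0|) by apply: itg_sum => i _.
have ir : itg P (fun w => e + 2 * M / K * \sum_i `|X w i 0|).
  by apply: itgD; [exact: itg_cst|exact: itgZ].
rewrite -exB//; apply: (le_trans (ex_norm (itgB ig if_))).
apply: (@le_trans _ _ (ex P (fun w => e + 2 * M / K * \sum_i `|X w i 0|))).
  apply: ex_le => //; first by apply: itg_norm; exact: itgB.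
  move=> w; have s0 : 0 <= \sum_i `|X w i 0| by exact: sumr_ge0.
  have [|/existsNP[i /negP]] := pselect (forall i, `|X w i 0| <= K).
    by move=> /gf /le_trans; apply; rewrite lerDl mulr_ge0.
  rewrite -ltNge => /ltW Ki.
  apply: (@le_trans _ _ (2 * M)).
    by rewrite (le_trans (ler_normB _ _))// mulr_natl mulr2n lerD.
  apply: (@le_trans _ _ (2 * M / K * \sum_i `|X w i 0|)); last by rewrite lerDr.
  rewrite -mulrA ler_peMr ?mulr_ge0// mulrC ler_pdivlMr// mul1r.
  by rewrite (le_trans Ki)// (bigD1 i)//= lerDl sumr_ge0.
rewrite exD; [|exact: itg_cst|exact: itgZ].
rewrite ex_cst exZ// ex_sum// lerD2l ler_wpM2l//.
apply: (@le_trans _ _ (\sum_(i < k) C)).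
  by apply: ler_sum => i _; have [] := hX i.
by rewrite sumr_const card_ord -[_ *+ k]mulr_natl.
Qed.

End trigonometric_tests.

Section convergence_in_distribution.
Variables (d : measure_display) (T : measurableType d) (R : realType).
Variables (P : probability T R) (k : nat) (Z : nat -> T -> 'cV[R]_k).
Variables (mu : probability (borel_cV R k) R) (C : R).
Hypothesis mZ : forall N i, measurable_fun setT (fun w => Z N w i 0).
Hypothesis hZ : \forall N \near \oo, forall i,
  itg P (fun w => Z N w i 0) /\ ex P (fun w => `|Z N w i 0|) <= C.
Hypothesis hmu : forall i, itg mu (fun x : borel_cV R k => (x : 'cV[R]_k) i 0) /\
  ex mu (fun x : borel_cV R k => `|(x : 'cV[R]_k) i 0|) <= C.
Hypothesis hcos : forall u t, ex P (fun w => cos (dot u (Z N w) + t)) @[N --> \oo] -->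
  ex mu (fun x : borel_cV R k => cos (dot u x + t)).

Let midx i : measurable_fun setT (fun x : borel_cV R k => (x : 'cV[R]_k) i 0).
Proof. by apply: borel_coord_measurable; exact: measurable_id. Qed.

Lemma trig_cvg g : trig g -> ex P (fun w => g (Z N w)) @[N --> \oo] -->
  ex mu (fun x : borel_cV R k => g x).
Proof.
elim => [a t u|f1 f2 t1 IH1 t2 IH2].
  rewrite exZ; last by apply: cos_itg; exact: dot_meas.
  rewrite (_ : (fun N => _) = fun N => a * ex P (fun w => cos (dot u (Z N w) + t))).
    by apply: cvgMr; exact: hcos.
  by apply/funext => N; rewrite exZ//; apply: cos_itg; exact: dot_meas.
rewrite exD; [|exact: trig_itg..].
rewrite (_ : (fun N => _) = fun N => ex P (fun w => f1 (Z N w)) + ex P (fun w => f2 (Z N w))).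
  exact: cvgD.
by apply/funext => N; rewrite exD//; exact: trig_itg.
Qed.

Lemma cvg_in_distribution_cos : cvg_in_distribution P Z mu.
Proof.
move=> f cf [M fM].
have M0 : 0 <= M by rewrite (le_trans _ (fM 0)).
have ifZ N : itg P (f \o Z N).
  apply: (@itg_bounded _ _ _ _ _ M) => [|w]; last exact: fM.
  exact: measurable_comp_cV.
have ifm : itg mu (fun x : borel_cV R k => f x).
  apply: (@itg_bounded _ _ _ _ _ M) => [|w]; last exact: fM.
  exact: continuous_borel_measurable.
have -> : (\int[mu]_x (f x)%:E = (ex mu (fun x : borel_cV R k => f x))%:E)%E.
  by rewrite -expectationE// unlock.
have -> : (fun N => 'E_P[f \o Z N]%E) = fun N => (ex P (f \o Z N))%:E.
  by apply/funext => N; rewrite expectationE.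
apply: cvg_EFin; first exact: nearW.
have [N0 _ hN0] := hZ.
apply/cvgrPdist_le => e e0.
(* Five errors: approximation and tail for each of the two laws, and convergence for the
   approximating g. *)
have e50 : 0 < e / 5 by rewrite divr_gt0.
pose K := 2 * M * (k%:R * `|C|) / (e / 5) + 1.
have K0 : 0 < K by rewrite ltr_wpDl// divr_ge0 ?(ltW e50)// !mulr_ge0.
have Ke : 2 * M / K * (k%:R * C) <= e / 5.
  rewrite mulrAC ler_pdivrMr// /K mulrDr mulr1 [e / 5 * _]mulrC divfK ?gt_eqF//.
  apply: (@le_trans _ _ (2 * M * (k%:R * `|C|))); last by rewrite lerDl ltW.
  by rewrite ler_wpM2l ?mulr_ge0// ler_wpM2l// ler_norm.
have [g [tg gM gf]] := trig_approx cf fM K0 e50.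
have igm := trig_itg mu midx tg.
have b1 := ex_box_approx ifm igm K0 (ltW e50) fM gM gf hmu.
near=> N.
have NN : (N0 <= N)%N by near: N; exact: nbhs_infty_ge.
have b2 := ex_box_approx (ifZ N) (trig_itg P (mZ N) tg) K0 (ltW e50) fM gM gf
  (hN0 N NN).
have b3 : `|ex mu (fun x : borel_cV R k => g x) - ex P (fun w => g (Z N w))| <= e / 5.
  by near: N; move/cvgrPdist_le : (trig_cvg tg); exact.
have {}b1 := le_trans b1 (lerD (lexx _) Ke).
have {}b2 := le_trans b2 (lerD (lexx _) Ke).
rewrite distrC in b1.
apply: (le_trans (ler_distD (ex mu (fun x : borel_cV R k => g x)) _ _)).
apply: (le_trans (lerD b1 (ler_distD (ex P (fun w => g (Z N w))) _ _))).
apply: (le_trans (lerD (lexx _) (lerD b3 b2))).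
by rewrite le_eqVlt; apply/orP; left; apply/eqP; field.
Unshelve. all: by end_near. Qed.

End convergence_in_distribution.

Section change_of_law.
Variables (d : measure_display) (T : measurableType d) (R : realType).
Variable P : probability T R.

Lemma distribution_ex d' (T' : measurableType d') (X : T -> T')
    (mX : measurable_fun setT X) (g : T' -> R) : measurable_fun setT g ->
  itg P (g \o X) -> itg (distribution P (mkmfun mX)) g /\
  ex (distribution P (mkmfun mX)) g = ex P (g \o X).
Proof.
move=> mg ig; have mgE : measurable_fun setT (EFin \o g) by exact/measurable_EFinP.
split; last by congr fine; rewrite integral_distribution.
apply/integrableP; split => //; rewrite ge0_integral_distribution//.
  by have /integrableP[_] := ig.
exact: measurableT_comp.
Qed.

Lemma ex_eq_law (X Y : T -> R) (g : R -> R) :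
  measurable_fun setT X -> measurable_fun setT Y ->
  (forall A, measurable A -> P [set w | A (X w)] = P [set w | A (Y w)]) ->
  measurable_fun setT g -> itg P (g \o X) -> itg P (g \o Y) ->
  ex P (g \o X) = ex P (g \o Y).
Proof.
move=> mX mY XY mg iX iY.
have [_ <-] := distribution_ex (mX : measurable_fun setT (X : T -> measurableTypeR R)) mg iX.
have [_ <-] := distribution_ex (mY : measurable_fun setT (Y : T -> measurableTypeR R)) mg iY.
by congr fine; apply: eq_measure_integral => A mA _; exact: XY.
Qed.

End change_of_law.

(** * Gaussian vectors built from a Wiener path *)

Section gaussian_vectors.
Variables (d : measure_display) (T : measurableType d) (R : realType).
Variable P : probability T R.
Variable b : R -> T -> R.
Hypothesis hb : wiener1 P b.

Lemma wiener1_normal_law (v : R) : 0 <= v -> forall A, measurable A ->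
  P [set w | A (b v w - b 0 w)] = normal_law 0 v A.
Proof.
move=> v0 A mA; rewrite /normal_law; have [->|vn0] := eqVneq v 0.
  have [A0|A0] := pselect (A 0).
    rewrite (_ : mkset _ = setT) ?probability_setT; last first.
      by apply/seteqP; split => w //= _; rewrite subrr.
    by rewrite diracE mem_set.
  rewrite (_ : mkset _ = set0) ?measure0; last first.
    by apply/seteqP; split => w //=; rewrite subrr.
  by rewrite diracE memNset.
have vp : 0 < v by rewrite lt_def vn0.
by rewrite (wiener1_law hb (lexx 0) vp mA) subr0.
Qed.

Variables (k m : nat) (M : 'M[R]_(k, m)).

Let Z (i : nat) w := b i.+1%:R w - b i%:R w.

Let mZ i : measurable_fun setT (Z i).
Proof. by apply: measurable_funB; apply: wiener1_meas hb _ _. Qed.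

Let lZ i A : measurable A -> P [set w | A (Z i w)] = normal_prob 0 1 A.
Proof.
move=> mA; have ii : (i%:R : R) < i.+1%:R by rewrite ltr_nat.
rewrite (wiener1_law hb (ler0n _ i) ii mA).
by rewrite (_ : i.+1%:R - i%:R = 1) ?sqrtr1// -natr1; ring.
Qed.

Let indZ : independent_systems P (fun i : 'I_m => sigma_rv (Z i)).
Proof.
have [_ _ h _ _] := hb; apply: (h m (fun i => i%:R)) => //.
by move=> i j ij; rewrite ler_nat.
Qed.

(** The increments of b over unit intervals are independent standard normal, so every law N(0, M
    M^T) is realised on the given space. *)
Definition gvec w : 'cV[R]_k := M *m \col_(i < m) Z i w.

Lemma dot_gvec u w : dot u (gvec w) = \sum_i (u^T *m M) 0 i * Z i w.
Proof.
rewrite /dot /gvec mulmxA mxE; apply: eq_bigr => i _.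
by rewrite [(\col__ _) _ _]mxE.
Qed.

Lemma gvec_coord i w : gvec w i 0 = \sum_j M i j * Z j w.
Proof. by rewrite mxE; apply: eq_bigr => j _; rewrite mxE. Qed.

Let itgZ1 i : itg P (Z i).
Proof.
have := gauss_itg_pow (ltr01 : 0 < 1 :> R) (mZ i) (@lZ i) 1.
by under eq_fun do rewrite expr1.
Qed.

Lemma gvec_itg i : itg P (fun w => gvec w i 0).
Proof.
under eq_fun do rewrite gvec_coord.
by apply: itg_sum => j _; exact: itgZ.
Qed.

Let mgvec : measurable_fun setT (gvec : T -> borel_cV R k).
Proof. by apply: measurable_cV => i; exact: itg_meas (gvec_itg i). Qed.

Definition gvec_law : probability (borel_cV R k) R := distribution P (mkmfun mgvec).

Let var (u : 'cV[R]_k) : R := (u^T *m (M *m M^T) *m u) 0 0.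

Let varE u : var u = \sum_i (u^T *m M) 0 i ^+ 2.
Proof.
rewrite /var (_ : _ *m u = (u^T *m M) *m (u^T *m M)^T); last first.
  by rewrite trmx_mul trmxK !mulmxA.
by rewrite mxE; apply: eq_bigr => i _; rewrite [(_^T) _ _]mxE expr2.
Qed.

Let dot_law u A : measurable A ->
  P [set w | A (dot u (gvec w))] = normal_law 0 (var u) A.
Proof.
move=> mA; rewrite varE -(wiener1_sum_law hb (fun i => (u^T *m M) 0 i) _ indZ _ mA)//.
  by congr (P _); apply/seteqP; split => w /=; rewrite dot_gvec.
by move=> i B mB; exact: lZ.
Qed.

Lemma gvec_gaussian : gaussian_law gvec_law 0 (M *m M^T).
Proof.
by move=> u A mA; rewrite mulmx0 mxE -dot_law.
Qed.

Lemma gvec_law_coord i :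
  itg gvec_law (fun x : borel_cV R k => (x : 'cV[R]_k) i 0) /\
  ex gvec_law (fun x : borel_cV R k => `|(x : 'cV[R]_k) i 0|) =
    ex P (fun w => `|gvec w i 0|).
Proof.
have mc : measurable_fun setT (fun x : borel_cV R k => (x : 'cV[R]_k) i 0).
  by apply: borel_coord_measurable; exact: measurable_id.
have [h1 _] := distribution_ex mgvec mc (gvec_itg i).
split => //.
by have [] := distribution_ex mgvec (measurableT_comp (@normr_measurable R setT) mc)
  (itg_norm (gvec_itg i)).
Qed.

(** The right-hand side has the shape of the comparison term of [qblock_clt]: the same Wiener
    coordinate at the time given by the variance. *)
Lemma gvec_law_cos u t :
  ex gvec_law (fun x : borel_cV R k => cos (dot u x + t)) =
  ex P (fun w => cos (b (var u) w - b 0 w + t)).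
Proof.
have v0 : 0 <= var u by rewrite varE sumr_ge0// => i _; exact: sqr_ge0.
have mco (i : 'I_k) : measurable_fun setT (fun x : borel_cV R k => (x : 'cV[R]_k) i 0).
  by apply: borel_coord_measurable; exact: measurable_id.
have mgc i : measurable_fun setT (fun w => gvec w i 0) by exact: itg_meas (gvec_itg i).
have md : measurable_fun setT (fun w => dot u (gvec w)) by exact: dot_meas.
have mb : measurable_fun setT (fun w => b (var u) w - b 0 w).
  by apply: measurable_funB; apply: wiener1_meas hb _ _.
have mcos : measurable_fun setT (fun x : R => cos (x + t)) by exact: cos_meas.
have [_ ->] := distribution_ex mgvec (cos_meas t (dot_meas u mco)) (cos_itg P t md).
apply: (ex_eq_law md mb _ mcos); [|exact: cos_itg..].
by move=> A mA; rewrite dot_law// wiener1_normal_law.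
Qed.

End gaussian_vectors.

(** * The duplication matrix *)

Section duplication.
Variables (R : realType) (p : nat).
Local Notation D := (dupmx R p).
Local Notation Dp := (mpinv (dupmx R p)).

Lemma sum_mxtens m n (F : 'I_(m * n) -> R) :
  \sum_k F k = \sum_(x : 'I_m * 'I_n) F (mxtens_index x).
Proof.
by rewrite (reindex (@mxtens_index m n))//; exists (@mxtens_unindex m n) => z _;
  [exact: mxtens_indexK|exact: mxtens_unindexK].
Qed.

Let vech_uniq : uniq (vech_index p).
Proof.
apply: allpairs_uniq_dep => /=; first exact: enum_uniq.
  by move=> x _; rewrite filter_uniq ?enum_uniq.
by move=> [a b] [c d] _ _ [-> ->].
Qed.

Let vech_le l : ((tnth (vech_index p) l).2 <= (tnth (vech_index p) l).1)%N.
Proof.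
have : tnth (vech_index p) l \in vech_index p by exact: mem_tnth.
by move=> /allpairsPdep[a [b [_]]]; rewrite mem_filter => /andP[ab _] ->.
Qed.

Lemma dupmx_mul (x : 'cV[R]_(pbar p)) l :
  (D *m x) (mxtens_index ((tnth (vech_index p) l).2, (tnth (vech_index p) l).1)) 0 = x l 0.
Proof.
have := vech_le l; case E : (tnth _ l) => [i j]/= ji.
rewrite mxE (bigD1 l)//= mxE mxtens_indexK E eqxx mul1r big1 ?addr0// => l' ll'.
rewrite mxE mxtens_indexK -E (inj_eq (tuple_uniqP _ vech_uniq)) (negbTE ll')/=.
case: eqP => [e|_]; last by rewrite mul0r.
have := vech_le l'; rewrite e /= => ij.
have ij' : i = j by apply/val_inj/eqP; rewrite eqn_leq ij ji.
by move: ll'; rewrite -(inj_eq (tuple_uniqP _ vech_uniq)) E e ij' eqxx.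
Qed.

(** By [dupmx_mul] every coordinate of a vector can be read off its image under D; since D Dp D = D,
    the vectors Dp D y and y have the same image. *)
Lemma mpinv_dupmx : Dp *m D = 1%:M.
Proof.
have [DDD _ _ _] := mpinvP D.
apply/matrixP => l m.
have h (y : 'cV[R]_(pbar p)) : Dp *m D *m y = y.
  apply/matrixP => a z; rewrite ord1 -(dupmx_mul _ a) -(dupmx_mul y a).
  by rewrite !mulmxA DDD.
have := h (delta_mx m 0) => /matrixP/(_ l 0).
rewrite -colE mxE => ->; rewrite !mxE eqxx andbT.
by [].
Qed.

(** The matrix form of Dp^T u: on symmetric A, the linear form of [vech] A given by u is the
    Frobenius product with this matrix. *)
Definition dual_vech (u : 'cV[R]_(pbar p)) : 'M[R]_p :=
  \matrix_(i, j) (Dp^T *m u) (mxtens_index (j, i)) 0.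

(** The Moore-Penrose identities give Dp^T = D Dp Dp^T, so Dp^T u lies in the range of D, which
    consists of vectorised symmetric matrices. *)
Lemma dual_vech_sym u : (dual_vech u)^T = dual_vech u.
Proof.
have [_ XDX AX _] := mpinvP D.
have xE : Dp^T *m u = D *m (Dp *m Dp^T *m u).
  by rewrite !mulmxA -[D *m Dp]AX -trmx_mul mulmxA XDX.
rewrite /dual_vech xE.
apply/matrixP => i j; rewrite !mxE; apply: eq_bigr => l _; congr (_ * _).
by rewrite !mxE !mxtens_indexK orbC.
Qed.

Lemma vec_dual_vech u : vec (dual_vech u) = Dp^T *m u.
Proof.
by apply/matrixP => k z; rewrite ord1 !mxE -surjective_pairing mxtens_unindexK.
Qed.

Lemma dot_vech u (A : 'M[R]_p) : A^T = A ->
  dot u (vech A) = \sum_(x : 'I_p * 'I_p) dual_vech u x.1 x.2 * A x.1 x.2.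
Proof.
move=> AT; have e : vech A = Dp *m vec A by rewrite dupmxP// mulmxA mpinv_dupmx mul1mx.
rewrite /dot e mulmxA (_ : u^T *m Dp = (vec (dual_vech u))^T); last first.
  by rewrite vec_dual_vech trmx_mul trmxK.
rewrite mxE sum_mxtens (reindex_inj (_ : injective (fun x : 'I_p * 'I_p => (x.2, x.1)))).
  by apply: eq_bigr => x _; rewrite !mxE mxtens_indexK.
by move=> [a b] [a' b'] [-> ->].
Qed.

Lemma vec_tens r (A : 'M[R]_(p, r)) (X : 'M[R]_p) :
  (A *t A)^T *m vec X = vec (A^T *m X *m A).
Proof.
apply/matrixP => k z; rewrite ord1 mxE sum_mxtens -(mxtens_unindexK k).
case: (mxtens_unindex k) => [k1 k2]; rewrite mxE mxtens_indexK/= mxE.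
under [RHS]eq_bigr do rewrite mxE mulr_suml.
rewrite pair_bigA/=; apply: eq_bigr => -[l1 l2] _ /=.
by rewrite trmx_tens tensmxE !mxE mxtens_indexK/=; ring.
Qed.

(** Up to the factor 2, the limit variance in direction u is thus the variance of the quadratic form
    with matrix A^T (dual_vech u) A. *)
Lemma dual_vech_var r (A : 'M[R]_(p, r)) u :
  (u^T *m (Dp *m ((A *m A^T) *t (A *m A^T)) *m Dp^T) *m u) 0 0 =
  \sum_(x : 'I_r * 'I_r) (A^T *m dual_vech u *m A) x.1 x.2 ^+ 2.
Proof.
have -> : u^T *m (Dp *m ((A *m A^T) *t (A *m A^T)) *m Dp^T) *m u =
    (vec (A^T *m dual_vech u *m A))^T *m vec (A^T *m dual_vech u *m A).
  rewrite -vec_tens vec_dual_vech -tensmx_mul -trmx_tens.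
  by rewrite !trmx_mul !trmxK !mulmxA.
rewrite mxE sum_mxtens (reindex_inj (_ : injective (fun x : 'I_r * 'I_r => (x.2, x.1)))).
  by apply: eq_bigr => x _; rewrite [_^T _ _]mxE !mxE mxtens_indexK expr2.
by move=> [a b] [a' b'] [-> ->].
Qed.

End duplication.

(** * Realized covariance of a diffusion *)

Section diffusion.
Variables (d : measure_display) (T : measurableType d) (R : realType).
Variable P : probability T R.
Variables (k r : nat) (W : R -> T -> 'cV[R]_r) (B : 'cV[R]_k -> 'cV[R]_k).
Variables (S : 'M[R]_(k, r)) (c : 'cV[R]_k) (Y : R -> T -> 'cV[R]_k).
Variables (L M : R).
Local Notation mu := (@lebesgue_measure R).
Hypothesis hW : wiener P W.
Hypothesis L0 : 0 <= L.
Hypothesis LB : forall x z, `|B x - B z| <= L * `|x - z|.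
Hypothesis mY : forall t i, 0 <= t -> measurable_fun setT (fun w => Y t w i 0).
Hypothesis cY : forall w i, {within `[0, +oo[, continuous (fun t => Y t w i 0)}.
Hypothesis eY : \forall w \ae P, forall t, 0 <= t -> forall i,
  Y t w i 0 = c i 0 + \int[mu]_(s in `[0, t]) B (Y s w) i 0 + (S *m W t w) i 0.
Hypothesis M0 : 0 <= M.
Hypothesis hM : forall t i, 0 <= t ->
  itg P (fun w => Y t w i 0 ^+ 2) /\ ex P (fun w => Y t w i 0 ^+ 2) <= M.

Lemma Bcoord_continuous i : continuous (fun x : 'cV[R]_k => B x i 0).
Proof.
move=> x s /= /nbhs_ballP[e /= e0 es]; apply/nbhs_ballP.
have d0 : 0 < e / (L + 1) by rewrite divr_gt0// ltr_wpDl.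
exists (e / (L + 1) / 2) => /=; first by rewrite divr_gt0.
move=> z [_ xz]; apply: es; rewrite /ball/=.
have -> : B x i 0 - B z i 0 = (B x - B z) i 0 by rewrite !mxE.
apply: (le_lt_trans (coord_norm_le _ _ _)); apply: (le_lt_trans (LB _ _)).
have xz' : `|x - z| <= e / (L + 1) / 2.
  apply: mx_norm_leP => [|a b]; first by rewrite divr_ge0// ltW.
  by rewrite !mxE; apply/ltW/xz.
apply: (le_lt_trans (ler_wpM2l L0 xz')).
rewrite !mulrA -mulrA -invfM ltr_pdivrMr; last by rewrite mulr_gt0// ltr_wpDl.
have -> : e * ((L + 1) * 2) = L * e + (L * e + 2 * e) by ring.
by rewrite ltrDl ltr_wpDl ?mulr_ge0 ?mulr_gt0 ?(ltW e0).
Qed.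

Lemma sqnorm_le (x : 'cV[R]_k) : `|x| ^+ 2 <= \sum_i x i 0 ^+ 2.
Proof.
have s0 : 0 <= \sum_i x i 0 ^+ 2 by apply: sumr_ge0 => i _; exact: sqr_ge0.
rewrite -(sqr_sqrtr s0) lerXn2r ?nnegrE ?sqrtr_ge0//.
apply: mx_norm_leP => [|i j]; first exact: sqrtr_ge0.
rewrite ord1 -sqrtr_sqr ler_wsqrtr// (bigD1 i)//= lerDl.
by apply: sumr_ge0 => l _; exact: sqr_ge0.
Qed.

(** Second-moment bound for the drift, uniform in time, from the linear growth implied by the
    Lipschitz condition. *)
Definition MB := 2 * `|B 0| ^+ 2 + 2 * L ^+ 2 * (k%:R * M).

Lemma B_growth (x : 'cV[R]_k) i :
  B x i 0 ^+ 2 <= 2 * `|B 0| ^+ 2 + 2 * L ^+ 2 * \sum_j x j 0 ^+ 2.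
Proof.
have h : `|B x i 0| <= `|B 0| + L * `|x|.
  apply: (le_trans (coord_norm_le _ _ _)).
  rewrite -[X in `|X|](subrK (B 0)) addrC (le_trans (ler_normD _ _))// lerD2l.
  by have := LB x 0; rewrite subr0.
rewrite -real_normK ?num_real//.
apply: (@le_trans _ _ ((`|B 0| + L * `|x|) ^+ 2)).
  by rewrite lerXn2r ?nnegrE// (le_trans _ h).
apply: (@le_trans _ _ (2 * `|B 0| ^+ 2 + 2 * L ^+ 2 * `|x| ^+ 2)).
  by have := sqr_ge0 (`|B 0| - L * `|x|); nra.
by rewrite lerD2l ler_wpM2l ?sqnorm_le// mulr_ge0// sqr_ge0.
Qed.

Lemma drift_sqi t i : 0 <= t ->
  sqi P (fun w => B (Y t w) i 0) /\ ex P (fun w => B (Y t w) i 0 ^+ 2) <= MB.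
Proof.
move=> t0.
have mB : measurable_fun setT (fun w => B (Y t w) i 0).
  have mYt j : measurable_fun setT (fun w => Y t w j 0) by exact: mY.
  exact: (measurable_comp_cV (@Bcoord_continuous i) mYt).
pose g w := 2 * `|B 0| ^+ 2 + 2 * L ^+ 2 * \sum_j Y t w j 0 ^+ 2.
have is_ : itg P (fun w => \sum_j Y t w j 0 ^+ 2).
  by apply: itg_sum => j _; have [] := hM j t0.
have ig : itg P g by apply: itgD; [exact: itg_cst|exact: itgZ].
have iB : itg P (fun w => B (Y t w) i 0 ^+ 2).
  apply: (itg_le _ _ ig); first exact: measurable_funX.
  by move=> w; rewrite ger0_norm ?sqr_ge0//; exact: B_growth.
split => //; apply: (@le_trans _ _ (ex P g)).
  by apply: ex_le => // w; exact: B_growth.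
rewrite /g exD; [|exact: itg_cst|exact: itgZ].
rewrite ex_cst exZ// ex_sum; last by move=> j _; have [] := hM j t0.
rewrite /MB lerD2l ler_wpM2l ?mulr_ge0 ?sqr_ge0//.
apply: (@le_trans _ _ (\sum_(j < k) M)).
  by apply: ler_sum => j _; have [] := hM j t0.
by rewrite sumr_const card_ord mulr_natl.
Qed.

Lemma MB_ge0 : 0 <= MB.
Proof. by rewrite addr_ge0// mulr_ge0 ?sqr_ge0// mulr_ge0 ?sqr_ge0// ?ler0n. Qed.

(** Almost surely the integral of the drift over [s, t]. Written through increments, it is visibly a
    random variable. *)
Definition Dr (s t : R) i w :=
  Y t w i 0 - Y s w i 0 - (S *m (W t w - W s w)) i 0.

Lemma SW_expand s t i w : (S *m (W t w - W s w)) i 0 =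
  \sum_a S i a * (W t w a 0 - W s w a 0).
Proof. by rewrite mxE; apply: eq_bigr => a _; rewrite !mxE. Qed.

Lemma SW_sqi s t i : 0 <= s -> s <= t ->
  sqi P (fun w => (S *m (W t w - W s w)) i 0) /\
  ex P (fun w => (S *m (W t w - W s w)) i 0 ^+ 2) <=
    r%:R * (\sum_i \sum_a S i a ^+ 2) * (t - s).
Proof.
move=> s0 st; under eq_fun do rewrite SW_expand.
under [X in ex P X]eq_fun do rewrite SW_expand.
have h a : sqi P (fun w => S i a * (W t w a 0 - W s w a 0)).
  by apply: sqiZ; exact: (wiener_incr_sqi hW).
split; first by apply: sqi_sum => a _; exact: h.
apply: (le_trans (ex_sqr_sum_le h)); rewrite -mulrA ler_wpM2l ?ler0n//.
apply: (@le_trans _ _ (\sum_a S i a ^+ 2 * (t - s))).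
  apply: ler_sum => a _; under eq_fun do rewrite exprMn.
  have [_ i2] := wiener_incr_sqi hW a s0 st.
  by rewrite exZ// (wiener_incr_ex2 hW).
rewrite -mulr_suml ler_wpM2r ?subr_ge0// [leRHS](bigD1 i)//= lerDl.
by apply: sumr_ge0 => j _; apply: sumr_ge0 => a _; exact: sqr_ge0.
Qed.

Lemma Dr_meas s t i : 0 <= s -> s <= t -> measurable_fun setT (Dr s t i).
Proof.
move=> s0 st; have t0 := le_trans s0 st.
apply: measurable_funB; first by apply: measurable_funB; exact: mY.
by have [[]] := SW_sqi i s0 st.
Qed.

(* Riemann sums and Fatou's lemma turn a bound on the drift along the path into
   a bound on its time integral. *)
Lemma riemann_fatou s t i (g : T -> R) (C : R) : 0 <= s -> s <= t ->
  sqi P g ->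
  (forall u, s <= u -> u <= t ->
    ex P (fun w => (B (Y u w) i 0 - g w) ^+ 2) <= C) ->
  sqi P (fun w => Dr s t i w - (t - s) * g w) /\
  ex P (fun w => (Dr s t i w - (t - s) * g w) ^+ 2) <= (t - s) ^+ 2 * C.
Proof.
move=> s0 st sg hC; have [mg ig] := sg.
have ts0 : 0 <= t - s by rewrite subr_ge0.
pose u (n l : nat) := s + l%:R * ((t - s) / n%:R).
(* Riemann sums of the drift minus g over n + 1 pieces, which avoids a division by 0. *)
pose X n w := \sum_(l < n.+1) ((t - s) / n.+1%:R) * (B (Y (u n.+1 l) w) i 0 - g w).
have su n (l : 'I_n.+1) : s <= u n.+1 l.
  by rewrite lerDl mulr_ge0// divr_ge0.
have ut n (l : 'I_n.+1) : u n.+1 l <= t.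
  rewrite -lerBrDl mulrCA ler_piMr// ler_pdivrMr ?ltr0n// mul1r ler_nat.
  exact/ltnW.
have sBg v : s <= v -> sqi P (fun w => B (Y v w) i 0 - g w).
  move=> sv; have [sB _] := drift_sqi i (le_trans s0 sv).
  by under eq_fun do rewrite -mulN1r; apply: sqiD => //; exact: sqiZ.
have sX n : sqi P (X n).
  by apply: sqi_sum => l _; apply: sqiZ; apply: sBg.
have mD : measurable_fun setT (fun w => Dr s t i w - (t - s) * g w).
  by apply: measurable_funB; [exact: Dr_meas|exact: measurable_funM].
have [iD le] : itg P (fun w => (Dr s t i w - (t - s) * g w) ^+ 2) /\
    ex P (fun w => (Dr s t i w - (t - s) * g w) ^+ 2) <= (t - s) ^+ 2 * C.
  apply: (@itg_fatou _ _ _ P (fun n w => X n w ^+ 2)).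
  - by move=> n; have [] := sX n.
  - by move=> n w; exact: sqr_ge0.
  - move=> n; apply: (le_trans (ex_sqr_sum_le _)).
      by move=> l; apply: sqiZ; apply: sBg.
    apply: (@le_trans _ _ (n.+1%:R * \sum_(l < n.+1) ((t - s) / n.+1%:R) ^+ 2 * C)).
      rewrite ler_wpM2l ?ler0n//; apply: ler_sum => l _.
      under eq_fun do rewrite exprMn.
      have [_ i2] := sBg _ (su n l).
      by rewrite exZ// ler_wpM2l ?sqr_ge0//; apply: hC.
    rewrite sumr_const card_ord -[_ *+ _]mulr_natl le_eqVlt; apply/orP; left.
    apply/eqP; have : (n.+1%:R : R) != 0 by rewrite pnatr_eq0.
    by move=> n0; field.
  - exact: measurable_funX.
  - apply: filterS eY => w ew.
    have := @riemann_cvg _ _ _ (fun t => Y t w) (fun t => W t w) B S c L L0 LB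
      (@cY w) ew s t i s0 st.
    rewrite -(cvg_shiftS _) => h.
    suff h2 : X n w @[n --> \oo] --> Dr s t i w - (t - s) * g w.
      by rewrite !expr2; under eq_fun do rewrite expr2; exact: cvgM.
    have XE n : X n w = \sum_(l < n.+1) ((t - s) / n.+1%:R) * B (Y (u n.+1 l) w) i 0
        - (t - s) * g w.
      rewrite /X; under eq_bigr do rewrite mulrBr; rewrite sumrB; congr (_ - _).
      rewrite sumr_const card_ord -[_ *+ _]mulr_natl mulrA; congr (_ * _).
      by rewrite mulrC divfK// pnatr_eq0.
    under eq_fun do rewrite XE.
    by apply: cvgB; [exact: h|exact: cvg_cst].
  - by move=> w; exact: sqr_ge0.
by split.
Qed.

Lemma Dr_sqi s t i : 0 <= s -> s <= t ->
  sqi P (Dr s t i) /\ ex P (fun w => Dr s t i w ^+ 2) <= (t - s) ^+ 2 * MB.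
Proof.
move=> s0 st.
have [|h1 h2] := @riemann_fatou s t i (fun=> 0) MB s0 st (sqi_cst P 0).
  by move=> u su ut; under eq_fun do rewrite subr0; have [] := drift_sqi i (le_trans s0 su).
have e w : Dr s t i w - (t - s) * 0 = Dr s t i w by rewrite mulr0 subr0.
move: h1 h2; rewrite (_ : (fun w => Dr s t i w - (t - s) * 0) = Dr s t i); last first.
  exact/funext.
by under [X in ex P X <= _ -> _]eq_fun do rewrite e.
Qed.

Definition CY := 2 * MB + 2 * (r%:R * (\sum_i \sum_a S i a ^+ 2)).

Lemma CY_ge0 : 0 <= CY.
Proof.
rewrite addr_ge0// mulr_ge0// ?MB_ge0// mulr_ge0 ?ler0n//.
by apply: sumr_ge0 => i _; apply: sumr_ge0 => a _; exact: sqr_ge0.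
Qed.

Lemma Y_increment s t i : 0 <= s -> s <= t -> t - s <= 1 ->
  sqi P (fun w => Y t w i 0 - Y s w i 0) /\
  ex P (fun w => (Y t w i 0 - Y s w i 0) ^+ 2) <= CY * (t - s).
Proof.
move=> s0 st ts1; have [sD eD] := Dr_sqi i s0 st; have [sW eW] := SW_sqi i s0 st.
have e w : Y t w i 0 - Y s w i 0 = Dr s t i w + (S *m (W t w - W s w)) i 0.
  by rewrite subrK.
have -> : (fun w => Y t w i 0 - Y s w i 0) =
  fun w => Dr s t i w + (S *m (W t w - W s w)) i 0 by apply/funext.
split; first exact: sqiD.
under eq_fun do rewrite e.
apply: (le_trans (ex_sqrD_le sD sW)); rewrite /CY (mulrDl (2 * MB)); apply: lerD.
  rewrite -mulrA ler_wpM2l// (le_trans eD)// mulrC ler_wpM2l ?MB_ge0//.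
  by rewrite expr2 ler_piMr// subr_ge0.
by rewrite -mulrA ler_wpM2l.
Qed.

Definition CD := L ^+ 2 * (k%:R * CY).

(** Freezing the drift at the left end point gains a factor t - s over [Dr_sqi], through the
    Lipschitz condition and the mean square increments of Y. *)
Lemma Dr_linear s t i : 0 <= s -> s <= t -> t - s <= 1 ->
  sqi P (fun w => Dr s t i w - (t - s) * B (Y s w) i 0) /\
  ex P (fun w => (Dr s t i w - (t - s) * B (Y s w) i 0) ^+ 2) <=
    (t - s) ^+ 2 * (CD * (t - s)).
Proof.
move=> s0 st ts1; have [sB _] := drift_sqi i s0.
apply: riemann_fatou => // u su ut.
have us1 : u - s <= 1 by rewrite (le_trans _ ts1)// lerD2r.
have i2 : itg P (fun w => \sum_j (Y u w j 0 - Y s w j 0) ^+ 2).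
  by apply: itg_sum => j _; have [[]] := Y_increment j s0 su us1.
have [sBu _] := drift_sqi i (le_trans s0 su).
have sd : sqi P (fun w => B (Y u w) i 0 - B (Y s w) i 0).
  by under eq_fun do rewrite -mulN1r; apply: sqiD => //; exact: sqiZ.
have [_ id] := sd.
apply: (@le_trans _ _ (ex P (fun w => L ^+ 2 * \sum_j (Y u w j 0 - Y s w j 0) ^+ 2))).
  apply: ex_le => //; first exact: itgZ.
  move=> w.
  have -> : B (Y u w) i 0 - B (Y s w) i 0 = (B (Y u w) - B (Y s w)) i 0 by rewrite !mxE.
  rewrite -real_normK ?num_real//.
  have h := le_trans (coord_norm_le (B (Y u w) - B (Y s w)) i 0) (LB _ _).
  apply: (@le_trans _ _ ((L * `|Y u w - Y s w|) ^+ 2)).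
    by rewrite lerXn2r ?nnegrE// (le_trans _ h).
  rewrite exprMn ler_wpM2l ?sqr_ge0//; apply: (le_trans (sqnorm_le _)).
  by apply: ler_sum => j _; rewrite !mxE.
rewrite exZ// ex_sum; last by move=> j _; have [[]] := Y_increment j s0 su us1.
rewrite /CD -mulrA ler_wpM2l ?sqr_ge0//.
apply: (@le_trans _ _ (\sum_(j < k) CY * (t - s))).
  apply: ler_sum => j _; have [_ h] := Y_increment j s0 su us1.
  by apply: (le_trans h); rewrite ler_wpM2l ?CY_ge0// lerD2r.
by rewrite sumr_const card_ord -[_ *+ _]mulr_natl mulrA.
Qed.

Section martingale_part.
Variables (h : R) (n : nat).
Hypothesis h0 : 0 < h.

Section grid.
Variable N : nat.
Hypothesis N0 : (0 < N)%N.
(** The Euler grid cuts each observation step into N pieces, so that fine index j N corresponds to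
    time j h. [J q] collects the increments before q, [J' q] those from q on. *)
Let tau : R := h / N%:R.
Let m := (n * N)%N.
Let t (l : nat) : R := l%:R * tau.
Let G := @fincr _ _ _ _ W m t.
Let J q : {set 'I_m * 'I_r} := [set x : 'I_m * 'I_r | (x.1 < q)%N]%SET.
Let J' q : {set 'I_m * 'I_r} := [set x : 'I_m * 'I_r | (q <= x.1)%N]%SET.

Let tau0 : 0 < tau. Proof. by rewrite divr_gt0// ltr0n. Qed.
Let t0 l : 0 <= t l. Proof. by rewrite mulr_ge0// ?ler0n// ltW. Qed.
Let tm : {homo t : i j / (i <= j)%N >-> i <= j}.
Proof. by move=> i j ij; rewrite ler_wpM2r ?(ltW tau0)// ler_nat. Qed.

Let tN j : t (j * N)%N = j%:R * h.
Proof. by rewrite /t natrM -mulrA /tau [N%:R * _]mulrC divfK// pnatr_eq0 -lt0n. Qed.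

Let mG i : measurable_fun setT (G i).
Proof. exact: (fincr_meas hW). Qed.

Let indG : independent_systems P (fun i => sigma_rv (G i)).
Proof. by apply: (incr_indep hW) => //; exact: tm. Qed.

Definition eul (l : nat) (w : T) : 'cV[R]_k :=
  euler B S c tau (fun l => W (l.+1%:R * tau) w - W (l%:R * tau) w) l.

(** Adaptedness of the scheme, by induction along its recursion. *)
Let eul_meas l i : (l <= m)%N -> fam_meas G (J l) (fun w => eul l w i 0).
Proof.
elim: l i => [|l IH] i lm; first exact: measurable_cst.
have IH' j : fam_meas G (J l.+1) (fun w => eul l w j 0).
  apply: fam_meas_sub (IH j (ltnW lm)); apply/fintype.subsetP => x; rewrite !inE.
  by move=> /ltnW.
have -> : (fun w => eul l.+1 w i 0) = fun w => eul l w i 0 +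
    tau * B (eul l w) i 0 + \sum_a S i a * G (Ordinal lm, a) w.
  apply/funext => w; rewrite /eul/= -/(eul l w) !mxE; congr (_ + _).
  by apply: eq_bigr => a _; rewrite !mxE.
apply: measurable_funD; first apply: measurable_funD.
- exact: IH'.
- apply: measurable_funM; first exact: measurable_cst.
  exact: (measurable_comp_cV (@Bcoord_continuous i) IH').
- apply: measurable_sum => a; apply: measurable_funM; first exact: measurable_cst.
  by apply: fam_meas_coord; rewrite inE/=.
Qed.

Lemma eul_measT l i : (l <= m)%N -> measurable_fun setT (fun w => eul l w i 0).
Proof. by move=> lm; apply: fam_measW (eul_meas i lm). Qed.

Let blockE j a w : (j < n)%N ->
  W (j.+1%:R * h) w a 0 - W (j%:R * h) w a 0 =
  \sum_(x : 'I_m | (j * N <= x < j.+1 * N)%N) G (x, a) w.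
Proof.
move=> jn; rewrite -!tN.
have jm : (j.+1 * N <= m)%N by rewrite leq_mul2r jn orbT.
transitivity (\sum_(j * N <= l < j.+1 * N) (W (t l.+1) w a 0 - W (t l) w a 0)).
  by rewrite telescope_sumr// leq_mul2r leqnSn orbT.
rewrite (big_nat_widen _ _ _ _ _ jm) big_geq_mkord.
by apply: eq_bigl => x; rewrite andbC.
Qed.

(** A coarse increment is a sum of N fine ones, with indices from j N on; the clipped drift of the
    scheme at time j h involves only earlier ones. *)
Lemma euler_orthogonal (K : R) (i : 'I_k) (a : 'I_r) : 0 <= K ->
  sqi P (fun w => \sum_(j < n) clip K (B (eul (j * N) w) i 0) *
    (W (j.+1%:R * h) w a 0 - W (j%:R * h) w a 0)) /\
  ex P (fun w => (\sum_(j < n) clip K (B (eul (j * N) w) i 0) *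
    (W (j.+1%:R * h) w a 0 - W (j%:R * h) w a 0)) ^+ 2) =
  \sum_(j < n) ex P (fun w => clip K (B (eul (j * N) w) i 0) ^+ 2) * h.
Proof.
move=> K0.
have jh j : 0 <= j%:R * h by rewrite mulr_ge0// ?ler0n// ltW.
have jh1 j : j%:R * h < j.+1%:R * h by rewrite ltr_pM2r// ltr_nat.
have jhE j : j.+1%:R * h - j%:R * h = h by rewrite -natr1; ring.
have := @orthogonal_sum _ _ _ P _ G mG indG
  (fun j w => clip K (B (eul (j * N) w) i 0))
  (fun j w => W (j.+1%:R * h) w a 0 - W (j%:R * h) w a 0)
  (fun j => J (j * N)%N) (fun j => J' (j * N)%N) K h n.
have bm (j : nat) (J0 : {set 'I_m * 'I_r}) : (j < n)%N ->
    (forall x : 'I_m, (j * N <= x < j.+1 * N)%N -> (x, a) \in J0) ->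
    fam_meas G J0 (fun w => W (j.+1%:R * h) w a 0 - W (j%:R * h) w a 0).
  move=> jn hJ; rewrite (_ : (fun w => _) = fun w => \sum_(x : 'I_m)
     if (j * N <= x < j.+1 * N)%N then G (x, a) w else 0); last first.
    by apply/funext => w; rewrite (blockE _ _ jn) big_mkcond.
  have hx (x : 'I_m) : fam_meas G J0
      (fun w => if (j * N <= x < j.+1 * N)%N then G (x, a) w else 0).
    have [xj|xj] := boolP (j * N <= x < j.+1 * N)%N; last exact: measurable_cst.
    by apply: fam_meas_coord; exact: hJ.
  exact: (measurable_sum _ hx).
move=> H; have [] // := H _ _ _ _ _ _ _ _ _ n (leqnn n).
- move=> j; apply/fintype.subsetP => x; rewrite !inE => /leq_trans; apply.
  by rewrite leq_mul2r leqnSn orbT.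
- move=> j; rewrite disjoint_subset; apply/fintype.subsetP => x.
  by rewrite !inE -ltnNge.
- move=> j jn.
  have jm : (j * N <= m)%N by rewrite leq_mul2r (ltnW jn) orbT.
  have cc : continuous (fun x : 'cV[R]_k => clip K (B x i 0)).
    move=> x; apply: continuous_comp; first exact: (@Bcoord_continuous i).
    exact: clip_continuous.
  exact: (measurable_comp_cV cc (fun i' => eul_meas i' jm)).
- by move=> j jn; apply: bm => // x; rewrite inE => /andP[_ ->].
- by move=> j jn; apply: bm => // x; rewrite inE => /andP[->].
- by move=> j w; exact: clip_norm.
- by move=> j jn; apply: (wiener_incr_sqi hW) => //; exact: ltW.
- by move=> j jn; exact: (wiener_incr_ex1 hW).
- by move=> j jn; rewrite (wiener_incr_ex2 hW) ?jhE// ltW.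
Qed.

End grid.

Lemma eul_cvg : \forall w \ae P, forall j,
  eul N.+1 (j * N.+1) w @[N --> \oo] --> Y (j%:R * h) w.
Proof.
(* The scheme starts at c exactly, which matches Y at time 0 only where W vanishes there. *)
have W0 : \forall w \ae P, forall a, W 0 w a 0 = 0.
  by apply: filter_forall => a; have [/(_ a)[]] := hW.
apply: filterS2 W0 eY => w w0 ew j; apply/cvgrPdist_le => e e0.
have H0 : 0 <= j%:R * h by rewrite mulr_ge0// ltW.
have v0 : W 0 w = 0 by apply/matrixP => a b; rewrite ord1 w0 mxE.
have := @euler_cvg _ _ _ (fun t => Y t w) (fun t => W t w) B S c L L0 LB
  (@cY w) ew (j%:R * h) e H0 e0 v0.
move=> hd; near (0 : R)^'+ => d0.
have d00 : 0 < d0 by near: d0; exact: nbhs_right_gt.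
have hd0 : forall (tau : R) (n : nat), 0 < tau -> tau < d0 ->
    n%:R * tau <= j%:R * h ->
    `|Y (n%:R * tau) w - euler B S c tau
      (fun l => W (l.+1%:R * tau) w - W (l%:R * tau) w) n| <= e.
  by near: d0.
near=> N.
have jN : (j * N.+1)%:R * (h / N.+1%:R) = j%:R * h.
  by rewrite natrM -mulrA [N.+1%:R * _]mulrC divfK// pnatr_eq0.
have := hd0 (h / N.+1%:R) (j * N.+1)%N; rewrite jN; apply => //.
  by rewrite divr_gt0.
rewrite -ltr_pdivlMl// mulrC; near: N.
exact: near_infty_natSinv_lt (PosNum (divr_gt0 d00 h0)).
Unshelve. all: by end_near. Qed.

Definition drift_sum (i : 'I_k) (a : 'I_r) w := \sum_(j < n) B (Y (j%:R * h) w) i 0 *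
  (W (j.+1%:R * h) w a 0 - W (j%:R * h) w a 0).

Let jh (j : nat) : 0 <= j%:R * h. Proof. by rewrite mulr_ge0// ltW. Qed.

Let mBY (j : nat) i : measurable_fun setT (fun w => B (Y (j%:R * h) w) i 0).
Proof.
by have [[]] := drift_sqi i (jh j).
Qed.

Let mdW (j : nat) a :
  measurable_fun setT (fun w => W (j.+1%:R * h) w a 0 - W (j%:R * h) w a 0).
Proof. exact: (wiener_incr_meas hW). Qed.

Let csum K (i : 'I_k) (a : 'I_r) w := \sum_(j < n)
  clip K (B (Y (j%:R * h) w) i 0) * (W (j.+1%:R * h) w a 0 - W (j%:R * h) w a 0).

Let clip_comp K (f : T -> R) : measurable_fun setT f ->
  measurable_fun setT (fun w => clip K (f w)).
Proof.
move=> mf; apply: measurableT_comp mf.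
by apply: continuous_measurable_fun; exact: clip_continuous.
Qed.

Let mcsum K i a : measurable_fun setT (csum K i a).
Proof.
have h1 (j : 'I_n) : measurable_fun setT (fun w =>
    clip K (B (Y (j%:R * h) w) i 0) * (W (j.+1%:R * h) w a 0 - W (j%:R * h) w a 0)).
  by apply: measurable_funM; [exact: clip_comp|exact: mdW].
exact: (measurable_sum _ h1).
Qed.

(** As the Euler grid is refined, the second moments of the coefficients converge by boundedness,
    and Fatou's lemma carries the bound to the sum built on Y. *)
Lemma clipped_orthogonal K i a : 0 <= K ->
  itg P (fun w => csum K i a w ^+ 2) /\
  ex P (fun w => csum K i a w ^+ 2) <= n%:R * h * MB.
Proof.
move=> K0.
pose b N := \sum_(j < n) ex P (fun w => clip K (B (eul N.+1 (j * N.+1) w) i 0) ^+ 2) * h.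
pose X N w := \sum_(j < n) clip K (B (eul N.+1 (j * N.+1) w) i 0) *
    (W (j.+1%:R * h) w a 0 - W (j%:R * h) w a 0).
have hX N : sqi P (X N) /\ ex P (fun w => X N w ^+ 2) = b N.
  exact: euler_orthogonal.
have cc : continuous (fun x : 'cV[R]_k => clip K (B x i 0)).
  move=> x; apply: continuous_comp; first exact: (@Bcoord_continuous i).
  exact: clip_continuous.
have ce : \forall w \ae P, forall j,
    clip K (B (eul N.+1 (j * N.+1) w) i 0) @[N --> \oo] --> clip K (B (Y (j%:R * h) w) i 0).
  apply: filterS eul_cvg => w hw j.
  exact: (@continuous_cvg _ _ _ _ _ _ (fun x : 'cV[R]_k => clip K (B x i 0)) _ (cc _) (hw j)).
have bcvg : b N @[N --> \oo] -->
    \sum_(j < n) ex P (fun w => clip K (B (Y (j%:R * h) w) i 0) ^+ 2) * h.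
  apply: cvg_fsum => j; apply: cvgMl.
  apply: (@ex_bounded_cvg _ _ _ P _ _ (K ^+ 2)).
  - move=> N; apply: measurable_funX.
    have mE l : measurable_fun setT (fun w => eul N.+1 (j * N.+1) w l 0).
      by apply: (@eul_measT N.+1 isT (j * N.+1)%N l); rewrite leq_mul2r (ltnW (ltn_ord j)) orbT.
    exact: (measurable_comp_cV cc mE).
  - by apply: measurable_funX; exact: clip_comp.
  - by move=> N w; rewrite normrX lerXn2r ?nnegrE// ?clip_norm.
  - apply: filterS ce => w hw; rewrite !expr2; under eq_fun do rewrite expr2.
    by apply: cvgM; exact: hw.
have le0 : \sum_(j < n) ex P (fun w => clip K (B (Y (j%:R * h) w) i 0) ^+ 2) * h <=
    n%:R * h * MB.
  apply: (@le_trans _ _ (\sum_(j < n) MB * h)); last first.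
    by rewrite sumr_const card_ord -[_ *+ _]mulr_natl mulrAC mulrA.
  apply: ler_sum => j _; rewrite ler_wpM2r ?(ltW h0)//.
  have [[_ iB] leB] := drift_sqi i (jh j).
  apply: le_trans leB; apply: ex_le => //.
    apply: (@itg_bounded _ _ _ _ _ (K ^+ 2)).
      by apply: measurable_funX; exact: clip_comp.
    by move=> w; rewrite normrX lerXn2r ?nnegrE// ?clip_norm.
  by move=> w; exact: clip_sqr.
(* [itg_fatou] wants one bound for all indices, so the sequence is shifted to where [b N] exceeds
   its limit by at most e. *)
have fat e : 0 < e -> itg P (fun w => csum K i a w ^+ 2) /\
    ex P (fun w => csum K i a w ^+ 2) <= n%:R * h * MB + e.
  move=> e0.
  have [N0 _ hN0] : \forall N \near \oo, b N <= n%:R * h * MB + e.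
    move/cvgrPdist_lt : bcvg => /(_ _ e0); apply: filterS => N.
    by move=> /ltW; rewrite ler_distlC => /andP[_] /le_trans; apply; rewrite lerD2r.
  apply: (@itg_fatou _ _ _ P (fun N w => X (N + N0)%N w ^+ 2)).
  - by move=> N; have [[]] := hX (N + N0)%N.
  - by move=> N w; exact: sqr_ge0.
  - by move=> N; have [_ ->] := hX (N + N0)%N; apply: hN0; rewrite /= leq_addl.
  - by apply: measurable_funX; exact: mcsum.
  - apply: filterS ce => w hw.
    have h1 : X N w @[N --> \oo] --> csum K i a w.
      by apply: cvg_fsum => j; apply: cvgMl; exact: hw.
    rewrite -(cvg_shiftn N0) in h1.
    by rewrite !expr2; under eq_fun do rewrite expr2; exact: cvgM.
  - by move=> w; exact: sqr_ge0.
split; first by have [] := fat 1 ltr01.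
by apply/ler_addgt0Pr => e e0; have [] := fat e e0.
Qed.

(* The Euler scheme is adapted, and a solution is its limit: this replaces the
   non-anticipation of the solution, which is not assumed. *)
Lemma drift_sum_sqi i a : sqi P (drift_sum i a) /\
  ex P (fun w => drift_sum i a w ^+ 2) <= n%:R * h * MB.
Proof.
have mm : measurable_fun setT (drift_sum i a).
  have h1 (j : 'I_n) : measurable_fun setT (fun w =>
      B (Y (j%:R * h) w) i 0 * (W (j.+1%:R * h) w a 0 - W (j%:R * h) w a 0)).
    by apply: measurable_funM; [exact: mBY|exact: mdW].
  exact: (measurable_sum _ h1).
suff [? ?] : itg P (fun w => drift_sum i a w ^+ 2) /\
    ex P (fun w => drift_sum i a w ^+ 2) <= n%:R * h * MB by [].
apply: (@itg_fatou _ _ _ P (fun K w => csum K%:R i a w ^+ 2)).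
- by move=> K; have [] := clipped_orthogonal i a (ler0n R K).
- by move=> K w; exact: sqr_ge0.
- by move=> K; have [] := clipped_orthogonal i a (ler0n R K).
- exact: measurable_funX.
- apply: aeW => w.
  have h1 : csum K%:R i a w @[K --> \oo] --> drift_sum i a w.
    apply: cvg_fsum => j; apply: cvgMl; apply: cvg_near_cst.
    near=> K; apply: clip_id; near: K.
    exact: nbhs_infty_ger.
  by rewrite !expr2; under eq_fun do rewrite expr2; exact: cvgM.
- by move=> w; exact: sqr_ge0.
Unshelve. all: by end_near. Qed.

End martingale_part.

Variables (p : nat) (C : 'M[R]_(p, k)).
Local Notation A := (C *m S).

(** * Size of the remainder of the realized covariance *)

Section remainder.
Variables (h : R) (n : nat).
Hypothesis h0 : 0 < h.
Hypothesis h1 : h <= 1.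
Hypothesis n0 : (0 < n)%N.

Let D j i w := Dr (j%:R * h) (j.+1%:R * h) i w.
Let dW j a w := W (j.+1%:R * h) w a 0 - W (j%:R * h) w a 0.

Let jh (j : nat) : 0 <= j%:R * h. Proof. by rewrite mulr_ge0// ltW. Qed.
Let jh1 (j : nat) : j%:R * h <= j.+1%:R * h.
Proof. by rewrite ler_wpM2r ?(ltW h0)// ler_nat. Qed.
Let jhE (j : nat) : j.+1%:R * h - j%:R * h = h.
Proof. by rewrite -natr1; ring. Qed.

Let sD j i : sqi P (D j i) /\ ex P (fun w => D j i w ^+ 2) <= h ^+ 2 * MB.
Proof.
have := Dr_sqi i (jh j) (jh1 j).
by rewrite jhE.
Qed.

Let sW j a : sqi P (dW j a) /\ ex P (fun w => dW j a w ^+ 2) = h.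
Proof.
have s := wiener_incr_sqi hW a (jh j) (jh1 j).
by split => //; have := wiener_incr_ex2 hW a (jh j) (jh1 j); rewrite jhE.
Qed.

Lemma drift_drift i i' : let X w := \sum_(j < n) D j i w * D j i' w in
  itg P X /\ ex P (fun w => `|X w|) <= n%:R * (h ^+ 2 * (2 * MB)).
Proof.
rewrite /=.
have hX (j : 'I_n) : itg P (fun w => D j i w * D j i' w) /\
    ex P (fun w => `|D j i w * D j i' w|) <= h ^+ 2 * (2 * MB).
  have [s1 e1] := sD j i; have [s2 e2] := sD j i'.
  split; first exact: sqi_itgM.
  apply: (le_trans (ex_normM_le ltr01 s1 s2)).
  by rewrite invr1 !mul1r (le_trans (lerD e1 e2))// mulrCA mulr_natl mulr2n.
have [] := ex_lin_le (fun=> 1) hX.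
under eq_fun do under eq_bigr do rewrite mul1r.
under [X in ex P X <= _ -> _]eq_fun do under eq_bigr do rewrite mul1r.
by move=> iX; rewrite normr1 sumr_const card_ord; split.
Qed.

(** The drift is split into its value at the left end point and a linearisation error. The error is
    of order h^2 per step; the main part is h times an orthogonal sum, of order h sqrt (n h), where
    termwise estimates would give n h^(3/2). *)
Lemma drift_wiener i a : let X w := \sum_(j < n) D j i w * dW j a w in
  itg P X /\ ex P (fun w => `|X w|) <=
    n%:R * (h ^+ 2 * (CD + 1)) + h * (Num.sqrt (n%:R * h) * (1 + MB)).
Proof.
pose D' j w := D j i w - h * B (Y (j%:R * h) w) i 0.
have sD' j : sqi P (D' j) /\ ex P (fun w => D' j w ^+ 2) <= h ^+ 2 * (CD * h).
  have := Dr_linear i (jh j) (jh1 j).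
  by rewrite jhE; exact.
have hX (j : 'I_n) : itg P (fun w => D' j w * dW j a w) /\
    ex P (fun w => `|D' j w * dW j a w|) <= h ^+ 2 * (CD + 1).
  have [s1 e1] := sD' j; have [s2 e2] := sW j a.
  split; first exact: sqi_itgM.
  (* The weight 1/h balances second moments of orders h^3 and h. *)
  have hi : 0 < h^-1 by rewrite invr_gt0.
  apply: (le_trans (ex_normM_le hi s1 s2)).
  rewrite e2 invrK mulrDr mulr1 -expr2 lerD2r.
  apply: (le_trans (ler_wpM2l (ltW hi) e1)).
  set z := CD; rewrite (_ : h^-1 * _ = h ^+ 2 * z)//.
  by field; rewrite gt_eqF.
have [i1] := ex_lin_le (fun=> 1) hX.
have [sm em] := drift_sum_sqi n h0 i a.
set ms := drift_sum _ _ _ _ in sm em.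
have XE w : \sum_(j < n) D j i w * dW j a w = \sum_(j < n) 1 * (D' j w * dW j a w) + h * ms w.
  rewrite /ms /drift_sum mulr_sumr -big_split/=; apply: eq_bigr => j _.
  by rewrite /D' /dW; ring.
have nh : 0 < Num.sqrt (n%:R * h) by rewrite sqrtr_gt0 mulr_gt0// ltr0n.
have im := sqi_itg sm.
have em' : ex P (fun w => `|ms w|) <= Num.sqrt (n%:R * h) * (1 + MB).
  set s := Num.sqrt _ in nh *.
  have ni : 0 < s^-1 by rewrite invr_gt0.
  apply: (le_trans (ex_norm_le ni sm)); rewrite invrK mulrDr mulr1 addrC lerD2l.
  apply: (le_trans (ler_wpM2l (ltW ni) em)).
  have -> : n%:R * h = s ^+ 2 by rewrite sqr_sqrtr// mulr_ge0// ltW.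
  by rewrite expr2 -!mulrA mulKf ?gt_eqF.
move=> e1 /=; split.
  by under eq_fun do rewrite XE; apply: itgD => //; exact: itgZ.
apply: (@le_trans _ _ (ex P (fun w => `|\sum_(j < n) 1 * (D' j w * dW j a w)| + h * `|ms w|))).
  apply: ex_le.
  - by apply: itg_norm; under eq_fun do rewrite XE; apply: itgD => //; exact: itgZ.
  - by apply: itgD; [exact: itg_norm|apply: itgZ; exact: itg_norm].
  - by move=> w; rewrite XE (le_trans (ler_normD _ _))// normrM gtr0_norm.
rewrite exD; [|exact: itg_norm|by apply: itgZ; exact: itg_norm].
rewrite exZ; last exact: itg_norm.
apply: lerD; last by rewrite ler_wpM2l// ltW.
by rewrite (le_trans e1)// normr1 sumr_const card_ord.
Qed.

Lemma increment_expand j a w :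
  (C *m (Y (j.+1%:R * h) w - Y (j%:R * h) w)) a 0 =
  \sum_i C a i * D j i w + \sum_b A a b * dW j b w.
Proof.
have -> : Y (j.+1%:R * h) w - Y (j%:R * h) w =
    \col_i D j i w + S *m \col_b dW j b w.
  apply/matrixP => i z; rewrite ord1 !mxE /D /Dr.
  rewrite (_ : S *m (_ - _) = S *m \col_b dW j b w); last first.
    by congr (_ *m _); apply/matrixP => u v; rewrite ord1 !mxE.
  by rewrite [in RHS]mxE subrK.
rewrite mulmxDr mulmxA mxE [(C *m _) _ _]mxE [(C *m S *m _) _ _]mxE; congr (_ + _).
  by apply: eq_bigr => i _; rewrite mxE.
by apply: eq_bigr => i _; rewrite [(\col_b _) _ _]mxE.
Qed.

(** An entry of the realized covariance of C Y minus that of the noise part A W, before centring. *)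
Definition rcov_rem a b w := (n%:R * h)^-1 *
  ((\sum_(j < n) (C *m (Y (j.+1%:R * h) w - Y (j%:R * h) w)) a 0 *
      (C *m (Y (j.+1%:R * h) w - Y (j%:R * h) w)) b 0) -
   \sum_(j < n) (A *m (W (j.+1%:R * h) w - W (j%:R * h) w)) a 0 *
      (A *m (W (j.+1%:R * h) w - W (j%:R * h) w)) b 0).

Definition Crem a b :=
  (\sum_(x : 'I_k * 'I_k) `|C a x.1 * C b x.2|) * (2 * MB) +
  (\sum_(x : 'I_k * 'I_r) `|C a x.1 * A b x.2 + C b x.1 * A a x.2|) *
    (CD + 1 + (1 + MB)).

Lemma rcov_remE a b w : rcov_rem a b w = (n%:R * h)^-1 *
  (\sum_(x : 'I_k * 'I_k) (C a x.1 * C b x.2) * \sum_(j < n) D j x.1 w * D j x.2 w +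
   \sum_(x : 'I_k * 'I_r) (C a x.1 * A b x.2 + C b x.1 * A a x.2) *
     \sum_(j < n) D j x.1 w * dW j x.2 w).
Proof.
rewrite /rcov_rem; congr (_ * _).
rewrite -sumrB.
under [X in _ = X + _]eq_bigr do rewrite mulr_sumr.
under [X in _ = _ + X]eq_bigr do rewrite mulr_sumr.
rewrite [X in _ = X + _]exchange_big [X in _ = _ + X]exchange_big -big_split/=.
apply: eq_bigr => j _; rewrite !increment_expand.
have AE e : (A *m (W (j.+1%:R * h) w - W (j%:R * h) w)) e 0 = \sum_b A e b * dW j b w.
  by rewrite mxE; apply: eq_bigr => z _; rewrite !mxE.
rewrite !AE.
have prodE (I J : finType) (u : I -> R) (v : J -> R) :
    (\sum_i u i) * (\sum_j v j) = \sum_(x : I * J) u x.1 * v x.2.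
  by rewrite big_distrlr/= pair_bigA.
set u := \sum_i C a i * _; set u' := \sum_i C b i * _.
set v := \sum_b _ * dW _ _ _; set v' := \sum_b _ * dW _ _ _.
have -> : (u + v) * (u' + v') - v * v' = u * u' + (u * v' + u' * v) by ring.
rewrite !prodE -big_split/=; congr (_ + _); apply: eq_bigr => x _; ring.
Qed.

(** Division by n h turns n h^2 into h and h sqrt (n h) into sqrt (h / n). *)
Lemma rcov_rem_le a b : itg P (rcov_rem a b) /\
  ex P (fun w => `|rcov_rem a b w|) <= Crem a b * (h + Num.sqrt (h / n%:R)).
Proof.
have nh : 0 < n%:R * h by rewrite mulr_gt0// ltr0n.
have [i1 e1] := ex_lin_le (fun x : 'I_k * 'I_k => C a x.1 * C b x.2)
  (fun x => drift_drift x.1 x.2).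
have [i2 e2] := ex_lin_le (fun x : 'I_k * 'I_r => C a x.1 * A b x.2 + C b x.1 * A a x.2)
  (fun x => drift_wiener x.1 x.2).
set U := (fun w => \sum_x _) in i1; set V := (fun w => \sum_x _) in i2.
have iR : itg P (fun w => (n%:R * h)^-1 * (U w + V w)) by apply: itgZ; exact: itgD.
have -> : rcov_rem a b = fun w => (n%:R * h)^-1 * (U w + V w) by apply/funext => w; exact: rcov_remE.
split => //.
apply: (@le_trans _ _ (ex P (fun w => (n%:R * h)^-1 * (`|U w| + `|V w|)))).
  apply: ex_le; first exact: itg_norm.
    by apply: itgZ; apply: itgD; exact: itg_norm.
  by move=> w; rewrite normrM gtr0_norm ?invr_gt0// ler_pM2l ?invr_gt0// ler_normD.
rewrite exZ; last by apply: itgD; exact: itg_norm.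
rewrite exD; [|exact: itg_norm|exact: itg_norm].
rewrite mulrC ler_pdivrMr//.
apply: (le_trans (lerD e1 e2)).
set c1 := \sum_x _; set c2 := \sum_(x : 'I_k * 'I_r) _.
have c10 : 0 <= c1 by apply: sumr_ge0.
have c20 : 0 <= c2 by apply: sumr_ge0.
have mb0 : 0 <= MB by exact: MB_ge0.
have cd0 : 0 <= CD by rewrite mulr_ge0 ?sqr_ge0// mulr_ge0 ?ler0n// CY_ge0.
have -> : h * (Num.sqrt (n%:R * h) * (1 + MB)) = n%:R * h * (Num.sqrt (h / n%:R) * (1 + MB)).
  have n1 : 0 < (n%:R : R) by rewrite ltr0n.
  rewrite (_ : n%:R * h = n%:R ^+ 2 * (h / n%:R)); last by field; rewrite gt_eqF.
  rewrite sqrtrM ?sqr_ge0// sqrtr_sqr ger0_norm ?(ltW n1)//.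
  by field; rewrite gt_eqF.
set q := Num.sqrt (h / n%:R).
have q0 : 0 <= q by exact: sqrtr_ge0.
rewrite /Crem -/c1 -/c2 -subr_ge0.
(* A single constant for both rates overcounts by these nonnegative terms. *)
rewrite (_ : _ - _ = n%:R * h * (c1 * (2 * MB) * q + c2 * ((1 + MB) * h + (CD + 1) * q))).
  have hh := ltW h0.
  rewrite mulr_ge0 ?(ltW nh)// addr_ge0//; first by rewrite !mulr_ge0.
  by rewrite mulr_ge0// addr_ge0// mulr_ge0// addr_ge0.
by ring.
Qed.

End remainder.

Variable X : R -> T -> 'cV[R]_p.
Hypothesis hX : forall t w, 0 <= t -> X t w = C *m Y t w.
Local Notation Sigma := (A *m A^T).

Lemma realized_covE h n w : 0 < h -> realized_cov X h n w =
  (n%:R * h)^-1 *: \sum_(j < n)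
    (C *m (Y (j.+1%:R * h) w - Y (j%:R * h) w)) *m
    (C *m (Y (j.+1%:R * h) w - Y (j%:R * h) w))^T.
Proof.
move=> h0; have jh (j : nat) : 0 <= j%:R * h by rewrite mulr_ge0// ltW.
rewrite /realized_cov big_add1/= big_mkord; congr (_ *: _); apply: eq_bigr => j _.
by rewrite !hX// mulmxBr.
Qed.

Lemma realized_cov_meas h n a b : 0 < h ->
  measurable_fun setT (fun w => realized_cov X h n w a b).
Proof.
move=> h0; have jh (j : nat) : 0 <= j%:R * h by rewrite mulr_ge0// ltW.
have mC j e : measurable_fun setT
    (fun w => (C *m (Y (j.+1%:R * h) w - Y (j%:R * h) w)) e 0).
  rewrite (_ : (fun w => _) = fun w =>
    \sum_i C e i * (Y (j.+1%:R * h) w i 0 - Y (j%:R * h) w i 0)); last first.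
    by apply/funext => w; rewrite mxE; apply: eq_bigr => i _; rewrite !mxE.
  have hi (i : 'I_k) : measurable_fun setT
      (fun w => C e i * (Y (j.+1%:R * h) w i 0 - Y (j%:R * h) w i 0)).
    apply: measurable_funM; first exact: measurable_cst.
    by apply: measurable_funB; exact: mY.
  exact: (measurable_sum _ hi).
rewrite (_ : (fun w => _) = fun w => (n%:R * h)^-1 * \sum_(j < n)
    (C *m (Y (j.+1%:R * h) w - Y (j%:R * h) w)) a 0 *
    (C *m (Y (j.+1%:R * h) w - Y (j%:R * h) w)) b 0); last first.
  apply/funext => w; rewrite realized_covE// mxE summxE; congr (_ * _).
  by apply: eq_bigr => j _; rewrite mxE big_ord1 [(_^T) _ _]mxE.
apply: measurable_funM; first exact: measurable_cst.
have hj (j : 'I_n) := measurable_funM (mC j a) (mC j b).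
exact: (measurable_sum _ hj).
Qed.

Section step.
Variables (h : R) (n : nat).
Hypothesis h0 : 0 < h.
Hypothesis h1 : h <= 1.
Hypothesis n0 : (0 < n)%N.
Local Notation Q := (realized_cov X h n).

Let remmx w : 'M[R]_p := \matrix_(a, b) rcov_rem h n a b w.

Let zvec j w : 'cV[R]_r := \col_a nincr W h j a w.

Lemma realized_cov_sym w : (Q w - Sigma)^T = Q w - Sigma.
Proof.
rewrite linearB/= /realized_cov linearZ/= linear_sum/=; congr (_ *: _ - _).
  by apply: eq_bigr => j _; rewrite trmx_mul trmxK.
by rewrite trmx_mul trmxK.
Qed.

Let sh0 : 0 < Num.sqrt h. Proof. by rewrite sqrtr_gt0. Qed.
Let nR : 0 < n%:R :> R. Proof. by rewrite ltr0n. Qed.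

Lemma realized_cov_split w : Q w - Sigma =
  A *m (n%:R^-1 *: (\sum_(j < n) (zvec j w *m (zvec j w)^T - 1%:M))) *m A^T + remmx w.
Proof.
have jh (j : nat) : 0 <= j%:R * h by rewrite mulr_ge0// ltW.
have dWE j : W (j.+1%:R * h) w - W (j%:R * h) w = Num.sqrt h *: zvec j w.
  apply/matrixP => a z; rewrite ord1 !mxE mulrA divff ?mul1r// gt_eqF//.
have QE := @realized_covE h n w h0.
have remE : remmx w = Q w - (n%:R * h)^-1 *: \sum_(j < n)
    (A *m (Num.sqrt h *: zvec j w)) *m (A *m (Num.sqrt h *: zvec j w))^T.
  rewrite QE -scalerBr; apply/matrixP => a b; rewrite mxE /rcov_rem !mxE !summxE.
  congr (_ * (_ - _)); apply: eq_bigr => j _; rewrite [RHS]mxE big_ord1 ?dWE.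
    by rewrite [(_^T) _ _]mxE.
  by rewrite [(_^T) _ _]mxE.
have main : A *m (n%:R^-1 *: (\sum_(j < n) (zvec j w *m (zvec j w)^T - 1%:M))) *m A^T =
    (n%:R * h)^-1 *: (\sum_(j < n)
      (A *m (Num.sqrt h *: zvec j w)) *m (A *m (Num.sqrt h *: zvec j w))^T) - Sigma.
  rewrite sumrB sumr_const card_ord scalerBr -[1%:M *+ n]scaler_nat scalerA mulVf ?gt_eqF//.
  rewrite scale1r mulmxBr mulmxBl mulmx1; congr (_ - _).
  rewrite -scalemxAr -scalemxAl mulmx_sumr mulmx_suml !scaler_sumr; apply: eq_bigr => j _.
  rewrite -scalemxAr linearZ/= -scalemxAl -scalemxAr !scalerA [(A *m zvec j w)^T]trmx_mul !mulmxA.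
  congr (_ *: _); rewrite -mulrA -expr2 sqr_sqrtr ?(ltW h0)// invfM -mulrA mulVf ?mulr1//.
  by rewrite gt_eqF.
by rewrite main remE [RHS]addrC addrA subrK.
Qed.

(** [pairing_conj] moves A onto D, so that A^T D A becomes the matrix of the quadratic forms. *)
Lemma pairing_split (D : 'M[R]_p) w : pairing D (Q w - Sigma) =
  n%:R^-1 * (\sum_(j < n) qblock W (A^T *m D *m A) h j w) + pairing D (remmx w).
Proof.
rewrite realized_cov_split.
have pD (N N' : 'M[R]_p) : pairing D (N + N') = pairing D N + pairing D N'.
  by rewrite /pairing -big_split; apply: eq_bigr => x _; rewrite !mxE mulrDr.
rewrite pD pairing_conj; congr (_ + _).
rewrite /pairing.
have e (x : 'I_r * 'I_r) :
    (n%:R^-1 *: (\sum_(j < n) (zvec j w *m (zvec j w)^T - 1%:M))) x.1 x.2 =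
    n%:R^-1 * \sum_(j < n) (nincr W h j x.1 w * nincr W h j x.2 w - (x.1 == x.2)%:R).
  rewrite mxE summxE; congr (_ * _); apply: eq_bigr => j _.
  by rewrite !mxE big_ord1 !mxE.
under eq_bigr do rewrite e mulrCA mulr_sumr.
by rewrite -mulr_sumr exchange_big.
Qed.

Definition Dcrem (D : 'M[R]_p) : R :=
  \sum_(x : 'I_p * 'I_p) `|D x.1 x.2| * Crem x.1 x.2.

Lemma pairing_rem_le (D : 'M[R]_p) : itg P (fun w => pairing D (remmx w)) /\
  ex P (fun w => `|pairing D (remmx w)|) <= Dcrem D * (h + Num.sqrt (h / n%:R)).
Proof.
have hx (x : 'I_p * 'I_p) := rcov_rem_le h0 h1 n0 x.1 x.2.
have e w : pairing D (remmx w) = \sum_x D x.1 x.2 * rcov_rem h n x.1 x.2 w.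
  by apply: eq_bigr => x _; rewrite mxE.
have ix (x : 'I_p * 'I_p) : itg P (fun w => D x.1 x.2 * rcov_rem h n x.1 x.2 w).
  by apply: itgZ; have [] := hx x.
have iP : itg P (fun w => pairing D (remmx w)).
  by under eq_fun do rewrite e; apply: itg_sum => x _.
split => //.
have ia (x : 'I_p * 'I_p) : itg P (fun w => `|D x.1 x.2| * `|rcov_rem h n x.1 x.2 w|).
  by apply: itgZ; apply: itg_norm; have [] := hx x.
apply: (@le_trans _ _ (ex P (fun w => \sum_x `|D x.1 x.2| * `|rcov_rem h n x.1 x.2 w|))).
  apply: ex_le; [exact: itg_norm|by apply: itg_sum => x _|].
  move=> w; rewrite e; apply: (le_trans (ler_norm_sum _ _ _)).
  by apply: ler_sum => x _; rewrite normrM.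
rewrite ex_sum// /Dcrem mulr_suml; apply: ler_sum => x _.
have [i1 e1] := hx x; rewrite exZ; last exact: itg_norm.
by rewrite -mulrA ler_wpM2l.
Qed.

Let Dq (D : 'M[R]_p) := A^T *m D *m A.

Let Dq_sym D : D^T = D -> (Dq D)^T = Dq D.
Proof. by move=> DT; rewrite /Dq [LHS]trmx_mul [(A^T *m D)^T]trmx_mul trmxK DT mulmxA. Qed.

(** One L1 bound with two uses: with Markov's inequality it gives consistency, and multiplied by
    sqrt n it gives tightness. *)
Lemma pairing_le (D : 'M[R]_p) : D^T = D -> itg P (fun w => pairing D (Q w - Sigma)) /\
  ex P (fun w => `|pairing D (Q w - Sigma)|) <=
    (qvar (Dq D) + 1) / Num.sqrt n%:R + Dcrem D * (h + Num.sqrt (h / n%:R)).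
Proof.
move=> DT; have qT := Dq_sym DT.
have [ir er] := pairing_rem_le D.
pose V w := n%:R^-1 * (\sum_(j < n) qblock W (Dq D) h j w).
have aV : allm P V.
  apply: allmM; first exact: allm_cst.
  by apply: allm_sum => j; exact: (qblock_allm hW).
have sV : sqi P V by have := allm_sqi 1 aV; under eq_fun do rewrite expr1.
have iV := sqi_itg sV.
have e w : pairing D (Q w - Sigma) = V w + pairing D (remmx w) by exact: pairing_split.
have s0 : 0 < Num.sqrt n%:R :> R by rewrite sqrtr_gt0.
have eV : ex P (fun w => `|V w|) <= (qvar (Dq D) + 1) / Num.sqrt n%:R.
  apply: (le_trans (ex_norm_le s0 sV)).
  have -> : ex P (fun w => V w ^+ 2) = qvar (Dq D) / n%:R.
    under eq_fun do rewrite exprMn; rewrite exZ; last first.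
      have := allm_sqi 1 (allm_sum (fun j : 'I_n => qblock_allm hW (Dq D) h0 j)).
      by case; under eq_fun do rewrite expr1.
    rewrite (qblock_sum_ex2 hW n qT h0) -/(qvar _); field.
    by rewrite gt_eqF.
  rewrite mulrDl mul1r lerD2r -{2}(sqr_sqrtr (ltW nR)) le_eqVlt; apply/orP; left.
  by apply/eqP; field; rewrite gt_eqF.
have iT : itg P (fun w => V w + pairing D (remmx w)) by exact: itgD.
have -> : (fun w => pairing D (Q w - Sigma)) = fun w => V w + pairing D (remmx w).
  exact/funext.
split => //; under eq_fun do rewrite e.
apply: (@le_trans _ _ (ex P (fun w => `|V w| + `|pairing D (remmx w)|))).
  apply: ex_le; [exact: itg_norm|by apply: itgD; exact: itg_norm|].
  by move=> w; exact: ler_normD.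
by rewrite exD; [exact: lerD|exact: itg_norm..].
Qed.

(** Since cos is 1-Lipschitz, the remainder costs sqrt n times its L1 norm; the rest is
    [qblock_clt]. *)
Lemma pairing_cos (D : 'M[R]_p) (a : 'I_r) t : D^T = D ->
  `|ex P (fun w => cos (Num.sqrt n%:R * pairing D (Q w - Sigma) + t)) -
    ex P (fun w => cos (W (qvar (Dq D)) w a 0 - W 0 w a 0 + t))| <=
  Dcrem D * (Num.sqrt n%:R * h + Num.sqrt h) +
  2 * (2 * (quad4 (Dq D) + 3 * qvar (Dq D) ^+ 2) + qvar (Dq D)) / Num.sqrt n%:R.
Proof.
move=> DT; have qT := Dq_sym DT.
have [ir er] := pairing_rem_le D.
set s := Num.sqrt n%:R; have s0 : 0 < s by rewrite sqrtr_gt0.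
have s2 : s ^+ 2 = n%:R by rewrite sqr_sqrtr// ltW.
pose V w := s^-1 * (\sum_(j < n) qblock W (Dq D) h j w).
have e w : s * pairing D (Q w - Sigma) = V w + s * pairing D (remmx w).
  rewrite pairing_split mulrDr; congr (_ + _); rewrite mulrA /V; congr (_ * _).
  by rewrite -s2; field; rewrite gt_eqF.
have mV : measurable_fun setT V.
  have [] : allm P V.
    apply: allmM; first exact: allm_cst.
    by apply: allm_sum => j; exact: (qblock_allm hW).
  by [].
apply: (le_trans (ler_distD (ex P (fun w => cos (V w + t))) _ _)).
apply: lerD; last exact: (qblock_clt hW qT a h0 n0 t).
have iT : itg P (fun w => s * pairing D (remmx w)) by exact: itgZ.
have i1 := cos_itg P t mV.
have i2 : itg P (fun w => cos (s * pairing D (Q w - Sigma) + t)).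
  apply: cos_itg; under eq_fun do rewrite e.
  by apply: measurable_funD => //; exact: itg_meas iT.
rewrite -exB//; apply: (le_trans (ex_norm (itgB i2 i1))).
apply: (@le_trans _ _ (ex P (fun w => s * `|pairing D (remmx w)|))).
  apply: ex_le; [by apply: itg_norm; exact: itgB|by apply: itgZ; exact: itg_norm|].
  move=> w; apply: (le_trans (cos_lipschitz _ _)).
  rewrite e (_ : _ - _ = s * pairing D (remmx w)); last by ring.
  by rewrite normrM gtr0_norm.
rewrite exZ; last exact: itg_norm.
apply: (le_trans (ler_wpM2l (ltW s0) er)); rewrite mulrCA.
rewrite le_eqVlt; apply/orP; left; apply/eqP; congr (_ * _).
rewrite mulrDr; congr (_ + _).
rewrite /s -sqrtrM ?ler0n//; congr Num.sqrt; field.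
by rewrite gt_eqF.
Qed.

End step.

(** * Consistency and asymptotic normality *)

Section asymptotics.
Variable h : nat -> R.
Hypothesis hpos : forall n, 0 < h n.
Hypothesis hcvg : h n @[n --> \oo] --> 0.
Local Notation Q n := (realized_cov X (h n) n).
Local Notation Dq D := (A^T *m D *m A).

Let near_step : \forall n \near \oo, h n <= 1 /\ (0 < n)%N.
Proof.
near=> n; split; last by near: n; exact: nbhs_infty_gt.
apply: (le_trans (ler_norm _)); rewrite -[h n]subr0 -normrN opprB.
by near: n; move/cvgrPdist_le : hcvg; apply.
Unshelve. all: by end_near. Qed.

Let le_pairing n (D : 'M[R]_p) (n1 : h n <= 1 /\ (0 < n)%N) (DT : D^T = D) :=
  pairing_le (hpos n) n1.1 n1.2 DT.

Let le_cos n (D : 'M[R]_p) a t (n1 : h n <= 1 /\ (0 < n)%N) (DT : D^T = D) :=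
  pairing_cos (hpos n) n1.1 n1.2 a t DT.

Let entry_pairing n w a b : (Q n w - Sigma) a b = pairing (symdelta R a b) (Q n w - Sigma).
Proof. by rewrite pairing_symdelta// realized_cov_sym. Qed.

Let bnd (D : 'M[R]_p) n := (qvar (Dq D) + 1) * (Num.sqrt n%:R)^-1 +
  Dcrem D * (h n + Num.sqrt (h n * n%:R^-1)).

Let bnd_cvg D : bnd D n @[n --> \oo] --> 0.
Proof.
suff : bnd D n @[n --> \oo] --> (qvar (Dq D) + 1) * 0 + Dcrem D * (0 + 0).
  by rewrite addr0 !mulr0 addr0.
apply: cvgD; first by apply: cvgMr; exact: cvg_inv_sqrtn.
apply: cvgMr; apply: cvgD => //; apply: cvg_sqrt0.
by rewrite -(mulr0 0); apply: cvgM => //; exact: cvg_invn.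
Qed.

Lemma realized_cov_cvg : cvg_in_probability P \oo (fun n => Q n) Sigma.
Proof.
move=> e e0.
pose E n (x : 'I_p * 'I_p) w := (Q n w - Sigma) x.1 x.2.
pose b n := \sum_(x : 'I_p * 'I_p) bnd (symdelta R x.1 x.2) n.
have b0 : b n @[n --> \oo] --> 0.
  have := cvg_fsum (fun x : 'I_p * 'I_p => bnd_cvg (symdelta R x.1 x.2)).
  by rewrite big1.
have mE n x : measurable_fun setT (E n x).
  rewrite (_ : E n x = fun w => Q n w x.1 x.2 + (- Sigma x.1 x.2)).
    by apply: measurable_funD; [exact: realized_cov_meas|exact: measurable_cst].
  by apply/funext => w; rewrite /E !mxE.
(* The sup norm is attained at an entry; this yields both measurability of the event and the
   reduction to entries. *)
have normP n w : (e <= `|Q n w - Sigma|) = [exists x, e <= `|E n x w|].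
  apply/idP/existsP => [|[x] /le_trans]; last by apply; exact: coord_norm_le.
  apply: contraPP => /forallNP H; apply/negP; rewrite -ltNge.
  rewrite -[`|_|]/(mx_norm _) mx_normrE; apply/bigmax_ltP; split => // x _.
  by rewrite ltNge; apply/negP; exact: H.
have ms n : measurable [set w | e <= `|Q n w - Sigma|].
  rewrite (_ : [set _ | _] = \bigcup_(x in [set: 'I_p * 'I_p])
     [set w | e <= `|E n x w|]); last first.
    apply/seteqP; split => w /=; rewrite normP.
      by move=> /existsP[x ex_]; exists x.
    by move=> [x _ ex_]; apply/existsP; exists x.
  apply: fin_bigcup_measurable => // x _.
  have := measurableT_comp (@normr_measurable R setT) (mE n x).
  move=> /(_ measurableT `[e, +oo[%classic (measurable_itv _)); rewrite setTI.
  by congr (measurable _); apply/seteqP; split => w /=; rewrite in_itv/= andbT.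
apply: (@squeeze_cvge _ _ _ _ (fun=> 0%E) _ (fun n => (e^-1 * b n)%:E)); last first.
- apply/cvg_EFin; first exact: nearW.
  by rewrite -(mulr0 e^-1); apply: cvgMr.
- exact: cvg_cst.
near=> n; rewrite measure_ge0/=.
have n1 : h n <= 1 /\ (0 < n)%N by near: n.
have hE x : itg P (E n x) /\ ex P (fun w => `|E n x w|) <= bnd (symdelta R x.1 x.2) n.
  have := le_pairing n1 (symdelta_sym R x.1 x.2).
  rewrite (_ : (fun w => pairing _ _) = E n x); last first.
    by apply/funext => w; rewrite -entry_pairing.
  rewrite (_ : (fun w => `|pairing _ _|) = fun w => `|E n x w|)//.
  by apply/funext => w; rewrite -entry_pairing.
have iS : itg P (fun w => \sum_x `|E n x w|).
  by apply: itg_sum => x _; apply: itg_norm; have [] := hE x.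
apply: (@le_trans _ _ (P [set w | e <= `|\sum_x `|E n x w| |])).
  apply: le_measure; rewrite ?inE//.
    have := measurableT_comp (@normr_measurable R setT) (itg_meas iS).
    move=> /(_ measurableT `[e, +oo[%classic (measurable_itv _)); rewrite setTI.
    by congr (measurable _); apply/seteqP; split => w /=; rewrite in_itv/= andbT.
  move=> w /=; rewrite normP => /existsP[x ex_].
  rewrite ger0_norm ?sumr_ge0// (le_trans ex_)// (bigD1 x)//= lerDl.
  by apply: sumr_ge0.
apply: (le_trans (markov1 e0 iS)); rewrite lee_fin ler_wpM2l ?invr_ge0 ?(ltW e0)//.
have -> : ex P (fun w => `|\sum_x `|E n x w| |) = ex P (fun w => \sum_x `|E n x w|).
  by apply: congr1; apply/funext => w; rewrite ger0_norm// sumr_ge0.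
rewrite ex_sum; last by move=> x _; apply: itg_norm; have [] := hE x.
by apply: ler_sum => x _; have [] := hE x.
Unshelve. all: by end_near. Qed.

Hypothesis nhcvg : n%:R * h n ^+ 2 @[n --> \oo] --> 0.
Variable a0 : 'I_r.
Local Notation Dp := (mpinv (dupmx R p)).

(** An explicit factor of the limit covariance, available because Sigma = A A^T and the Kronecker
    product is multiplicative. *)
Let G := Num.sqrt 2 *: (Dp *m (A *t A)).

Let GG : G *m G^T = 2 *: (Dp *m (Sigma *t Sigma) *m Dp^T).
Proof.
rewrite /G linearZ/= -scalemxAl -scalemxAr scalerA -expr2 sqr_sqrtr//.
by rewrite [(Dp *m _)^T]trmx_mul trmx_tens -[Sigma *t Sigma]tensmx_mul !mulmxA.
Qed.

Let hb : wiener1 P (fun t w => W t w a0 0).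
Proof. by have [/(_ a0)] := hW. Qed.

Let Z n w := Num.sqrt n%:R *: (vech (Q n w) - vech Sigma).

(** Identifies the covariance of the statement with the variance that the replacement argument
    produces. *)
Let var_dual u : (u^T *m (G *m G^T) *m u) 0 0 = qvar (Dq (dual_vech u)).
Proof.
by rewrite GG -scalemxAr -scalemxAl mxE dual_vech_var.
Qed.

Let dot_Z u n w : dot u (Z n w) =
  Num.sqrt n%:R * pairing (dual_vech u) (Q n w - Sigma).
Proof.
rewrite /Z (_ : vech _ - vech _ = vech (Q n w - Sigma)); last first.
  by apply/matrixP => i j; rewrite !mxE.
by rewrite /dot -scalemxAr mxE -/(dot _ _) dot_vech ?realized_cov_sym.
Qed.

Let sqrt_nh n : Num.sqrt (n%:R * h n ^+ 2) = Num.sqrt n%:R * h n.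
Proof. by rewrite sqrtrM ?ler0n// sqrtr_sqr ger0_norm// ltW. Qed.

Let sqrt_nh_cvg : Num.sqrt n%:R * h n @[n --> \oo] --> 0.
Proof.
rewrite (_ : (fun n => _) = fun n => Num.sqrt (n%:R * h n ^+ 2)); last first.
  by apply/funext => n; rewrite sqrt_nh.
exact: cvg_sqrt0.
Qed.

Let Zij (i : 'I_(pbar p)) := tnth (vech_index p) i.

Let Z_coord n w i : Z n w i 0 =
  Num.sqrt n%:R * pairing (symdelta R (Zij i).1 (Zij i).2) (Q n w - Sigma).
Proof. by rewrite -entry_pairing !mxE. Qed.

Let dZ i := symdelta R (Zij i).1 (Zij i).2.

(** Dominates the first absolute moment of coordinate i for all large n and for the limit law; the 2
    bounds sqrt n h + sqrt h once both terms are at most 1. *)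
Let cz i := qvar (Dq (dZ i)) + 1 + `|Dcrem (dZ i)| * 2 +
  ex P (fun w => `|gvec (fun t w => W t w a0 0) G w i 0|).

Let cz_ge0 i : 0 <= cz i.
Proof.
by rewrite !addr_ge0 ?qvar_ge0 ?mulr_ge0// ex_ge0.
Qed.

Let cz_sum i : cz i <= \sum_i cz i.
Proof. by rewrite (bigD1 i)//= lerDl sumr_ge0. Qed.

Let Z_cvg : cvg_in_distribution P Z (gvec_law hb G).
Proof.
apply: (@cvg_in_distribution_cos _ _ _ _ _ _ _ (\sum_i cz i)).
- move=> n i; rewrite (_ : (fun w => _) = fun w =>
    Num.sqrt n%:R * (Q n w (Zij i).1 (Zij i).2 + (- Sigma (Zij i).1 (Zij i).2))).
    apply: measurable_funM; first exact: measurable_cst.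
    by apply: measurable_funD; [exact: realized_cov_meas|exact: measurable_cst].
  by apply/funext => w; rewrite !mxE.
- near=> n => i.
  have n1 : h n <= 1 /\ (0 < n)%N by near: n.
  have nh1 : Num.sqrt n%:R * h n <= 1.
    apply: (le_trans (ler_norm _)); rewrite -[X in `|X|]subr0 -normrN opprB.
    by near: n; move/cvgrPdist_le : sqrt_nh_cvg; apply.
  have [iD eD] := le_pairing n1 (symdelta_sym R (Zij i).1 (Zij i).2).
  rewrite -/(dZ i) in iD eD.
  have s0 : 0 < Num.sqrt n%:R :> R by rewrite sqrtr_gt0 ltr0n n1.2.
  have -> : (fun w => Z n w i 0) =
      fun w => Num.sqrt n%:R * pairing (dZ i) (Q n w - Sigma).
    by apply/funext => w; exact: Z_coord.
  split; first exact: itgZ.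
  rewrite (_ : (fun w => `|Z n w i 0|) =
      fun w => Num.sqrt n%:R * `|pairing (dZ i) (Q n w - Sigma)|); last first.
    by apply/funext => w; rewrite Z_coord normrM gtr0_norm.
  rewrite exZ; last exact: itg_norm.
  apply: le_trans (cz_sum i); rewrite /cz; apply: (@le_trans _ _
    (qvar (Dq (dZ i)) + 1 + `|Dcrem (dZ i)| * 2)); last by rewrite lerDl ex_ge0.
  apply: (le_trans (ler_wpM2l (ltW s0) eD)); rewrite mulrDr; apply: lerD.
    by rewrite mulrC divfK// gt_eqF.
  rewrite mulrCA; apply: (@le_trans _ _ (`|Dcrem (dZ i)| *
    (Num.sqrt n%:R * (h n + Num.sqrt (h n / n%:R))))).
    rewrite ler_wpM2r ?ler_norm// mulr_ge0 ?(ltW s0)// addr_ge0 ?sqrtr_ge0//.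
    exact: ltW.
  rewrite ler_wpM2l// mulrDr (_ : 2 = 1 + 1 :> R) ?lerD//.
  rewrite -sqrtrM ?ler0n// mulrCA divff ?mulr1; last by rewrite pnatr_eq0 -lt0n n1.2.
  by rewrite -[leRHS]sqrtr1 ler_wsqrtr// n1.1.
- move=> i; have [i1 ->] := gvec_law_coord hb G i; split => //.
  apply: le_trans (cz_sum i); rewrite /cz lerDr.
  by rewrite !addr_ge0 ?qvar_ge0 ?mulr_ge0.
- move=> u t; rewrite gvec_law_cos var_dual.
  pose K := 2 * (2 * (quad4 (Dq (dual_vech u)) + 3 * qvar (Dq (dual_vech u)) ^+ 2) +
    qvar (Dq (dual_vech u))).
  apply: (@cvg_dist_le _ _ (fun n => Dcrem (dual_vech u) * (Num.sqrt n%:R * h n + Num.sqrt (h n)) +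
    K * (Num.sqrt n%:R)^-1)).
    near=> n; have n1 : h n <= 1 /\ (0 < n)%N by near: n.
    have := le_cos a0 t n1 (dual_vech_sym u).
    rewrite (_ : (fun w => cos (dot u (Z n w) + t)) = fun w =>
      cos (Num.sqrt n%:R * pairing (dual_vech u) (Q n w - Sigma) + t))//.
    by apply/funext => w; rewrite dot_Z.
  rewrite [X in _ --> X](_ : 0 = Dcrem (dual_vech u) * (0 + 0) + K * 0); last first.
    by rewrite addr0 !mulr0 addr0.
  apply: cvgD; last by apply: cvgMr; exact: cvg_inv_sqrtn.
  by apply: cvgMr; apply: cvgD => //; exact: cvg_sqrt0.
Unshelve. all: by end_near. Qed.

Lemma realized_cov_clt : exists2 mu : probability (borel_cV R (pbar p)) R,
  gaussian_law mu 0 (2 *: (Dp *m (Sigma *t Sigma) *m Dp^T)) &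
  cvg_in_distribution P
    (fun n w => Num.sqrt n%:R *: (vech (Q n w) - vech Sigma)) mu.
Proof.
by exists (gvec_law hb G); [rewrite -GG; exact: gvec_gaussian|exact: Z_cvg].
Qed.

End asymptotics.

End diffusion.

(** * Stacking the latent processes *)

Section coordinates.
Variables (d : measure_display) (T : measurableType d) (R : realType).
Variable P : probability T R.
Local Notation mu := (@lebesgue_measure R).

(** The coordinatewise data that the estimates for a single diffusion take as hypotheses, in a form
    that is stable under stacking. *)
Definition coord_sde (k r : nat) (W : R -> T -> 'cV[R]_r)
    (B : 'cV[R]_k -> 'cV[R]_k) (S : 'M[R]_(k, r)) (c : 'cV[R]_k)
    (Y : R -> T -> 'cV[R]_k) (L M : R) :=
  [/\ forall x z, `|B x - B z| <= L * `|x - z|,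
      forall t i, 0 <= t -> measurable_fun setT (fun w => Y t w i 0),
      forall w i, {within `[0, +oo[, continuous (fun t => Y t w i 0)},
      \forall w \ae P, forall t, 0 <= t -> forall i, Y t w i 0 = c i 0 +
        \int[mu]_(s in `[0, t]) B (Y s w) i 0 + (S *m W t w) i 0 &
      forall t i, 0 <= t ->
        itg P (fun w => Y t w i 0 ^+ 2) /\ ex P (fun w => Y t w i 0 ^+ 2) <= M].

Lemma latent_coord_sde k r (W : R -> T -> 'cV[R]_r) (B : 'cV[R]_k -> 'cV[R]_k)
    (S : 'M[R]_(k, r)) c Y : latent_process P W B S c Y ->
  exists L M, [/\ 0 <= L, 0 <= M & coord_sde W B S c Y L M].
Proof.
move=> [[mY cY eY] [lB _ _] bm _].
have [L L0 LB] : exists2 L, 0 <= L & forall x z, `|B x - B z| <= L * `|x - z|.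
  near +oo_R => L; exists L; first by near: L; exact: nbhs_pinfty_ge.
  have lL : L.-lipschitz B by near: L.
  by move=> x z; exact: (lL (x, z) (conj I I)).
have mYi t i : 0 <= t -> measurable_fun setT (fun w => Y t w i 0).
  by move=> t0; apply: borel_coord_measurable; exact: mY.
have [M hM] := bm 2 ltac:(by []).
pose M' := Num.max M 0.
exists L, M'; split => //; first by rewrite le_max lexx orbT.
split => //.
- move=> w i t; apply: (@continuous_comp _ _ _ (Y ^~ w : subspace `[0, +oo[%classic -> _)
    (fun v : 'cV[R]_k => v i 0)); [exact: cY|exact: coord_continuous].
- apply: filterS eY => w ew t t0 i; rewrite ew//.
  by rewrite [LHS]mxE [X in X + _]mxE [(\col__ _) _ _]mxE.
- move=> t i t0; have := hM t t0.
  rewrite (_ : (fun w => `|Y t w| `^ 2) = fun w => `|Y t w| ^+ 2); last first.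
    by apply/funext => w; rewrite powR_mulrn.
  move=> le.
  have mn : measurable_fun setT (fun w => `|Y t w|).
    exact: (measurableT_comp (continuous_borel_measurable (@norm_continuous _ _)) (mY t t0)).
  have i2 : itg P (fun w => `|Y t w| ^+ 2).
    apply/integrableP; split; first by apply/measurable_EFinP; exact: measurable_funX.
    apply: le_lt_trans (ltry M); apply: le_trans le; rewrite unlock.
    rewrite le_eqVlt; apply/orP; left; apply/eqP; apply: eq_integral => w _.
    by rewrite gee0_abs// lee_fin exprn_ge0.
  have m2 : measurable_fun setT (fun w => Y t w i 0 ^+ 2) by apply: measurable_funX; exact: mYi.
  have le2 w : Y t w i 0 ^+ 2 <= `|Y t w| ^+ 2.
    by rewrite -real_normK ?num_real// lerXn2r ?nnegrE// coord_norm_le.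
  have iY : itg P (fun w => Y t w i 0 ^+ 2).
    by apply: (itg_le m2 _ i2) => w; rewrite ger0_norm ?sqr_ge0.
  split => //; apply: (le_trans (ex_le iY i2 le2)).
  rewrite expectationE// lee_fin in le; apply: (le_trans le).
  by rewrite le_max lexx.
Unshelve. all: by end_near. Qed.

(** The stacked drift acts blockwise, and for the sup norm its Lipschitz constant is the maximum of
    the two. *)
Lemma coord_sde_col k1 r1 k2 r2 (W1 : R -> T -> 'cV[R]_r1) (W2 : R -> T -> 'cV[R]_r2)
    (B1 : 'cV[R]_k1 -> 'cV[R]_k1) (B2 : 'cV[R]_k2 -> 'cV[R]_k2)
    (S1 : 'M[R]_(k1, r1)) (S2 : 'M[R]_(k2, r2)) c1 c2 Y1 Y2 L1 M1 L2 M2 :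
  0 <= L1 -> 0 <= L2 ->
  coord_sde W1 B1 S1 c1 Y1 L1 M1 -> coord_sde W2 B2 S2 c2 Y2 L2 M2 ->
  coord_sde (fun t w => col_mx (W1 t w) (W2 t w))
    (fun y => col_mx (B1 (usubmx y)) (B2 (dsubmx y)))
    (block_mx S1 0 0 S2) (col_mx c1 c2) (fun t w => col_mx (Y1 t w) (Y2 t w))
    (Num.max L1 L2) (Num.max M1 M2).
Proof.
move=> L10 L20 [l1 m1 y1 e1 b1] [l2 m2 y2 e2 b2]; split.
- have usub (x : 'cV[R]_(k1 + k2)) : `|usubmx x| <= `|x|.
    by apply: mx_norm_leP => // i j; rewrite mxE coord_norm_le.
  have dsub (x : 'cV[R]_(k1 + k2)) : `|dsubmx x| <= `|x|.
    by apply: mx_norm_leP => // i j; rewrite mxE coord_norm_le.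
  move=> x z; have n0 : 0 <= Num.max L1 L2 by rewrite le_max L10.
  apply: mx_norm_leP => [|i j]; first by rewrite mulr_ge0.
  rewrite opp_col_mx add_col_mx mxE; case: fintype.splitP => i' _.
    apply: (le_trans (coord_norm_le _ _ _)); apply: (le_trans (l1 _ _)).
    by rewrite ler_pM// ?le_max ?lexx// -linearB usub.
  apply: (le_trans (coord_norm_le _ _ _)); apply: (le_trans (l2 _ _)).
  by rewrite ler_pM// ?le_max ?lexx ?orbT// -linearB dsub.
- move=> t i t0; rewrite (_ : (fun w => _) = fun w =>
      match fintype.split i with inl a => Y1 t w a 0 | inr a => Y2 t w a 0 end).
    by case: (fintype.split i) => a; [exact: m1|exact: m2].
  by apply/funext => w; rewrite mxE.
- move=> w i; rewrite (_ : (fun t => _) = fun t =>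
      match fintype.split i with inl a => Y1 t w a 0 | inr a => Y2 t w a 0 end).
    by case: (fintype.split i) => a; [exact: y1|exact: y2].
  by apply/funext => t; rewrite mxE.
- apply: filterS2 e1 e2 => w e1 e2 t t0 i.
  rewrite mul_block_col !mul0mx addr0 add0r !mxE.
  under eq_Rintegral do rewrite mxE.
  case: (fintype.split i) => a.
    by rewrite e1//; congr (_ + _ + _); apply: eq_Rintegral => s _; rewrite col_mxKu.
  by rewrite e2//; congr (_ + _ + _); apply: eq_Rintegral => s _; rewrite col_mxKd.
- move=> t i t0; rewrite (_ : (fun w => _) = fun w =>
      match fintype.split i with inl a => Y1 t w a 0 | inr a => Y2 t w a 0 end ^+ 2); last first.
    by apply/funext => w; rewrite mxE.
  rewrite le_max; case: (fintype.split i) => a.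
    by have [h1 ->] := b1 t a t0.
  by have [h1 ->] := b2 t a t0; rewrite orbT.
Qed.

End coordinates.

Section merging.
Variables (d : measure_display) (T : measurableType d) (R : realType).
Variable P : probability T R.

Lemma sigma_process_coord r (W : R -> T -> 'cV[R]_r) i :
  sigma_process (fun t w => W t w i 0) `<=` sigma_process (W : R -> T -> borel_cV R r).
Proof.
apply: smallest_sub; first exact: smallest_sigma_algebra.
move=> _ [t t0 [A mA <-]]; apply: sub_sigma_algebra; exists t => //.
exists [set x : borel_cV R r | A ((x : 'cV[R]_r) i 0)] => //.
rewrite -[X in measurable X]setTI.
have mc : measurable_fun setT (fun x : borel_cV R r => (x : 'cV[R]_r) i 0).
  by apply: borel_coord_measurable; exact: measurable_id.
exact: mc.
Qed.

Lemma sigma_process_bigcap d' (T' : measurableType d') (W : R -> T -> T')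
    (I : finType) (J : {set I}) (A : I -> set T) :
  (forall i, i \in J -> sigma_process W (A i)) ->
  sigma_process W (\bigcap_(i in [set` J]) A i).
Proof.
move=> h; apply: (@fin_bigcap_measurable _ (g_sigma_algebraType
  [set B | exists2 t, 0 <= t & sigma_rv (W t) B]) I [set` J] A); first exact: finite_finset.
by move=> i; exact: h.
Qed.

(** Coordinate events are grouped by block: the groups are independent by [independent4], the
    coordinates within each block because it is a Wiener process. *)
Lemma wiener_col4 r1 r2 r3 r4 (W1 : R -> T -> 'cV[R]_r1) (W2 : R -> T -> 'cV[R]_r2)
    (W3 : R -> T -> 'cV[R]_r3) (W4 : R -> T -> 'cV[R]_r4) :
  wiener P W1 -> wiener P W2 -> wiener P W3 -> wiener P W4 ->
  independent4 P W1 W2 W3 W4 ->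
  wiener P (fun t w => col_mx (col_mx (W1 t w) (W2 t w)) (col_mx (W3 t w) (W4 t w))).
Proof.
move=> [b1 i1] [b2 i2] [b3 i3] [b4 i4] ind.
pose W t w := col_mx (col_mx (W1 t w) (W2 t w)) (col_mx (W3 t w) (W4 t w)).
pose j1 (a : 'I_r1) : 'I_((r1 + r2) + (r3 + r4)) := lshift _ (lshift _ a).
pose j2 (a : 'I_r2) : 'I_((r1 + r2) + (r3 + r4)) := lshift _ (rshift _ a).
pose j3 (a : 'I_r3) : 'I_((r1 + r2) + (r3 + r4)) := rshift _ (lshift _ a).
pose j4 (a : 'I_r4) : 'I_((r1 + r2) + (r3 + r4)) := rshift _ (rshift _ a).
have E1 a : (fun t w => W t w (j1 a) 0) = fun t w => W1 t w a 0.
  by apply/funext => t; apply/funext => w; rewrite /W col_mxEu col_mxEu.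
have E2 a : (fun t w => W t w (j2 a) 0) = fun t w => W2 t w a 0.
  by apply/funext => t; apply/funext => w; rewrite /W col_mxEu col_mxEd.
have E3 a : (fun t w => W t w (j3 a) 0) = fun t w => W3 t w a 0.
  by apply/funext => t; apply/funext => w; rewrite /W col_mxEd col_mxEu.
have E4 a : (fun t w => W t w (j4 a) 0) = fun t w => W4 t w a 0.
  by apply/funext => t; apply/funext => w; rewrite /W col_mxEd col_mxEd.
have cases (Q : 'I_((r1 + r2) + (r3 + r4)) -> Prop) :
    (forall a, Q (j1 a)) -> (forall a, Q (j2 a)) -> (forall a, Q (j3 a)) ->
    (forall a, Q (j4 a)) -> forall i, Q i.
  move=> q1 q2 q3 q4 i; rewrite -(fintype.splitK i); case: (fintype.split i) => a /=.
    by rewrite -(fintype.splitK a); case: (fintype.split a) => a' /=; [exact: q1|exact: q2].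
  by rewrite -(fintype.splitK a); case: (fintype.split a) => a' /=; [exact: q3|exact: q4].
split.
  by apply: cases => a; rewrite -?/(W _ _) ?E1 ?E2 ?E3 ?E4.
move=> J A JA.
pose J1 : {set 'I_r1} := [set a | j1 a \in J]%SET.
pose J2 : {set 'I_r2} := [set a | j2 a \in J]%SET.
pose J3 : {set 'I_r3} := [set a | j3 a \in J]%SET.
pose J4 : {set 'I_r4} := [set a | j4 a \in J]%SET.
pose D1 := \bigcap_(a in [set` J1]) A (j1 a).
pose D2 := \bigcap_(a in [set` J2]) A (j2 a).
pose D3 := \bigcap_(a in [set` J3]) A (j3 a).
pose D4 := \bigcap_(a in [set` J4]) A (j4 a).
have h1 a : a \in J1 -> sigma_process (fun t w => W1 t w a 0) (A (j1 a)).
  by rewrite inE -E1 => /JA.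
have h2 a : a \in J2 -> sigma_process (fun t w => W2 t w a 0) (A (j2 a)).
  by rewrite inE -E2 => /JA.
have h3 a : a \in J3 -> sigma_process (fun t w => W3 t w a 0) (A (j3 a)).
  by rewrite inE -E3 => /JA.
have h4 a : a \in J4 -> sigma_process (fun t w => W4 t w a 0) (A (j4 a)).
  by rewrite inE -E4 => /JA.
have s1 : sigma_process (W1 : R -> T -> borel_cV R r1) D1.
  by apply: sigma_process_bigcap => a aJ; exact: (sigma_process_coord (@h1 a aJ)).
have s2 : sigma_process (W2 : R -> T -> borel_cV R r2) D2.
  by apply: sigma_process_bigcap => a aJ; exact: (sigma_process_coord (@h2 a aJ)).
have s3 : sigma_process (W3 : R -> T -> borel_cV R r3) D3.
  by apply: sigma_process_bigcap => a aJ; exact: (sigma_process_coord (@h3 a aJ)).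
have s4 : sigma_process (W4 : R -> T -> borel_cV R r4) D4.
  by apply: sigma_process_bigcap => a aJ; exact: (sigma_process_coord (@h4 a aJ)).
have -> : \bigcap_(i in [set` J]) A i =
    \bigcap_(i in [set` [set: 'I_4]%SET]) tnth [tuple D1; D2; D3; D4] i.
  apply/seteqP; split => w /= h.
    move=> i _; case: i => -[|[|[|[|//]]]] ? /= a; rewrite /= inE => aJ; exact: h.
  have g (i : 'I_4) : tnth [tuple D1; D2; D3; D4] i w.
    by apply: h; rewrite /= finset.in_setT.
  apply: cases => a /= aJ.
  - by apply: (g (@Ordinal 4 0 isT)); rewrite /= inE.
  - by apply: (g (@Ordinal 4 1 isT)); rewrite /= inE.
  - by apply: (g (@Ordinal 4 2 isT)); rewrite /= inE.
  - by apply: (g (@Ordinal 4 3 isT)); rewrite /= inE.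
rewrite (ind [set: 'I_4]%SET (tnth [tuple D1; D2; D3; D4])); last first.
  by case=> -[|[|[|[|//]]]] ? _ /=.
rewrite (eq_bigl xpredT); last by move=> i; rewrite finset.in_setT.
rewrite !big_ord_recl big_ord0 mule1.
rewrite !(tnth_nth set0)/=.
rewrite (i1 _ _ h1) (i2 _ _ h2) (i3 _ _ h3) (i4 _ _ h4).
rewrite big_split_ord/= big_split_ord/= [X in (_ = _ * X)%E]big_split_ord/= !muleA.
congr (_ * _ * _ * _)%E; by apply: eq_bigl => a; rewrite inE.
Qed.

End merging.

Theorem theorem5 (R : realType) (d : measure_display) (T : measurableType d)
  (P : probability T R)
  (p1 p2 k1 k2 r1 r2 r3 r4 : nat)
  (hp1 : (1 <= p1)%N) (hp2 : (1 <= p2)%N) (hk1 : (1 <= k1)%N) (hk2 : (1 <= k2)%N)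
  (hr1 : (1 <= r1)%N) (hr2 : (1 <= r2)%N) (hr3 : (1 <= r3)%N) (hr4 : (1 <= r4)%N)
  (hkp1 : (k1 <= p1)%N) (hkp2 : (k2 <= p2)%N)
  (W1 : R -> T -> 'cV[R]_r1) (W2 : R -> T -> 'cV[R]_r2)
  (W3 : R -> T -> 'cV[R]_r3) (W4 : R -> T -> 'cV[R]_r4)
  (hW1 : wiener P W1) (hW2 : wiener P W2)
  (hW3 : wiener P W3) (hW4 : wiener P W4)
  (hW : independent4 P W1 W2 W3 W4)
  (B1 : 'cV[R]_k1 -> 'cV[R]_k1) (B2 : 'cV[R]_p1 -> 'cV[R]_p1)
  (B3 : 'cV[R]_p2 -> 'cV[R]_p2) (B4 : 'cV[R]_k2 -> 'cV[R]_k2)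
  (S1 : 'M[R]_(k1, r1)) (S2 : 'M[R]_(p1, r2))
  (S3 : 'M[R]_(p2, r3)) (S4 : 'M[R]_(k2, r4))
  (c1 : 'cV[R]_k1) (c2 : 'cV[R]_p1) (c3 : 'cV[R]_p2) (c4 : 'cV[R]_k2)
  (xi : R -> T -> 'cV[R]_k1) (delta : R -> T -> 'cV[R]_p1)
  (eps : R -> T -> 'cV[R]_p2) (zeta : R -> T -> 'cV[R]_k2)
  (hxi : latent_process P W1 B1 S1 c1 xi)
  (hdelta : latent_process P W2 B2 S2 c2 delta)
  (heps : latent_process P W3 B3 S3 c3 eps)
  (hzeta : latent_process P W4 B4 S4 c4 zeta)
  (Lx1 : 'M[R]_(p1, k1)) (Lx2 : 'M[R]_(p2, k2))
  (Gamma : 'M[R]_(k2, k1)) (B0 : 'M[R]_k2)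
  (hLx1 : \rank Lx1 = k1) (hB0 : forall i, B0 i i = 0)
  (hPsi : (1%:M - B0) \in unitmx)
  (hSdd : posdef (S2 *m S2^T)) (hSee : posdef (S3 *m S3^T))
  (eta : R -> T -> 'cV[R]_k2)
  (heta : forall t w, 0 <= t ->
    eta t w = B0 *m eta t w + Gamma *m xi t w + zeta t w)
  (h : nat -> R) (hpos : forall n, 0 < h n) :
  let p := (p1 + p2)%N in
  let Sxx := S1 *m S1^T in
  let Sdd := S2 *m S2^T in
  let See := S3 *m S3^T in
  let Szz := S4 *m S4^T in
  let iPsi := invmx (1%:M - B0) in
  let Sigma11 := Lx1 *m Sxx *m Lx1^T + Sdd in
  let Sigma12 := Lx1 *m Sxx *m Gamma^T *m iPsi^T *m Lx2^T in
  let Sigma22 :=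
    Lx2 *m iPsi *m (Gamma *m Sxx *m Gamma^T + Szz) *m iPsi^T *m Lx2^T + See in
  let Sigma0 : 'M[R]_p := block_mx Sigma11 Sigma12 Sigma12^T Sigma22 in
  let X : R -> T -> 'cV[R]_p := fun t w =>
    col_mx (Lx1 *m xi t w + delta t w) (Lx2 *m eta t w + eps t w) in
  let Q n := realized_cov X (h n) n in
  let Dplus := mpinv (dupmx R p) in
  h n @[n --> \oo] --> 0 ->
  n%:R * h n @[n --> \oo] --> +oo ->
  cvg_in_probability P \oo Q Sigma0 /\
  (n%:R * h n ^+ 2 @[n --> \oo] --> 0 ->
   exists2 mu : probability (borel_cV R (pbar p)) R,
     gaussian_law mu 0 (2 *: (Dplus *m (Sigma0 *t Sigma0) *m Dplus^T)) &
     cvg_in_distribution P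
       (fun n w => Num.sqrt n%:R *: (vech (Q n w) - vech Sigma0)) mu).
Proof.
move=> p Sxx Sdd See Szz iPsi Sigma11 Sigma12 Sigma22 Sigma0 X Q Dplus hcvg _.
have [L1 [M1 [L10 M10 q1]]] := latent_coord_sde hxi.
have [L2 [M2 [L20 M20 q2]]] := latent_coord_sde hdelta.
have [L3 [M3 [L30 M30 q3]]] := latent_coord_sde heps.
have [L4 [M4 [L40 M40 q4]]] := latent_coord_sde hzeta.
have L120 : 0 <= Num.max L1 L2 by rewrite le_max L10.
have L340 : 0 <= Num.max L3 L4 by rewrite le_max L30.
pose Y t w := col_mx (col_mx (xi t w) (delta t w)) (col_mx (eps t w) (zeta t w)).
pose W t w := col_mx (col_mx (W1 t w) (W2 t w)) (col_mx (W3 t w) (W4 t w)).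
pose S := block_mx (block_mx S1 0 0 S2) 0 0 (block_mx S3 0 0 S4).
have [LB mY cY eY hM] := coord_sde_col L120 L340
  (coord_sde_col L10 L20 q1 q2) (coord_sde_col L30 L40 q3 q4).
rewrite -/S in eY.
have W0 : wiener P W := wiener_col4 hW1 hW2 hW3 hW4 hW.
(* The structural equation is solved as eta = iPsi (Gamma xi + zeta), which makes X linear in the
   stacked vector (xi, delta, eps, zeta). *)
pose C : 'M[R]_(p1 + p2, (k1 + p1) + (p2 + k2)) :=
  block_mx (row_mx Lx1 1%:M) 0 (row_mx (Lx2 *m iPsi *m Gamma) 0) (row_mx 1%:M (Lx2 *m iPsi)).
have hX t w : 0 <= t -> X t w = C *m Y t w.
  move=> t0; rewrite /X /C /Y mul_block_col !mul_row_col !mul1mx !mul0mx !addr0.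
  have etaE : eta t w = iPsi *m (Gamma *m xi t w + zeta t w).
    have e := heta t w t0.
    rewrite -[LHS](mulKmx hPsi); congr (_ *m _).
    by apply/eqP; rewrite mulmxBl mul1mx subr_eq [X in _ == X]addrC addrA; apply/eqP.
  rewrite etaE; congr col_mx; rewrite mulmxDr mulmxDr !mulmxA.
  by rewrite -addrA [_ + eps t w]addrC.
have SE : Sigma0 = (C *m S) *m (C *m S)^T.
  have CS : C *m S = block_mx (row_mx (Lx1 *m S1) S2) 0
      (row_mx (Lx2 *m iPsi *m Gamma *m S1) 0) (row_mx S3 (Lx2 *m iPsi *m S4)).
    by rewrite /C /S mulmx_block !mul_row_block !mulmx0 !mul0mx !mul1mx !addr0 !add0r.
  rewrite CS tr_block_mx mulmx_block !tr_row_mx !mul_row_col.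
  rewrite !trmx0 !mulmx0 !mul0mx !addr0.
  rewrite /Sigma0 /Sigma11 /Sigma12 /Sigma22 /Sxx /Sdd /See /Szz.
  rewrite !trmx_mul !trmxK !mulmxA mulmxDr !mulmxDl !mulmxA.
  by congr block_mx; rewrite -addrA; congr (_ + _); rewrite addrC.
have M0 : 0 <= Num.max (Num.max M1 M2) (Num.max M3 M4) by rewrite !le_max M10.
have L0 : 0 <= Num.max (Num.max L1 L2) (Num.max L3 L4) by rewrite le_max L120.
rewrite SE; split.
  exact: (realized_cov_cvg W0 L0 LB mY cY eY M0 hM hX hpos hcvg).
move=> nh.
(* The Gaussian variables are cut from the first coordinate of [W1], which exists by [hr1]. *)
exact: (realized_cov_clt W0 L0 LB mY cY eY M0 hM hX hpos hcvg nh
  (lshift _ (lshift _ (Ordinal hr1)))).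
Qed.
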